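(* In dimension $d=2$, the number $T_n$ of particles at a typical site at time $n$ is, conditional on the event $G_n$, of order $O_P(\log n)$. Moreover, for some sufficiently small $\varepsilon>0$ there exists $\delta>0$ such that $$\liminf_{n\to\infty}P(T_n\ge\varepsilon\log n\mid G_n)\ge\delta.$$
   Context: Branching random walk: a nearest neighbor branching random walk on $\mathbb{Z}^d$ with offspring distribution $\mathcal{Q}=\{Q_l\}_{l\ge 0}$ evolves as follows: at each time $n=0,1,2,\dots$ every particle independently produces a random number of offspring with law $\mathcal{Q}$ (which replace it), and each offspring independently moves to a site chosen uniformly at random from the $2d+1$ sites at distance $\le 1$ from the location of its parent. Standing assumptions: $\mathcal{Q}$ has mean $1$ (criticality) and finite, positive variance $\sigma^2$; the process is started by a single particle at the origin at time $0$. Notation: $\mathcal{Z}_n$ is the set of particles in generation $n$; $G_n$ is the event that the process survives to generation $n$ (i.e. $\mathcal{Z}_n\ne\emptyset$). On $G_n$, a typical particle is a particle chosen from $\mathcal{Z}_n$ uniformly at random, the choice being made independently of the evolution of the branching random walk up to time $n$; a typical site is the location of a typical particle. $T_n$ is the total number of generation-$n$ particles at the typical site. For random variables $X_n$, positive reals $f(n)$ and events $H_n$ of positive probability: $X_n=O_P(f(n))$ given $H_n$ means that the conditional distributions of $X_n/f(n)$ given $H_n$ are tight. *)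

(* Defs.v *)
From HB Require Import structures.
From mathcomp Require Export all_boot all_order all_algebra.
From mathcomp Require Export all_classical all_reals all_analysis.

Set Implicit Arguments.
Unset Strict Implicit.
Unset Printing Implicit Defensive.

Import Order.TTheory GRing.Theory Num.Theory.
Import numFieldNormedType.Exports.

Local Open Scope classical_set_scope.
Local Open Scope ring_scope.

(* Junk value 0 when P B = 0. *)
Definition cond_prob (disp : measure_display) (Omega : measurableType disp)
    (R : realType) (P : probability Omega R) (A B : set Omega) : R :=
  fine (P (A `&` B)) / fine (P B).

Definition tight (R : realType) (I : Type) (J : set I) (mu : I -> set R -> R) :
    Prop :=
  forall eps : R, 0 < eps ->
    exists K : set R, compact K /\ forall i, J i -> mu i (~` K) <= eps.

(* X_n = O_P(f(n)) given H_n.  The indices with f n <= 0 are left out, so that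
   f may be, for instance, n |-> ln n, which is positive only from n = 2 on. *)
Definition bigOP (disp : measure_display) (Omega : measurableType disp)
    (R : realType) (P : probability Omega R) (X : nat -> Omega -> R)
    (f : nat -> R) (H : nat -> set Omega) : Prop :=
  tight [set n | 0 < f n]
    (fun n B => cond_prob P [set w | B (X n w / f n)] (H n)).

(* Random element of a countable set with its discrete sigma-algebra. *)
Definition discrete_rv (disp : measure_display) (Omega : measurableType disp)
    (E : Type) (X : Omega -> E) : Prop :=
  forall A : set E, measurable (X @^-1` A).

Definition critical_offspring (R : realType) (Q : probability nat R)
    (sigma2 : R) : Prop :=
  [/\ ('E_Q[fun l : nat => l%:R] = 1)%E,
      'V_Q[fun l : nat => l%:R] = sigma2%:E & 0 < sigma2].

(* Ulam-Harris labels: [::] is the initial particle, and rcons u i is the i-th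
   child (counted from 0) of the particle u. *)
Definition label : Type := seq nat.

Definition site (dim : nat) : Type := 'rV[int]_dim.

(* The sites at distance at most 1 from the origin; there are 2 dim + 1. *)
Definition neighborhood0 (dim : nat) (e : site dim) : bool :=
  (\sum_(i < dim) `|e ord0 i|%N <= 1)%N.

(* The randomness driving the process: nchild u is the number of offspring of
   the particle u, and step u is its displacement from its parent.  Both are
   given for all labels, including those that are never born; step [::] plays
   no role.  The product formula with arbitrary A, B (possibly setT) is the
   mutual independence of the whole family (nchild u, step u)_u. *)
Record brw_driver (disp : measure_display) (Omega : measurableType disp)
    (R : realType) (P : probability Omega R) (dim : nat)
    (Q : probability nat R) (nchild : label -> Omega -> nat)
    (step : label -> Omega -> site dim) : Prop := BrwDriver {
  brw_nchild_rv : forall u, discrete_rv (nchild u);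
  brw_step_rv : forall u, discrete_rv (step u);
  brw_nchild_law : forall u (A : set nat), P (nchild u @^-1` A) = Q A;
  brw_step_law : forall u (e : site dim),
    P (step u @^-1` [set e]) =
    (if neighborhood0 e then (2 * dim + 1)%:R^-1 else 0)%:E;
  brw_indep : forall (s : seq label) (A : label -> set nat)
      (B : label -> set (site dim)), uniq s ->
    P [set w | forall u, u \in s -> A u (nchild u w) /\ B u (step u w)] =
    (\prod_(u <- s) (P (nchild u @^-1` A u) * P (step u @^-1` B u)))%E }.

(* The set Z_n, as a duplicate-free sequence. *)
Fixpoint generation (Omega : Type) (nchild : label -> Omega -> nat) (n : nat)
    (w : Omega) : seq label :=
  if n is n'.+1 then
    flatten [seq [seq rcons u i | i <- iota 0 (nchild u w)]
            | u <- generation nchild n' w]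
  else [:: [::]].

Definition position (Omega : Type) (dim : nat)
    (step : label -> Omega -> site dim) (u : label) (w : Omega) : site dim :=
  \sum_(k < size u) step (take k.+1 u) w.

Definition survival (Omega : Type) (nchild : label -> Omega -> nat) (n : nat) :
    set Omega :=
  [set w | generation nchild n w != [::]].

(* The evolution up to time n: generations 0, ..., n with the locations of
   their particles (labels encode the genealogy). *)
Definition history (Omega : Type) (dim : nat)
    (nchild : label -> Omega -> nat) (step : label -> Omega -> site dim)
    (n : nat) (w : Omega) : seq (seq (label * site dim)) :=
  [seq [seq (u, position step u w) | u <- generation nchild k w]
  | k <- iota 0 n.+1].

(* V n is a typical particle of generation n: conditionally on each possible
   evolution h up to time n, it is uniform on the particles of the last
   generation of h.  Nothing is required off the survival event. *)
Definition typical_particle (disp : measure_display)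
    (Omega : measurableType disp) (R : realType) (P : probability Omega R)
    (dim : nat) (nchild : label -> Omega -> nat)
    (step : label -> Omega -> site dim) (V : nat -> Omega -> label) : Prop :=
  forall n, discrete_rv (V n) /\
    forall (h : seq (seq (label * site dim))) (u : label),
      u \in unzip1 (last [::] h) ->
      P [set w | history nchild step n w = h /\ V n w = u] =
      (((size (last [::] h))%:R^-1)%:E *
        P [set w | history nchild step n w = h])%E.

(* T_n: the number of generation-n particles at the location of V n. *)
Definition typical_count (Omega : Type) (dim : nat)
    (nchild : label -> Omega -> nat) (step : label -> Omega -> site dim)
    (V : nat -> Omega -> label) (n : nat) (w : Omega) : nat :=
  count (fun v => position step v w == position step (V n w) w)
    (generation nchild n w).

(* Main.v *)
(* Given the evolution up to time n, the typical particle is uniform on the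
   generation Z_n, so that P(T_n >= t, G_n) = E[Y_t / Z_n; G_n], where Y_t is
   the number of particles u whose site carries N_u >= t particles.

   Upper bound. Y_t <= sum_u N_u / t, and sum_u N_u counts the pairs of
   particles at the same site, whose expectation is 1 + sigma^2 times the sum
   over j = 1..n of the probability that two independent walks meet at time j,
   that is, O(log n) in dimension 2. Moreover P(G_n) >= c / n by the second
   moment method, while P(0 < Z_n <= eps n) <= C eps / n: if f is the offspring
   generating function and q_k = P(G_k), then E (1 - q_k)^Z_n = 1 - q_(n+k),
   and q_n - q_(n+k) <= C k q_n^2.

   Lower bound. Let N'_u count only the particles at the site of u which
   descend from the child of index 1 - i of an ancestor of u, where i is the
   index (0 or 1) of the child of this ancestor in the lineage of u. With this
   truncation, E sum_u N'_u >= c log n and E sum_u N'_u^2 <= C (log n)^2 need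
   two moments of the offspring law only. Comparing the two, together with
   E Z_n^2 = 1 + n sigma^2, gives the bound E[Y_(eps log n) / Z_n] >= c / n,
   and P(G_n) <= C / n. *)

Require Import Defs.
From mathcomp Require Import measurable_realfun ring lra zify.
Import Order.TTheory GRing.Theory Num.Theory.
Import numFieldNormedType.Exports.
Local Open Scope classical_set_scope.
Local Open Scope ring_scope.

Set Implicit Arguments.
Unset Strict Implicit.
Unset Printing Implicit Defensive.

(** * The simple random walk on the integers *)

(** Only the variance of the offspring law is finite, so triples of siblings may have infinite
    expected number, and so may the sum of the squares N_u^2. The truncation removes them: two
    relatives of u that leave its lineage at the same ancestor do so through the same child, hence
    each branching involves at most two children of a particle.

    Moments come from a backward recursion instead of a choice of lineages. The expected sum of a
    kernel over pairs (or triples) of generation n + 1 is the expected sum over generation n of the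
    kernel averaged over one step of independent walks, plus terms for the tuples that separate at
    this branching. The coincidence kernel is translation invariant, so on the diagonal it is a
    number depending on time only, and the recursion adds up these numbers. They lie between two
    multiples of 1 / (n + 1), whence the logarithm.

    Conditioning on the past is done by integrating over the countably many cells on which the past
    is constant. *)

Lemma leq_bin_step n k : (k.*2 < n)%N -> ('C(n, k) <= 'C(n, k.+1))%N.
Proof.
move=> kn; rewrite -(@leq_pmul2l k.+1)// mul_bin_left leq_mul2r.
by apply/orP; right; lia.
Qed.

Lemma leq_bin_central i k : ('C(i.*2, k) <= 'C(i.*2, i))%N.
Proof.
have H j : (j <= i)%N -> ('C(i.*2, i - j) <= 'C(i.*2, i))%N.
  elim: j => [|j IH] ji; first by rewrite subn0.
  apply: leq_trans (IH (ltnW ji)).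
  have -> : (i - j = (i - j.+1).+1)%N by lia.
  by apply: leq_bin_step; lia.
have [ki|ik] := leqP k i; first by rewrite -(subKn ki) H// leq_subr.
have [k2|k2] := leqP k i.*2; last by rewrite bin_small.
rewrite -bin_sub//; have -> : (i.*2 - k = i - (k - i))%N by lia.
by apply: H; lia.
Qed.

Lemma mul_bin_central i :
  (i.+1 * 'C(i.+1.*2, i.+1) = (i.*2.+1).*2 * 'C(i.*2, i))%N.
Proof.
have := mul_bin_diag i.+1.*2 i; rewrite doubleS /= => <-.
by have := mul_bin_down i.*2.+1 i; rewrite /=; nia.
Qed.

(** The bound 1 / sqrt (2 i + 1) for the return probability at time 2 i, squared to stay in the
    integers. The induction step amounts to (2 i + 3) (2 i + 1) <= 4 (i + 1)^2. *)
Lemma bin_central_sqr i : (i.*2.+1 * 'C(i.*2, i) ^ 2 <= 4 ^ i.*2)%N.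
Proof.
elim: i => // i IH.
have e := mul_bin_central i; set D := 'C(i.*2, i) in IH e *.
set D' := 'C(_, _) in e *.
rewrite -(@leq_pmul2l (i.+1 ^ 2)) ?expn_gt0//.
have -> : (i.+1 ^ 2 * (i.+1.*2.+1 * D' ^ 2) =
  i.+1.*2.+1 * ((i.*2.+1).*2 * D) ^ 2)%N by rewrite -e; ring.
rewrite doubleS !expnS -doubleS; move: IH; set W := (4 ^ i.*2)%N => IH.
apply: (@leq_trans (16 * i.+1 ^ 2 * (i.*2.+1 * D ^ 2))%N); last by nia.
rewrite [leqLHS](_ : _ =
   i.+1.*2.+1 * i.*2.+1 * 4 * (i.*2.+1 * D ^ 2))%N; last first.
  by rewrite -!muln2; ring.
by rewrite leq_mul2r; apply/orP; right; nia.
Qed.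

Section simple_walk.
Context {R : realFieldType}.

(** The probability that the simple walk started at 0 is at [x] after [m] steps. *)
Fixpoint srw (m : nat) (x : int) : R :=
  if m is m'.+1 then (srw m' (x - 1) + srw m' (x + 1)) / 2 else (x == 0)%:R.

Lemma srw_far m x : x < - m%:Z -> srw m x = 0.
Proof.
elim: m x => [|m IH] x xm /=.
  by rewrite (_ : (x == 0) = false)//; apply/negbTE; rewrite lt_eqF.
by rewrite !IH ?addr0 ?mul0r//; lia.
Qed.

(** With k steps up the walk ends at 2 k - m, so [j] must be even and k is its half. *)
Lemma srw_bin m j :
  srw m (j%:Z - m%:Z) = if odd j then 0 else 'C(m, j./2)%:R / 2 ^+ m.
Proof.
elim: m j => [|m IH] j /=.
  rewrite subr0; case: j => [|[|j]] /=.
  - by rewrite bin0 expr0 divr1.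
  - by [].
  - by rewrite bin0n mul0r if_same.
case: j => [|[|j]] /=.
- rewrite srw_far ?add0r; last by lia.
  rewrite [X in srw m X](_ : _ = 0%:Z - m%:Z); last by lia.
  by rewrite IH /= !bin0 exprS invfM; field.
- rewrite srw_far ?add0r; last by lia.
  rewrite [X in srw m X](_ : _ = 1%:Z - m%:Z); last by lia.
  by rewrite IH /= mul0r.
- rewrite [X in srw m X + _](_ : _ = j%:Z - m%:Z); last by lia.
  rewrite [X in _ + srw m X](_ : _ = j.+2%:Z - m%:Z); last by lia.
  rewrite !IH /= negbK; case: ifP => _; first by rewrite addr0 mul0r.
  rewrite binS natrD exprS; field.
  by rewrite expf_neq0.
Qed.

Lemma srw_ge0 m x : 0 <= srw m x.
Proof.
elim: m x => [|m IH] x /=; first by rewrite ler0n.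
by apply: divr_ge0 => //; apply: addr_ge0.
Qed.

Lemma srw_even_le i x : srw i.*2 x <= 'C(i.*2, i)%:R / 2 ^+ i.*2.
Proof.
have [lt|] := ltP x (- i.*2%:Z).
  by rewrite srw_far// divr_ge0// exprn_ge0.
move=> h; have -> : x = (absz (x + i.*2%:Z))%:Z - i.*2%:Z by lia.
rewrite srw_bin; case: ifP => _; first by rewrite divr_ge0// exprn_ge0.
by rewrite ler_pM2r ?invr_gt0 ?exprn_gt0// ler_nat leq_bin_central.
Qed.

(** The planar kernel is a mixture of products of two such values, so a bound on squares is what is
    needed. At odd times the value is the mean of two values at an even time, and squaring is
    convex. *)
Lemma srw_sqr_le m x : srw m x ^+ 2 <= 2 / m.+1%:R.
Proof.
have even i y : srw i.*2 y ^+ 2 <= i.*2.+1%:R^-1.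
  apply: (@le_trans _ _ (('C(i.*2, i)%:R / 2 ^+ i.*2) ^+ 2)).
    by rewrite ler_pXn2r// ?nnegrE ?srw_ge0 ?srw_even_le// divr_ge0// exprn_ge0.
  rewrite expr_div_n ler_pdivrMr ?exprn_gt0// ler_pdivlMl ?ltr0n//.
  rewrite -exprM mulnC exprM -natrX -natrX -natrX -natrM ler_nat.
  exact: bin_central_sqr.
rewrite -(odd_double_half m); case: (odd m); last first.
  rewrite add0n; apply: le_trans (even _ _) _.
  by rewrite -[leLHS]mul1r ler_pM2r ?invr_gt0 ?ltr0n// ler1n.
rewrite add1n /=; set a := srw _ _; set b := srw _ _.
have := even m./2 (x - 1); have := even m./2 (x + 1); rewrite -/a -/b => hb ha.
set i := m./2 in ha hb *.
have H : i.*2.+1%:R^-1 <= 2 / i.*2.+2%:R :> R.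
  by rewrite ler_pdivlMr ?ltr0n// mulrC ler_pdivrMr ?ltr0n// -natrM ler_nat; lia.
apply: le_trans H; set c := _^-1 in ha hb *.
have -> : ((a + b) / 2) ^+ 2 = (a ^+ 2 + b ^+ 2) / 2 - ((a - b) / 2) ^+ 2 by field.
by have := sqr_ge0 ((a - b) / 2); lra.
Qed.

End simple_walk.

(** * The lazy nearest neighbor walk on the square lattice *)

Definition mksite (a b : int) : site 2 := \row_j (if j == ord0 then a else b).

Definition nbhd : seq (site 2) :=
  [:: mksite 0 0; mksite 1 0; mksite (-1) 0; mksite 0 1; mksite 0 (-1)].

Section walk_operator.
Context {R : realFieldType}.
Implicit Types f g : site 2 -> R.

(** The transition operator of the walk: its n-th iterate at [x] is the expectation of [f] at time n
    for the walk started at [x]. Random walks enter only through these iterates, never as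
    processes. *)
Definition walk_op f (x : site 2) : R := 5^-1 * \sum_(e <- nbhd) f (x + e).

Lemma eq_walk_op f g x : (forall y, f y = g y) -> walk_op f x = walk_op g x.
Proof. by move=> fg; congr (_ * _); apply: eq_bigr => e _; rewrite fg. Qed.

Lemma le_walk_op f g x : (forall y, f y <= g y) -> walk_op f x <= walk_op g x.
Proof. by move=> fg; rewrite ler_pM2l ?invr_gt0//; apply: ler_sum. Qed.

Lemma walk_op_cst (c : R) x : walk_op (fun=> c) x = c.
Proof. by rewrite /walk_op !big_cons big_nil; field. Qed.

Lemma walk_op_sum (I : Type) (s : seq I) (F : I -> site 2 -> R) x :
  walk_op (fun y => \sum_(i <- s) F i y) x = \sum_(i <- s) walk_op (F i) x.
Proof. by rewrite /walk_op exchange_big -mulr_sumr. Qed.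

Lemma walk_opZ (c : R) f x : walk_op (fun y => c * f y) x = c * walk_op f x.
Proof. by rewrite /walk_op -mulr_sumr mulrCA. Qed.

Lemma walk_op_exchange (F : site 2 -> site 2 -> R) x y :
  walk_op (fun x' => walk_op (F x') y) x =
  walk_op (fun y' => walk_op (F^~ y') x) y.
Proof.
rewrite /walk_op -!mulr_sumr; congr (_ * (_ * _)).
exact: exchange_big.
Qed.

Lemma eq_iter_walk_op n f g x :
  (forall y, f y = g y) -> iter n walk_op f x = iter n walk_op g x.
Proof.
by move=> fg; elim: n x => [|n IH] x /=; [exact: fg | exact: eq_walk_op].
Qed.

Lemma le_iter_walk_op n f g x :
  (forall y, f y <= g y) -> iter n walk_op f x <= iter n walk_op g x.
Proof.
by move=> fg; elim: n x => [|n IH] x /=; [exact: fg | exact: le_walk_op].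
Qed.

Lemma iter_walk_op_cst n (c : R) x : iter n walk_op (fun=> c) x = c.
Proof.
elim: n x => [|n IH] x //=.
by rewrite (@eq_walk_op _ (fun=> c))// walk_op_cst.
Qed.

Lemma iter_walk_op_sum n (I : Type) (s : seq I) (F : I -> site 2 -> R) x :
  iter n walk_op (fun y => \sum_(i <- s) F i y) x =
  \sum_(i <- s) iter n walk_op (F i) x.
Proof.
elim: n x => [|n IH] x //=.
by rewrite (eq_walk_op _ IH) walk_op_sum.
Qed.

Lemma iter_walk_opZ n (c : R) f x :
  iter n walk_op (fun y => c * f y) x = c * iter n walk_op f x.
Proof.
elim: n x => [|n IH] x //=.
by rewrite (eq_walk_op _ IH) walk_opZ.
Qed.

Lemma iter_walk_op_ge0 n f x : (forall y, 0 <= f y) -> 0 <= iter n walk_op f x.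
Proof.
by move=> f0; rewrite -(iter_walk_op_cst n 0 x); exact: le_iter_walk_op.
Qed.

Lemma walk_op_shift f a x : walk_op (fun y => f (y + a)) x = walk_op f (x + a).
Proof. by congr (_ * _); apply: eq_bigr => e _; rewrite addrAC. Qed.

Lemma iter_walk_op_shift n f a x :
  iter n walk_op (fun y => f (y + a)) x = iter n walk_op f (x + a).
Proof.
elim: n x => [|n IH] x //=.
by rewrite (eq_walk_op _ IH) walk_op_shift.
Qed.

Lemma walk_op_iter_exchange n (F : site 2 -> site 2 -> R) x y :
  walk_op (fun x' => iter n walk_op (F x') y) x =
  iter n walk_op (fun y' => walk_op (F^~ y') x) y.
Proof.
elim: n y => [|n IH] y //=.
by rewrite walk_op_exchange; apply: eq_walk_op => y'; rewrite IH.
Qed.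

Lemma iter_walk_op_exchange m n (F : site 2 -> site 2 -> R) x y :
  iter m walk_op (fun x' => iter n walk_op (F x') y) x =
  iter n walk_op (fun y' => iter m walk_op (F^~ y') x) y.
Proof.
elim: m x => [|m IH] x //=.
by rewrite (eq_walk_op _ IH) walk_op_iter_exchange.
Qed.

Definition pair_op (F : site 2 -> site 2 -> R) x y : R :=
  walk_op (fun x' => walk_op (F x') y) x.

Definition triple_op (F : site 2 -> site 2 -> site 2 -> R) x y z : R :=
  walk_op (fun x' => walk_op (fun y' => walk_op (F x' y') z) y) x.

(** Independent walks can be run one after the other, so that one-walk bounds apply with the other
    walk frozen. *)
Lemma iter_pair_opE n (F : site 2 -> site 2 -> R) x y :
  iter n pair_op F x y = iter n walk_op (fun x' => iter n walk_op (F x') y) x.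
Proof.
elim: n x y => [|n IH] x y //=; rewrite /pair_op.
apply: eq_walk_op => x'; rewrite (eq_walk_op _ (IH x')).
by rewrite walk_op_iter_exchange.
Qed.

Lemma iter_triple_opE n (F : site 2 -> site 2 -> site 2 -> R) x y z :
  iter n triple_op F x y z = iter n walk_op (fun x' =>
    iter n walk_op (fun y' => iter n walk_op (F x' y') z) y) x.
Proof.
elim: n x y z => [|n IH] x y z //=; rewrite /triple_op.
apply: eq_walk_op => x'.
under eq_walk_op => y' do rewrite (eq_walk_op _ (IH x' y')).
under eq_walk_op => y' do rewrite walk_op_iter_exchange.
rewrite walk_op_iter_exchange; apply: eq_iter_walk_op => x''.
apply: eq_walk_op => y'; rewrite walk_op_iter_exchange.
by [].
Qed.

Definition diag2 (x y : site 2) : R := (x == y)%:R.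
Definition diag3 (x y z : site 2) : R := diag2 x y * diag2 x z.

Definition coordsum (x : site 2) : int := x ord0 ord0 + x ord0 ord_max.
Definition coorddiff (x : site 2) : int := x ord0 ord0 - x ord0 ord_max.

Lemma coordsumD x y : coordsum (x + y) = coordsum x + coordsum y.
Proof. by rewrite /coordsum !mxE; ring. Qed.

Lemma coorddiffD x y : coorddiff (x + y) = coorddiff x + coorddiff y.
Proof. by rewrite /coorddiff !mxE; ring. Qed.

Lemma coordsum_mksite a b : coordsum (mksite a b) = a + b.
Proof. by rewrite /coordsum !mxE. Qed.

Lemma coorddiff_mksite a b : coorddiff (mksite a b) = a - b.
Proof. by rewrite /coorddiff !mxE. Qed.

Lemma site2P (x y : site 2) :
  x ord0 ord0 = y ord0 ord0 -> x ord0 ord_max = y ord0 ord_max -> x = y.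
Proof.
move=> e0 e1; apply/rowP => -[[|[|//]] lt].
- by rewrite (_ : Ordinal lt = ord0)//; exact: val_inj.
- by rewrite (_ : Ordinal lt = ord_max)//; exact: val_inj.
Qed.

Lemma coord_eq0 x : (x == 0) = (coordsum x == 0) && (coorddiff x == 0).
Proof.
apply/eqP/andP => [->|[/eqP s0 /eqP d0]].
  by rewrite /coordsum /coorddiff !mxE.
by move: s0 d0; rewrite /coordsum /coorddiff => s0 d0;
  apply: site2P; rewrite !mxE; lia.
Qed.

(* In the coordinates [(a + b, a - b)] a nonlazy step moves both coordinates by
   independent signs; [m] is the number of nonlazy steps. *)
Lemma heat_kernelE n x :
  iter n walk_op (fun y => (y == 0)%:R) x = \sum_(m < n.+1)
    'C(n, m)%:R * 4 ^+ m / 5 ^+ n *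
      (srw m (coordsum x) * srw m (coorddiff x)) :> R.
Proof.
elim: n x => [|n IH] x.
  rewrite big_ord1 /= bin0 !expr0 invr1 !mul1r coord_eq0.
  by rewrite -natrM mulnb.
rewrite iterS (eq_walk_op _ IH) walk_op_sum.
pose g m : R := srw m (coordsum x) * srw m (coorddiff x).
have Kg m : walk_op (fun y => srw m (coordsum y) * srw m (coorddiff y)) x =
    5^-1 * g m + 4 / 5 * g m.+1.
  rewrite /walk_op !big_cons big_nil !coordsumD !coorddiffD.
  rewrite !coordsum_mksite !coorddiff_mksite /g /=.
  rewrite ?(addr0, add0r, subr0, sub0r, opprK).
  by field.
under eq_bigr do rewrite walk_opZ Kg.
pose W n' m : R := 'C(n', m)%:R * 4 ^+ m / 5 ^+ n'.
rewrite (eq_bigr (fun m : 'I_n.+1 => W n m / 5 * g m + 4 / 5 * W n m * g m.+1));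
  last by move=> m _; rewrite -/(W n m); set w := W n m; field.
rewrite big_split /=.
have -> : \sum_(m < n.+1) W n m / 5 * g m = \sum_(m < n.+2) W n m / 5 * g m.
  by rewrite [RHS]big_ord_recr /= [W n n.+1]/W bin_small// !mul0r addr0.
rewrite big_ord_recl [RHS]big_ord_recl -addrA -big_split.
congr (_ + _).
  by rewrite /g /W /bump /= !bin0 exprS; field; rewrite expf_neq0.
apply: eq_bigr => m _; cbv beta; rewrite -/(g _) !lift0 /W binS natrD !exprS; set a := g _ => /=.
by field; rewrite expf_neq0.
Qed.

(** The product of the two one-dimensional kernels is at most 2 / (m + 1). With M binomial of
    parameters n and 4/5 (the number of nonlazy steps), the mean of 1 / (M + 1) is at most 5 / (4 (n
    + 1)), because 'C(n, m) / (m + 1) = 'C(n + 1, m + 1) / (n + 1). *)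
Lemma heat_kernel_le n y x :
  iter n walk_op (fun z => (z == y)%:R) x <= 5 / 2 / n.+1%:R.
Proof.
have -> : iter n walk_op (fun z => (z == y)%:R) x =
          iter n walk_op (fun z => (z == 0)%:R) (x - y) :> R.
  rewrite -iter_walk_op_shift; apply: eq_iter_walk_op => z.
  by rewrite subr_eq0.
rewrite heat_kernelE.
apply: (@le_trans _ _ (\sum_(m < n.+1)
    5 / 2 / n.+1%:R * ('C(n.+1, m.+1)%:R * 4 ^+ m.+1 / 5 ^+ n.+1))).
  apply: ler_sum => m _; set a := srw _ _; set b := srw _ _.
  have ab : a * b <= 2 / m.+1%:R.
    have := srw_sqr_le (R := R) m (coordsum (x - y)).
    have := srw_sqr_le (R := R) m (coorddiff (x - y)).
    have := sqr_ge0 (a - b); rewrite -/a -/b; set c := _ / _.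
    by rewrite sqrrB; lra.
  have -> : 'C(n.+1, m.+1)%:R = n.+1%:R * 'C(n, m)%:R / m.+1%:R :> R.
    by rewrite -natrM (mul_bin_diag n.+1 m) natrM mulrC mulKf// pnatr_eq0.
  apply: le_trans (_ : _ <= 'C(n, m)%:R * 4 ^+ m / 5 ^+ n * (2 / m.+1%:R)) _.
    by rewrite ler_wpM2l// divr_ge0 ?exprn_ge0// mulr_ge0 ?exprn_ge0 ?ler0n.
  rewrite le_eqVlt; apply/orP; left; apply/eqP; rewrite !exprS; field.
  by rewrite expf_neq0 //= !nat1r !pnatr_eq0.
rewrite -mulr_sumr ler_piMr// ?divr_ge0// -mulr_suml ler_pdivrMr ?exprn_gt0//.
rewrite mul1r (_ : 5 = 1 + 4 :> R); last by ring.
rewrite exprDn [leRHS]big_ord_recl /=.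
rewrite ler_wpDl// ?mulrn_wge0// ?mulr_ge0 ?exprn_ge0//.
by apply: ler_sum => m _; rewrite expr1n mul1r mulr_natl.
Qed.

End walk_operator.

(** * Meeting probabilities of two and three independent walks *)

Section meeting_probabilities.
Context {R : realFieldType}.

Lemma iter_walk_op_diag2_le n (x y : site 2) :
  iter n walk_op (diag2 x) y <= 5 / 2 / n.+1%:R :> R.
Proof.
rewrite (@eq_iter_walk_op _ _ _ (fun z => (z == x)%:R)); last first.
  by move=> z; rewrite /diag2 eq_sym.
exact: heat_kernel_le.
Qed.

Lemma iter_pair_op_diag2_le n (x y : site 2) :
  iter n pair_op diag2 x y <= 5 / 2 / n.+1%:R :> R.
Proof.
rewrite iter_pair_opE.
apply: (@le_trans _ _ (iter n walk_op (fun=> 5 / 2 / n.+1%:R) x)).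
  by apply: le_iter_walk_op => x'; exact: iter_walk_op_diag2_le.
by rewrite iter_walk_op_cst.
Qed.

Lemma iter_pair_op_diag2_ge0 n (x y : site 2) : 0 <= iter n pair_op diag2 x y :> R.
Proof.
rewrite iter_pair_opE; apply: iter_walk_op_ge0 => x'.
by apply: iter_walk_op_ge0 => y'; rewrite ler0n.
Qed.

Lemma iter_pair_op_diag2xx n (x : site 2) :
  iter n pair_op diag2 x x = iter n pair_op diag2 0 0 :> R.
Proof.
rewrite !iter_pair_opE.
rewrite -[in LHS](add0r x) -[LHS]iter_walk_op_shift.
apply: eq_iter_walk_op => x'.
rewrite -[in LHS](add0r x) -iter_walk_op_shift.
by apply: eq_iter_walk_op => y'; rewrite /diag2 add0r (inj_eq (addIr _)).
Qed.

(** With the first two walks frozen, the third one must hit their common site, which costs one more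
    heat kernel factor uniformly in that site. *)
Lemma iter_triple_op_diag3_le n (x y z : site 2) :
  iter n triple_op diag3 x y z <=
  5 / 2 / n.+1%:R * iter n pair_op diag2 x y :> R.
Proof.
rewrite iter_triple_opE iter_pair_opE -iter_walk_opZ.
apply: le_iter_walk_op => x'; rewrite -iter_walk_opZ.
apply: le_iter_walk_op => y'; rewrite iter_walk_opZ mulrC.
by rewrite ler_wpM2r ?ler0n// iter_walk_op_diag2_le.
Qed.

(** Lets the previous bound single out the second walk instead of the third, as is needed when the
    first two start from the same site. *)
Lemma iter_triple_op_diag3_swap n (x y z : site 2) :
  iter n triple_op diag3 x y z = iter n triple_op diag3 x z y :> R.
Proof.
rewrite !iter_triple_opE; apply: eq_iter_walk_op => x'.
rewrite iter_walk_op_exchange; apply: eq_iter_walk_op => y'.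
by apply: eq_iter_walk_op => z'; rewrite /diag3 mulrC.
Qed.

Lemma iter_triple_op_diag3_ge0 n (x y z : site 2) :
  0 <= iter n triple_op diag3 x y z :> R.
Proof.
rewrite iter_triple_opE; apply: iter_walk_op_ge0 => x'.
apply: iter_walk_op_ge0 => y'; apply: iter_walk_op_ge0 => z'.
by rewrite mulr_ge0 ?ler0n.
Qed.

Definition sqnorm (x : site 2) : R :=
  (x ord0 ord0)%:~R ^+ 2 + (x ord0 ord_max)%:~R ^+ 2.

Lemma iter_walk_op_sqnorm n (x : site 2) :
  iter n walk_op sqnorm x = sqnorm x + 4 / 5 * n%:R.
Proof.
elim: n x => [|n IH] x /=; first by rewrite mulr0 addr0.
rewrite (eq_walk_op _ IH) /walk_op !big_cons big_nil /sqnorm !mxE /=.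
rewrite !intrD !mulr1z -natr1 !mulrN1z !mulr0z.
by field.
Qed.

Definition box (L : nat) : seq (site 2) :=
  [seq mksite (i.1%:Z - L%:Z) (i.2%:Z - L%:Z) |
     i <- [seq (a, b) | a <- iota 0 L.*2.+1, b <- iota 0 L.*2.+1]].

Lemma size_box L : size (box L) = (L.*2.+1 ^ 2)%N.
Proof. by rewrite size_map size_allpairs size_iota. Qed.

(** Chebyshev's inequality in pointwise form, to be integrated by the iterates of [walk_op]. *)
Lemma box_sum_ge (L : nat) (x : site 2) :
  1 - sqnorm x / L.+1%:R ^+ 2 <= \sum_(t <- box L) (x == t)%:R :> R.
Proof.
have [xL|xL] := boolP ((absz (x ord0 ord0) <= L) && (absz (x ord0 ord_max) <= L))%N.
  move/andP: xL => [x0 x1].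
  have xb : x \in box L.
    apply/mapP; exists (absz (x ord0 ord0 + L%:Z), absz (x ord0 ord_max + L%:Z)).
      by apply/allpairsP; exists (absz (x ord0 ord0 + L%:Z), absz (x ord0 ord_max + L%:Z));
        rewrite !mem_iota /=; split => //; lia.
    by apply: site2P; rewrite !mxE /=; lia.
  apply: (@le_trans _ _ 1).
    by rewrite gerBl divr_ge0 ?addr_ge0 ?sqr_ge0 ?exprn_ge0.
  rewrite (perm_big _ (perm_to_rem xb)) big_cons eqxx.
  by rewrite lerDl sumr_ge0// => i _; rewrite ler0n.
apply: (@le_trans _ _ 0); last by rewrite sumr_ge0// => i _; rewrite ler0n.
rewrite subr_le0 ler_pdivlMr ?exprn_gt0 ?ltr0n// mul1r /sqnorm.
have H (a : int) : (L < absz a)%N -> L.+1%:R ^+ 2 <= a%:~R ^+ 2 :> R.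
  move=> La; rewrite -(real_normK (num_real a%:~R)) -intr_norm ler_pXn2r ?nnegrE ?ler0n//.
  by rewrite (_ : L.+1%:R = L.+1%:Z%:~R)// ler_int; lia.
move: xL; rewrite negb_and -!ltnNge => /orP[/H h|/H h].
  by rewrite ler_wpDr// sqr_ge0.
by rewrite ler_wpDl// sqr_ge0.
Qed.

(** By Cauchy-Schwarz, the probability that two walks meet inside a box is at least the squared
    probability of being in the box, divided by its cardinality. A box of side of order sqrt n
    carries at least half of the mass. *)
Lemma iter_pair_op_diag2_ge n (x : site 2) :
  72^-1 / n.+1%:R <= iter n pair_op diag2 x x :> R.
Proof.
rewrite iter_pair_op_diag2xx.
(* For the least [L] with 2 n <= (L + 1)^2, Chebyshev leaves mass at least 3/5 >= 1/2, and the box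
   has at most 18 (n + 1) sites; then 72 = 4 * 18. *)
have [L [nL Ln]] : exists L, (2 * n <= L.+1 ^ 2)%N /\ (L.*2.+1 ^ 2 <= 18 * n.+1)%N.
  have ex : exists L, (2 * n <= L.+1 ^ 2)%N by exists n.*2; nia.
  exists (ex_minn ex); case: ex_minnP => -[|L] h minL; split => //.
  have : ~~ (2 * n <= L.+1 ^ 2)%N by apply/negP => /minL; rewrite ltnn.
  by rewrite -ltnNge; nia.
pose p (t : site 2) : R := iter n walk_op (fun z => (z == t)%:R) 0.
have p_sum : 2^-1 <= \sum_(t <- box L) p t.
  rewrite -iter_walk_op_sum.
  apply: (@le_trans _ _ (iter n walk_op
     (fun x => 1 + - (L.+1%:R ^+ 2)^-1 * sqnorm x) 0)); last first.
    apply: le_iter_walk_op => y; have := box_sum_ge L y.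
    by rewrite mulNr [_^-1 * _]mulrC.
  have -> : iter n walk_op
      (fun x => 1 + - (L.+1%:R ^+ 2)^-1 * sqnorm x) 0 =
      1 + - (L.+1%:R ^+ 2)^-1 * iter n walk_op sqnorm 0 :> R.
    rewrite -iter_walk_opZ.
    have := @iter_walk_op_sum R n bool [:: true; false]
      (fun b => if b then fun=> 1 else fun x => - (L.+1%:R ^+ 2)^-1 * sqnorm x) 0.
    rewrite !big_cons !big_nil /= addr0 iter_walk_op_cst => <-.
    by apply: eq_iter_walk_op => y; rewrite !big_cons big_nil addr0.
  rewrite iter_walk_op_sqnorm /sqnorm !mxE !mulr0z !expr0n /= !add0r mulNr.
  have : (L.+1%:R ^+ 2)^-1 * (4 / 5 * n%:R) <= 2 / 5 :> R.
    rewrite ler_pdivrMl ?exprn_gt0 ?ltr0n// -natrX.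
    have : (2 * n)%:R <= (L.+1 ^ 2)%:R :> R by rewrite ler_nat.
    by rewrite natrM; set c := (L.+1 ^ 2)%:R; lra.
  by set X := _^-1 * _; lra.
have le_sq : (\sum_(t <- box L) p t) ^+ 2 <=
    (L.*2.+1 ^ 2)%:R * \sum_(t <- box L) p t ^+ 2.
  rewrite -size_box; move: (box L) => s {p_sum}.
  (* Cauchy-Schwarz *)
  elim: s => [|t s IH]; first by rewrite !big_nil expr0n mul0r.
  rewrite !big_cons /= -natr1; set S := \sum_(_ <- s) p _ in IH *.
  set S2 := \sum_(_ <- s) p _ ^+ 2 in IH *; set m := (size s)%:R in IH *.
  have -> : (m + 1) * (p t ^+ 2 + S2) = m * S2 + p t ^+ 2 + (m * p t ^+ 2 + S2).
    by ring.
  have : 2 * (p t * S) <= m * p t ^+ 2 + S2.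
    rewrite /m /S /S2; elim: (s) => [|u s' IH'].
      by rewrite !big_nil /= mul0r mulr0 addr0 mulr0.
    rewrite !big_cons /= -natr1.
    by have := sqr_ge0 (p t - p u); rewrite sqrrB; lra.
  by rewrite sqrrD; lra.
(* Both walks being at the same [t] of the box is one way of meeting; as the box has no repetition,
   each meeting is counted at most once. *)
have le_meet : \sum_(t <- box L) p t ^+ 2 <= iter n pair_op diag2 0 0.
  rewrite iter_pair_opE.
  have -> : \sum_(t <- box L) p t ^+ 2 = iter n walk_op (fun x' =>
      iter n walk_op (fun y' => \sum_(t <- box L) (x' == t)%:R * (y' == t)%:R) 0) 0.
    transitivity (iter n walk_op (fun x' => \sum_(t <- box L) p t * (x' == t)%:R) 0).
      rewrite iter_walk_op_sum; apply: eq_bigr => t _.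
      by rewrite iter_walk_opZ expr2.
    apply: eq_iter_walk_op => x'; rewrite iter_walk_op_sum.
    by apply: eq_bigr => t _; rewrite iter_walk_opZ mulrC.
  apply: le_iter_walk_op => x'; apply: le_iter_walk_op => y'.
  rewrite /diag2; case: eqVneq => [<-|xy].
    have ub : uniq (box L).
      rewrite map_inj_in_uniq; first by rewrite allpairs_uniq ?iota_uniq// => -[? ?] [].
      move=> [a b] [a' b'] _ _ /matrixP e; have := e ord0 ord0; have := e ord0 ord_max.
      by rewrite !mxE /= => e1 e2; congr (_, _); lia.
    under eq_bigr do rewrite -natrM mulnb andbb.
    have [xL|xL] := boolP (x' \in box L).
      rewrite (bigD1_seq x')//= eqxx big1 ?addr0// => i; rewrite eq_sym.
      by move=> /negbTE ->.
    rewrite big1_seq// => i /andP[_ ib]; case: eqP => // e.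
    by move: xL; rewrite e ib.
  rewrite big1// => t _; rewrite -natrM mulnb; case: eqVneq => // e.
  by rewrite -e eq_sym (negbTE xy).
apply: le_trans le_meet; rewrite ler_pdivrMr ?ltr0n//.
set S2 := \sum_(_ <- _) p _ ^+ 2 in le_sq *.
have S0 : 0 <= S2 by apply: sumr_ge0 => t _; exact: sqr_ge0.
have : (L.*2.+1 ^ 2)%:R * S2 <= 18 * n.+1%:R * S2.
  by rewrite ler_wpM2r// -natrM ler_nat.
have : 4^-1 <= (\sum_(t <- box L) p t) ^+ 2 by nra.
by lra.
Qed.

End meeting_probabilities.

(** * Expectations over discrete random variables *)

Section discrete_random_variables.
Context {disp : measure_display} {Omega : measurableType disp} {R : realType}.
Variable P : probability Omega R.

(** Only attained values have to be tested, which is the form of the history cells: each is given by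
    a sample point. *)
Lemma discrete_rv_cells (T : countType) (X : Omega -> T) :
  (forall w0, measurable [set w | X w = X w0]) -> discrete_rv X.
Proof.
move=> mX A.
have -> : X @^-1` A =
    \bigcup_(t : T) [set w | X w = t /\ A t /\ exists w0, X w0 = t].
  apply/seteqP; split => [w /= Aw|w [t _ /= [e [At _]]]]; last by rewrite e.
  by exists (X w) => //=; split => //; split => //; exists w.
apply: countable_bigcupT_measurable => // t.
have [At|nAt] := pselect (A t /\ exists w0, X w0 = t).
  have [w0 e] := At.2.
  rewrite (_ : [set _ | _] = [set w | X w = X w0]); first exact: mX.
  by rewrite e; apply/seteqP; split => w /=; [case|].
rewrite (_ : [set _ | _] = set0)//.
by apply/seteqP; split => w //= [_ /nAt].
Qed.

Lemma discrete_rv_factor (T U : Type) (X : Omega -> T) (Y : Omega -> U) :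
  discrete_rv X -> (forall w w', X w = X w' -> Y w = Y w') -> discrete_rv Y.
Proof.
move=> mX XY A; rewrite (_ : Y @^-1` A = X @^-1` (X @` (Y @^-1` A))).
  exact: mX.
apply/seteqP; split => w /=; first by move=> Aw; exists w.
by move=> [w' Aw' /XY <-].
Qed.

Lemma discrete_rv_pair (T U : countType) (X : Omega -> T) (Y : Omega -> U) :
  discrete_rv X -> discrete_rv Y -> discrete_rv (fun w => (X w, Y w)).
Proof.
move=> mX mY; apply: discrete_rv_cells => w0.
rewrite (_ : [set _ | _] = X @^-1` [set X w0] `&` Y @^-1` [set Y w0]).
  by apply: measurableI.
by apply/seteqP; split => w /= [-> ->].
Qed.

Lemma discrete_measurable_fun d' (U : sigmaRingType d') (f : Omega -> U) D :
  discrete_rv f -> measurable_fun D f.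
Proof. by move=> mf mD Y _; apply: measurableI. Qed.

(** Kept in the extended reals: for nonnegative integrands all rules hold without integrability side
    conditions. *)
Definition expect (E : set Omega) (f : Omega -> R) : \bar R :=
  (\int[P]_(w in E) (f w)%:E)%E.

Definition nnrv (f : Omega -> R) : Prop :=
  (forall w, 0 <= f w) /\ measurable_fun setT (fun w => (f w)%:E).

Lemma nnrv_discrete (f : Omega -> R) :
  (forall w, 0 <= f w) -> discrete_rv f -> nnrv f.
Proof.
move=> f0 mf; split => //; apply: discrete_measurable_fun.
by apply: (discrete_rv_factor mf) => w w' /= ->.
Qed.

Lemma nnrv_factor (T : Type) (X : Omega -> T) (f : Omega -> R) :
  discrete_rv X -> (forall w, 0 <= f w) ->
  (forall w w', X w = X w' -> f w = f w') -> nnrv f.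
Proof. by move=> mX f0 Xf; apply: nnrv_discrete => //; exact: discrete_rv_factor Xf. Qed.

Lemma nnrv_measurable (f : Omega -> R) D : nnrv f -> measurable_fun D (fun w => (f w)%:E).
Proof. by move=> [_ mf]; exact: measurable_funTS. Qed.

Lemma nnrv_cst c : 0 <= c -> nnrv (fun=> c).
Proof. by move=> c0; split => //; exact: measurable_cst. Qed.

Lemma nnrv_sum (I : Type) (s : seq I) (f : I -> Omega -> R) :
  (forall i, nnrv (f i)) -> nnrv (fun w => \sum_(i <- s) f i w).
Proof.
move=> nf; split => [w|]; first by apply: sumr_ge0 => i _; exact: (nf i).1.
rewrite (_ : (fun w => _) = (fun w => \sum_(i <- s) (f i w)%:E)%E); last first.
  by apply/funext => w /=; rewrite sumEFin.
by apply: emeasurable_sum => i _; exact: (nf i).2.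
Qed.

Lemma nnrvD f g : nnrv f -> nnrv g -> nnrv (fun w => f w + g w).
Proof.
move=> nf ng; split => [w|]; first by rewrite addr_ge0 ?nf.1 ?ng.1.
rewrite (_ : (fun w => _) = (fun w => (f w)%:E + (g w)%:E)%E)//.
by apply: emeasurable_funD; [exact: nf.2|exact: ng.2].
Qed.

Lemma nnrvM f g : nnrv f -> nnrv g -> nnrv (fun w => f w * g w).
Proof.
move=> nf ng; split => [w|]; first by rewrite mulr_ge0 ?nf.1 ?ng.1.
rewrite (_ : (fun w => _) = (fun w => (f w)%:E * (g w)%:E)%E)//.
by apply: emeasurable_funM; [exact: nf.2|exact: ng.2].
Qed.

Lemma nnrvZ c f : 0 <= c -> nnrv f -> nnrv (fun w => c * f w).
Proof. by move=> c0; apply: nnrvM; exact: nnrv_cst. Qed.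

Lemma eq_nnrv f g : (forall w, f w = g w) -> nnrv f -> nnrv g.
Proof. by move=> /funext ->. Qed.

Lemma nnrv_prod (I : Type) (s : seq I) (f : I -> Omega -> R) :
  (forall i, nnrv (f i)) -> nnrv (fun w => \prod_(i <- s) f i w).
Proof.
move=> nf; elim: s => [|i s IH].
  by apply: (@eq_nnrv (fun=> 1)) => [w|]; [rewrite big_nil|exact: nnrv_cst].
apply: (@eq_nnrv (fun w => f i w * \prod_(j <- s) f j w)) => [w|].
  by rewrite big_cons.
exact: nnrvM.
Qed.

Lemma expect_ge0 E f : nnrv f -> (0 <= expect E f)%E.
Proof. by move=> nf; apply: integral_ge0 => w _; rewrite lee_fin nf.1. Qed.

Lemma eq_expect E f g : (forall w, E w -> f w = g w) -> expect E f = expect E g.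
Proof. by move=> fg; apply: eq_integral => w /set_mem /fg ->. Qed.

Lemma le_expect E f g : measurable E -> nnrv f -> nnrv g ->
  (forall w, E w -> f w <= g w) -> (expect E f <= expect E g)%E.
Proof.
move=> mE nf ng fg; apply: ge0_le_integral => //.
- by move=> w _; rewrite lee_fin nf.1.
- exact: nnrv_measurable.
- exact: nnrv_measurable.
Qed.

Lemma expect_sum E (I : Type) (s : seq I) (f : I -> Omega -> R) :
  measurable E -> (forall i, nnrv (f i)) ->
  expect E (fun w => \sum_(i <- s) f i w) = (\sum_(i <- s) expect E (f i))%E.
Proof.
move=> mE nf; rewrite -ge0_integral_sum//.
- by apply: eq_integral => w _; rewrite sumEFin.
- by move=> i; exact: nnrv_measurable.
- by move=> i w _; rewrite lee_fin (nf i).1.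
Qed.

Lemma expectD E f g : measurable E -> nnrv f -> nnrv g ->
  expect E (fun w => f w + g w) = (expect E f + expect E g)%E.
Proof.
move=> mE nf ng; rewrite -ge0_integralD//.
- by move=> w _; rewrite lee_fin nf.1.
- exact: nnrv_measurable.
- by move=> w _; rewrite lee_fin ng.1.
- exact: nnrv_measurable.
Qed.

Lemma expectZ E c f : measurable E -> 0 <= c -> nnrv f ->
  expect E (fun w => c * f w) = (c%:E * expect E f)%E.
Proof.
move=> mE c0 nf; rewrite -ge0_integralZl//.
- exact: nnrv_measurable.
- by move=> w _; rewrite lee_fin nf.1.
Qed.

Lemma expect_cst E c : measurable E -> expect E (fun=> c) = (c%:E * P E)%E.
Proof. by move=> mE; rewrite -(integral_cst P mE). Qed.

Lemma expect_cells (T : countType) (X : Omega -> T) (E : set Omega) f :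
  discrete_rv X -> measurable E -> nnrv f ->
  expect E f = (\sum_(k <oo) expect (E `&` [set w | pickle (X w) = k]) f)%E.
Proof.
move=> mX mE nf.
have mF k : measurable (E `&` [set w | pickle (X w) = k]).
  by apply: measurableI => //; exact: (mX [set t | pickle t = k]).
rewrite -ge0_integral_bigcup//.
- congr (integral _ _ _); apply/seteqP; split => [w Ew|w [k _ []]//].
  by exists (pickle (X w)).
- exact: nnrv_measurable.
- by move=> w _; rewrite lee_fin nf.1.
- by apply/trivIsetP => i j _ _ ij; apply/seteqP; split => w //= [[_ ei] [_ ej]];
    move: ij; rewrite -ei -ej eqxx.
Qed.

Lemma expect_cell_eq (T : countType) (X : Omega -> T) (E : set Omega) k w0 f :
  pickle (X w0) = k ->
  expect (E `&` [set w | pickle (X w) = k]) f = expect (E `&` [set w | X w = X w0]) f.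
Proof.
move=> <-; congr (integral _ _ _); apply/seteqP; split => w /= [Ew].
  by move=> /(pcan_inj pickleK).
by move=> ->.
Qed.

(** The substitute for conditional expectations: agreement of the integrals on each cell where [X]
    is constant is summed over the cells. *)
Lemma expect_tower (T : countType) (X : Omega -> T) (E : set Omega) f g :
  discrete_rv X -> measurable E -> nnrv f -> nnrv g ->
  (forall w0, E w0 -> expect (E `&` [set w | X w = X w0]) f =
              expect (E `&` [set w | X w = X w0]) g) ->
  expect E f = expect E g.
Proof.
move=> mX mE nf ng fg; rewrite (expect_cells mX mE nf) (expect_cells mX mE ng).
apply: eq_eseriesr => k _.
have [[w0 [Ew0 w0k]]|no] := pselect (exists w0, E w0 /\ pickle (X w0) = k).
  by rewrite !(expect_cell_eq _ _ w0k) fg.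
(* The index [k] is not the code of a value attained on [E], so its cell is empty. *)
rewrite (_ : _ `&` _ = set0) ?/expect ?integral_set0//.
by apply/seteqP; split => w //= [Ew wk]; apply: no; exists w.
Qed.

Lemma probability_expect E : measurable E -> P E = expect setT (\1_E).
Proof. by move=> mE; rewrite /expect integral_indic// setIT. Qed.

Lemma expect_mkcond E f : measurable E ->
  expect E f = expect setT (fun w => \1_E w * f w).
Proof.
move=> mE; rewrite /expect integral_mkcond; apply: eq_integral => w _.
rewrite patchE indicE; case: ifP => _; first by rewrite mul1r.
by rewrite mul0r.
Qed.

Lemma nnrv_indic E : measurable E -> nnrv (\1_E).
Proof.
move=> mE; split => [w|]; first by rewrite indicE ler0n.
by apply/measurable_EFinP; exact: measurable_indic.
Qed.

End discrete_random_variables.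

(** * Genealogy *)

Definition parent (v : label) : label := take (size v).-1 v.

Lemma parent_rcons u i : parent (rcons u i) = u.
Proof. by rewrite /parent size_rcons /= -cats1 take_size_cat. Qed.

Section genealogy.
Variables (Omega : Type) (dim : nat).
Variables (nchild : label -> Omega -> nat) (step : label -> Omega -> site dim).

Lemma mem_generationS n w v : reflect
  (exists u i, [/\ u \in generation nchild n w, (i < nchild u w)%N & v = rcons u i])
  (v \in generation nchild n.+1 w).
Proof.
apply: (iffP flattenP) => [[s /mapP[u un ->] /mapP[i]]|[u [i [un iu ->]]]].
  by rewrite mem_iota => iu ->; exists u, i.
exists [seq rcons u i | i <- iota 0 (nchild u w)]; first by apply/mapP; exists u.
by apply/mapP; exists i; rewrite ?mem_iota.
Qed.

Lemma size_generation n w u : u \in generation nchild n w -> size u = n.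
Proof.
elim: n u => [|n IH] u; first by rewrite inE => /eqP ->.
by move=> /mem_generationS[v [i [/IH sv _ ->]]]; rewrite size_rcons sv.
Qed.

Lemma big_generationS (T : Type) (idx : T) (op : Monoid.law idx) n w (F : label -> T) :
  \big[op/idx]_(v <- generation nchild n.+1 w) F v =
  \big[op/idx]_(u <- generation nchild n w)
    \big[op/idx]_(i <- iota 0 (nchild u w)) F (rcons u i).
Proof.
rewrite /= big_flatten big_map; apply: eq_bigr => u _.
by rewrite big_map.
Qed.

Lemma uniq_generation n w : uniq (generation nchild n w).
Proof.
elim: n => //= n IH; elim: (generation nchild n w) IH => //= u s IHs /andP[us uqs].
rewrite cat_uniq IHs// andbT map_inj_in_uniq ?iota_uniq /=; last first.
  by move=> i j _ _ e; case: (rcons_inj e).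
apply/hasPn => v /flattenP[t /mapP[u' u's ->] /mapP[i _ ->]].
apply/negP => /mapP[j _ /rcons_inj[e _]].
by move: us; rewrite -e u's.
Qed.

(** The next generation determines the offspring numbers of the present one; with [eq_generationS],
    knowing one is knowing the other. *)
Lemma nchild_count n w u : u \in generation nchild n w ->
  nchild u w = count (fun v => parent v == u) (generation nchild n.+1 w).
Proof.
move=> un; rewrite -sum1_count big_mkcond big_generationS.
rewrite (bigD1_seq u) ?uniq_generation//= [X in addn _ X]big1 ?addn0.
  under eq_bigr do rewrite parent_rcons eqxx.
  by rewrite sum1_size size_iota.
move=> v /negbTE vu; rewrite big1// => i _.
by rewrite parent_rcons vu.
Qed.

Lemma eq_generationS n w w' : generation nchild n w = generation nchild n w' ->
  (forall u, u \in generation nchild n w' -> nchild u w = nchild u w') ->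
  generation nchild n.+1 w = generation nchild n.+1 w'.
Proof. by move=> /= -> e; congr flatten; apply/eq_in_map => u /e ->. Qed.

Lemma position_rcons u i w :
  position step (rcons u i) w = position step u w + step (rcons u i) w.
Proof.
rewrite /position size_rcons big_ord_recr /= -[in take _ _](size_rcons u i) take_size.
congr (_ + _); apply: eq_bigr => k _ /=.
by rewrite -cats1 takel_cat.
Qed.

Definition snapshot n w : seq (label * site dim) :=
  [seq (u, position step u w) | u <- generation nchild n w].

Lemma historyS n w :
  history nchild step n.+1 w = rcons (history nchild step n w) (snapshot n.+1 w).
Proof. by rewrite /history -[in LHS]addn1 iotaD map_cat -cats1. Qed.

Lemma last_history n w : last [::] (history nchild step n w) = snapshot n w.
Proof. by case: n => [//|n]; rewrite historyS last_rcons. Qed.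

Lemma snapshot_eq n w w' : history nchild step n w = history nchild step n w' ->
  snapshot n w = snapshot n w'.
Proof. by rewrite -!last_history => ->. Qed.

Lemma generation_snapshot n w : generation nchild n w = unzip1 (snapshot n w).
Proof. by rewrite /unzip1 -map_comp map_id. Qed.

Lemma generation_eq n w w' : history nchild step n w = history nchild step n w' ->
  generation nchild n w = generation nchild n w'.
Proof. by move=> /snapshot_eq; rewrite !generation_snapshot => ->. Qed.

Lemma position_eq n w w' u : history nchild step n w = history nchild step n w' ->
  u \in generation nchild n w' -> position step u w = position step u w'.
Proof.
move=> h un; have := snapshot_eq h; rewrite /snapshot (generation_eq h).
by move=> /eq_in_map /(_ u un) [].
Qed.

End genealogy.

(** * Independence of the past and the future *)

Section independence.
Context {disp : measure_display} {Omega : measurableType disp} {R : realType}.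
Variables (P : probability Omega R) (dim : nat) (Q : probability nat R).
Variables (nchild : label -> Omega -> nat) (step : label -> Omega -> site dim).
Hypothesis hbrw : brw_driver P Q nchild step.

Definition cylinder (T : Type) (X : label -> Omega -> T) (s : seq label)
    (A : label -> set T) : set Omega :=
  [set w | forall u, u \in s -> A u (X u w)].

Lemma cylinder_nil (T : Type) (X : label -> Omega -> T) A : cylinder X [::] A = setT.
Proof. by apply/seteqP; split. Qed.

Lemma cylinder_cons (T : Type) (X : label -> Omega -> T) u s A :
  cylinder X (u :: s) A = (X u @^-1` A u) `&` cylinder X s A.
Proof.
apply/seteqP; split => w /= h.
  by split => [|v vs]; apply: h; rewrite inE ?eqxx ?vs ?orbT.
by move=> v; rewrite inE => /orP[/eqP ->|vs]; [exact: h.1|exact: h.2].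
Qed.

(** The event is independent of the offspring numbers with label in [N] and of the displacements
    with label in [S], and these stay mutually independent with their original laws given the event.
    The two label sets are separate because offspring numbers are revealed before the displacements
    of the children. *)
Definition indep_of (N S : label -> Prop) (E : set Omega) : Prop :=
  measurable E /\ forall s1 s2 A B, uniq s1 -> uniq s2 ->
    (forall u, u \in s1 -> N u) -> (forall u, u \in s2 -> S u) ->
    P (E `&` cylinder nchild s1 A `&` cylinder step s2 B) =
    (P E * (\prod_(u <- s1) P (nchild u @^-1` A u) *
            \prod_(u <- s2) P (step u @^-1` B u)))%E.

Lemma indep_ofW (N N' S S' : label -> Prop) E :
  (forall u, N' u -> N u) -> (forall u, S' u -> S u) ->
  indep_of N S E -> indep_of N' S' E.
Proof.
move=> NN SS [mE indE]; split => // s1 s2 A B u1 u2 h1 h2.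
by apply: indE => // u us; [apply/NN/h1|apply/SS/h2].
Qed.

(** The driver has one list of labels for both families; the two lists are merged and the missing
    constraints are filled with [setT]. *)
Lemma indep_of_setT : indep_of (fun=> True) (fun=> True) setT.
Proof.
split => // s1 s2 A B u1 u2 _ _; rewrite setTI probability_setT mul1e.
pose s := undup (s1 ++ s2).
pose A' u := if u \in s1 then A u else setT.
pose B' u := if u \in s2 then B u else setT.
have -> : cylinder nchild s1 A `&` cylinder step s2 B =
    [set w | forall u, u \in s -> A' u (nchild u w) /\ B' u (step u w)].
  apply/seteqP; split => w /= h.
    move=> u _; rewrite /A' /B'; split.
      by case: ifP => // us; exact: h.1.
    by case: ifP => // us; exact: h.2.
  split => u us; have := h u; rewrite mem_undup mem_cat us ?orbT => /(_ isT) [].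
    by rewrite /A' us.
  by rewrite /B' us.
rewrite (brw_indep hbrw) ?undup_uniq// big_split.
have sub (T : Type) (X : label -> Omega -> T) (s' : seq label) (C : label -> set T) :
    uniq s' -> {subset s' <= s} ->
    (\prod_(u <- s) P (X u @^-1` (if u \in s' then C u else setT)) =
     \prod_(u <- s') P (X u @^-1` C u))%E.
  move=> us' ss'.
  transitivity (\prod_(u <- s | u \in s') P (X u @^-1` C u))%E.
    rewrite [RHS]big_mkcond; apply: eq_bigr => u _; case: ifP => // _.
    by rewrite preimage_setT probability_setT.
  rewrite -big_filter; apply: perm_big; apply: uniq_perm => //.
    by rewrite filter_uniq// undup_uniq.
  move=> u; rewrite mem_filter; case: (boolP (u \in s')) => //= /ss' ->//.
by rewrite /A' /B' !sub// => u us; rewrite mem_undup mem_cat us ?orbT.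
Qed.

(** Revealing one variable only removes its label from the set of free labels, so that revelations
    can be iterated. *)
Lemma indep_of_nchild N S E u (A : set nat) : N u -> indep_of N S E ->
  indep_of (fun v => N v /\ v <> u) S (E `&` nchild u @^-1` A) /\
  P (E `&` nchild u @^-1` A) = (P E * P (nchild u @^-1` A))%E.
Proof.
move=> Nu [mE indE].
have PE : P (E `&` nchild u @^-1` A) = (P E * P (nchild u @^-1` A))%E.
  have := indE [:: u] [::] (fun=> A) (fun=> setT).
  rewrite cylinder_cons !cylinder_nil !setIT big_seq1 big_nil mule1; apply => //.
  by move=> v; rewrite inE => /eqP ->.
split => //; split; first by apply: measurableI => //; exact: brw_nchild_rv hbrw _ _.
move=> s1 s2 A1 B u1 u2 h1 h2.
have us1 : u \notin s1 by apply/negP => /h1 [].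
pose A1' v := if v == u then A else A1 v.
have e1 : cylinder nchild s1 A1 = cylinder nchild s1 A1'.
  by apply/seteqP; split => w /= h v vs; have := h v vs; rewrite /A1';
    case: eqP => // e; move: us1; rewrite -e vs.
have := indE (u :: s1) s2 A1' B.
have eA : A1' u = A by rewrite /A1' eqxx.
rewrite cylinder_cons big_cons eA -e1 setIA => -> //=.
- rewrite PE !muleA; congr (_ * _ * _)%E; apply: eq_big_seq => v vs.
  by rewrite /A1'; case: eqP => // e; move: us1; rewrite -e vs.
- by rewrite us1.
- by move=> v; rewrite inE => /orP[/eqP ->//|/h1 []].
Qed.

Lemma indep_of_step N S E u (B : set (site dim)) : S u -> indep_of N S E ->
  indep_of N (fun v => S v /\ v <> u) (E `&` step u @^-1` B) /\
  P (E `&` step u @^-1` B) = (P E * P (step u @^-1` B))%E.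
Proof.
move=> Su [mE indE].
have PE : P (E `&` step u @^-1` B) = (P E * P (step u @^-1` B))%E.
  have := indE [::] [:: u] (fun=> setT) (fun=> B).
  rewrite cylinder_cons !cylinder_nil !setIT big_seq1 big_nil mul1e; apply => //.
  by move=> v; rewrite inE => /eqP ->.
split => //; split; first by apply: measurableI => //; exact: brw_step_rv hbrw _ _.
move=> s1 s2 A B1 u1 u2 h1 h2.
have us2 : u \notin s2 by apply/negP => /h2 [].
pose B1' v := if v == u then B else B1 v.
have e2 : cylinder step s2 B1 = cylinder step s2 B1'.
  by apply/seteqP; split => w /= h v vs; have := h v vs; rewrite /B1';
    case: eqP => // e; move: us2; rewrite -e vs.
have := indE s1 (u :: s2) A B1'.
have eB : B1' u = B by rewrite /B1' eqxx.
rewrite cylinder_cons big_cons eB -e2.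
rewrite (setIC (step u @^-1` B)) setIA setIAC -(setIA E) (setIC (cylinder _ _ _)).
rewrite setIA setIAC => -> //=.
- rewrite PE -!muleA; congr (_ * _)%E; rewrite muleCA; congr (_ * (_ * _))%E.
  apply: eq_big_seq => v vs.
  by rewrite /B1'; case: eqP => // e; move: us2; rewrite -e vs.
- by rewrite us2.
- by move=> v; rewrite inE => /orP[/eqP ->//|/h2 []].
Qed.

Lemma indep_of_nchilds N S E s (a : label -> nat) : uniq s ->
  (forall u, u \in s -> N u) -> indep_of N S E ->
  indep_of (fun v => N v /\ v \notin s) S
    (E `&` [set w | forall u, u \in s -> nchild u w = a u]).
Proof.
rewrite -[X in _ `&` X]/(cylinder nchild s (fun u => [set a u])).
elim: s N E => [|u s IH] N E.
  by move=> _ _; rewrite cylinder_nil setIT; apply: indep_ofW => // v [].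
move=> /andP[us uqs] Ns indE; rewrite cylinder_cons setIA.
have Nu : N u by apply: Ns; rewrite inE eqxx.
have [indE' _] := indep_of_nchild [set a u] Nu indE.
apply: indep_ofW (IH _ _ uqs _ indE') => // [v [Nv]|v vs].
  by rewrite inE negb_or => /andP[/eqP vu vs].
by split; [apply: Ns; rewrite inE vs orbT|move=> e; move: us; rewrite -e vs].
Qed.

Lemma indep_of_steps N S E s (b : label -> site dim) : uniq s ->
  (forall u, u \in s -> S u) -> indep_of N S E ->
  indep_of N (fun v => S v /\ v \notin s)
    (E `&` [set w | forall u, u \in s -> step u w = b u]).
Proof.
rewrite -[X in _ `&` X]/(cylinder step s (fun u => [set b u])).
elim: s S E => [|u s IH] S E.
  by move=> _ _; rewrite cylinder_nil setIT; apply: indep_ofW => // v [].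
move=> /andP[us uqs] Ns indE; rewrite cylinder_cons setIA.
have Nu : S u by apply: Ns; rewrite inE eqxx.
have [indE' _] := indep_of_step [set b u] Nu indE.
apply: indep_ofW (IH _ _ uqs _ indE') => // [v [Nv]|v vs].
  by rewrite inE negb_or => /andP[/eqP vu vs].
by split; [apply: Ns; rewrite inE vs orbT|move=> e; move: us; rewrite -e vs].
Qed.

Definition history_cell n w0 : set Omega :=
  [set w | history nchild step n w = history nchild step n w0].

(* The genealogy of generation [n.+1] is known, its displacements are not. *)
Definition genealogy_cell n w0 : set Omega :=
  history_cell n w0 `&`
  [set w | generation nchild n.+1 w = generation nchild n.+1 w0].

(** Turns the cell into prescribed values of the driver, the form to which [indep_of_nchilds]
    applies. *)
Lemma genealogy_cellE n w0 : genealogy_cell n w0 = history_cell n w0 `&`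
  [set w | forall u, u \in generation nchild n w0 -> nchild u w = nchild u w0].
Proof.
apply/seteqP; split => w [hw gw]; split => //=.
  move=> u un; have hg := generation_eq hw.
  by rewrite !(@nchild_count _ _ n) ?hg// gw.
exact: eq_generationS (generation_eq hw) gw.
Qed.

(** The displacement of a child is the difference of its position and that of its parent, so the new
    positions amount to prescribed displacements. *)
Lemma history_cellS n w0 : history_cell n.+1 w0 = genealogy_cell n w0 `&`
  [set w | forall v, v \in generation nchild n.+1 w0 -> step v w = step v w0].
Proof.
apply/seteqP; split => [w hw|w [[hw gw] sw]].
  have hn : history nchild step n w = history nchild step n w0.
    by move: (hw : _ = _); rewrite !historyS => /rcons_inj /(congr1 fst).
  split; first by split => //; exact: generation_eq hw.
  move=> v vn; have [u [i [un _ e]]] := mem_generationS _ _ _ _ vn.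
  have := position_eq hw vn; rewrite e !position_rcons (position_eq hn un).
  by move/addrI.
suff : history nchild step n.+1 w = history nchild step n.+1 w0 by [].
rewrite !historyS hw /snapshot gw; congr rcons.
apply/eq_in_map => v vn; have [u [i [un _ e]]] := mem_generationS _ _ _ _ vn.
have := sw v vn; rewrite e !position_rcons => ->.
by rewrite (position_eq hw un).
Qed.

(** The history up to time [n] uses offspring numbers of labels of length below [n] and
    displacements of labels of length at most [n]. Going on to the genealogy of the next generation
    uses up the offspring numbers of length [n], hence the strict inequality in the second part. *)
Lemma indep_history_cell n w0 :
  indep_of (fun u => n <= size u)%N (fun u => n < size u)%N (history_cell n w0) /\
  indep_of (fun u => n < size u)%N (fun u => n < size u)%N (genealogy_cell n w0).
Proof.
have step1 m : indep_of (fun u => m <= size u)%N (fun u => m < size u)%N (history_cell m w0) ->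
    indep_of (fun u => m < size u)%N (fun u => m < size u)%N (genealogy_cell m w0).
  move=> ind; rewrite genealogy_cellE.
  apply: indep_ofW (indep_of_nchilds (nchild^~ w0) (uniq_generation _ _ _) _ ind) => //.
    move=> u mu; split; first exact: ltnW.
    by apply/negP => h; rewrite (size_generation h) ltnn in mu.
  by move=> u h; rewrite (size_generation h).
suff H : indep_of (fun u => n <= size u)%N (fun u => n < size u)%N (history_cell n w0).
  by split => //; exact: step1.
elim: n => [|n IH].
  rewrite (_ : history_cell 0 w0 = setT); first exact: indep_ofW indep_of_setT.
  apply/seteqP; split => // w _.
  by rewrite /history_cell /= /history /= /position !big_ord0.
rewrite history_cellS.
apply: indep_ofW (indep_of_steps (step^~ w0) (uniq_generation _ _ _) _ (step1 _ IH)) => //.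
  move=> u nu; split; first exact: ltnW.
  by apply/negP => h; rewrite (size_generation h) ltnn in nu.
by move=> u h; rewrite (size_generation h).
Qed.

Lemma measurable_history_cell n w0 : measurable (history_cell n w0).
Proof. exact: (indep_history_cell n w0).1.1. Qed.

Lemma measurable_genealogy_cell n w0 : measurable (genealogy_cell n w0).
Proof. exact: (indep_history_cell n w0).2.1. Qed.

Lemma discrete_history n : discrete_rv (history nchild step n).
Proof. by apply: discrete_rv_cells => w0; exact: measurable_history_cell. Qed.

Lemma discrete_genealogy n :
  discrete_rv (fun w => (history nchild step n w, generation nchild n.+1 w)).
Proof.
apply: discrete_rv_cells => w0.
rewrite (_ : [set _ | _] = genealogy_cell n w0); first exact: measurable_genealogy_cell.
apply/seteqP; split => w; last by move=> [hw gw]; exact: congr2 hw gw.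
by move=> e; split; [exact: (congr1 fst (e : _ = _))|exact: (congr1 snd (e : _ = _))].
Qed.

End independence.

Lemma expect_nat_cells {disp : measure_display} {Omega : measurableType disp}
    {R : realType} (P : probability Omega R) (X : Omega -> nat) E f :
  discrete_rv X -> measurable E -> nnrv f ->
  expect P E f = (\sum_(k <oo) expect P (E `&` X @^-1` [set k]) f)%E.
Proof. exact: expect_cells. Qed.

Lemma nnrv_nat {R : realType} (g : nat -> R) : (forall l, 0 <= g l) -> nnrv g.
Proof. by move=> g0; apply: nnrv_discrete => // A. Qed.

Lemma nbhd_neighborhood0 e : e \in nbhd -> neighborhood0 e.
Proof.
by rewrite !inE => /or4P[/eqP->|/eqP->|/eqP->|/orP[]/eqP->];
  rewrite /neighborhood0 !big_ord_recl big_ord0 !mxE.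
Qed.

Lemma uniq_nbhd : uniq nbhd.
Proof.
have inj a b a' b' : mksite a b = mksite a' b' -> a = a' /\ b = b'.
  move=> /matrixP e; have := e ord0 ord0; have := e ord0 ord_max.
  by rewrite !mxE.
apply: (@map_uniq _ _ (fun x : site 2 => (x ord0 ord0, x ord0 ord_max))).
by rewrite /= !mxE.
Qed.

(** * One-step expectations of offspring numbers and displacements *)

Section one_step_expectations.
Context {disp : measure_display} {Omega : measurableType disp} {R : realType}.
Variables (P : probability Omega R) (Q : probability nat R).
Variables (nchild : label -> Omega -> nat) (step : label -> Omega -> site 2).
Hypothesis hbrw : brw_driver P Q nchild step.

Notation indep_of := (indep_of P nchild step).

Lemma nnrv_nchild u (g : nat -> R) : (forall l, 0 <= g l) ->
  nnrv (fun w => g (nchild u w)).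
Proof.
move=> g0; apply: (nnrv_factor (brw_nchild_rv hbrw u)) => // w w' ->.
by [].
Qed.

(** The event is cut along the values of the first offspring number; on each piece its factor is
    constant and the piece is still independent of the remaining labels. *)
Lemma expect_indep_nchild N S E s (g : label -> nat -> R) (m : label -> R) :
  indep_of N S E -> uniq s -> (forall u, u \in s -> N u) ->
  (forall u l, 0 <= g u l) ->
  (forall u, u \in s -> expect Q setT (g u) = (m u)%:E) ->
  expect P E (fun w => \prod_(u <- s) g u (nchild u w)) =
  (P E * (\prod_(u <- s) m u)%:E)%E.
Proof.
move=> + + + g0; elim: s N E => [|u s IH] N E indE.
  move=> _ _ _; rewrite (@eq_expect _ _ _ _ _ _ (fun=> 1)) => [|w _]; last first.
    by rewrite big_nil.
  by rewrite big_nil (expect_cst _ _ indE.1) mule1 mul1e.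
move=> /andP[us uqs] sN gm; have mE := indE.1.
have nnp (s' : seq label) : nnrv (fun w => \prod_(u <- s') g u (nchild u w)).
  by apply: nnrv_prod => v; exact: nnrv_nchild.
rewrite (expect_nat_cells _ (brw_nchild_rv hbrw u) indE.1 (nnp _)).
have Nu : N u by apply: sN; rewrite inE eqxx.
set M := \prod_(v <- s) m v.
have m0 v : v \in u :: s -> 0 <= m v.
  by move=> /gm e; rewrite -lee_fin -e expect_ge0//; exact: nnrv_nat.
have M0 : 0 <= M by rewrite /M big_seq; apply: prodr_ge0 => v vs; apply: m0; rewrite inE vs orbT.
have cell k : expect P (E `&` nchild u @^-1` [set k])
      (fun w => \prod_(v <- u :: s) g v (nchild v w)) =
    ((fine (P E) * M)%:E * expect Q (setT `&` id @^-1` [set k]) (g u))%E.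
  have [indE' PE'] := indep_of_nchild hbrw [set k] Nu indE.
  transitivity (expect P (E `&` nchild u @^-1` [set k])
      (fun w => g u k * \prod_(v <- s) g v (nchild v w))).
    by apply: eq_expect => w [_ /= <-]; rewrite big_cons.
  have mE' := indE'.1; rewrite expectZ//.
  rewrite (IH _ _ indE') => //; last 2 first.
  - move=> v vs; split; first by apply: sN; rewrite inE vs orbT.
    by move=> e; move: us; rewrite -e vs.
  - by move=> v vs; apply: gm; rewrite inE vs orbT.
  rewrite -/M PE' (brw_nchild_law hbrw).
  rewrite (@eq_expect _ _ _ _ _ _ (fun=> g u k)); last by move=> l [_ /= ->].
  rewrite expect_cst// setTI preimage_id.
  rewrite EFinM fineK; last exact: fin_num_measure.
  rewrite -!muleA [LHS]muleCA; congr (_ * _)%E; rewrite [RHS]muleCA.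
  by congr (_ * _)%E; rewrite muleC.
transitivity (\sum_(k <oo) (fine (P E) * M)%:E *
    expect Q (setT `&` id @^-1` [set k]) (g u))%E.
  by apply: eq_eseriesr => k _; exact: cell.
rewrite nneseriesZl; last by move=> k _; exact: (expect_ge0 _ _ (nnrv_nat (g0 u))).
have did : discrete_rv (id : nat -> nat) by move=> A.
rewrite -(expect_nat_cells Q did measurableT (nnrv_nat (g0 u))) gm ?inE ?eqxx//.
rewrite big_cons -/M -EFinM -[in RHS](fineK (fin_num_measure P _ indE.1)) -EFinM.
by congr EFin; ring.
Qed.

(** The five sites of [nbhd] have mass 1/5 each and exhaust the law. *)
Lemma step_ae_nbhd u : P (step u @^-1` (~` [set` nbhd])) = 0%E.
Proof.
have mS B : measurable (step u @^-1` B) by exact: brw_step_rv hbrw _ _.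
rewrite preimage_setC probability_setC; last exact: (mS [set` nbhd]).
suff -> : P (step u @^-1` [set` nbhd]) = 1%E by rewrite subee.
rewrite probability_expect; last exact: (mS [set` nbhd]).
transitivity (expect P setT (fun w => \sum_(e <- nbhd) \1_(step u @^-1` [set e]) w)).
  apply: eq_expect => w _; under eq_bigr do rewrite indicE.
  rewrite indicE; case: (boolP (step u w \in nbhd)) => h.
    rewrite (bigD1_seq _ h uniq_nbhd)/= !mem_set//= big1 ?addr0// => e eu.
    by rewrite memNset//= => ?; move: eu; rewrite eq_sym; case: eqP.
  rewrite memNset//=; last by move/negP: h.
  rewrite big1_seq// => e /andP[_ en]; rewrite memNset//= => ee.
  by move: h; rewrite ee en.
rewrite expect_sum//; last by move=> e; exact: nnrv_indic.
rewrite (eq_big_seq (fun=> (5^-1)%:E)) => [|e en]; last first.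
  by rewrite -probability_expect// (brw_step_law hbrw) nbhd_neighborhood0.
rewrite sumEFin !big_cons big_nil; congr EFin; by field.
Qed.

(** The displacement lies in [nbhd] only almost surely, so a null set is removed before the finite
    expansion. *)
Lemma expect_indep_step N S E u (f : site 2 -> Omega -> R) :
  indep_of N S E -> S u -> (forall e, nnrv (f e)) ->
  nnrv (fun w => f (step u w) w) ->
  expect P E (fun w => f (step u w) w) =
  (\sum_(e <- nbhd) expect P (E `&` step u @^-1` [set e]) (f e))%E.
Proof.
move=> indE Su nf nF; have mE := indE.1.
have mS B : measurable (step u @^-1` B) by exact: brw_step_rv hbrw _ _.
pose G w := \sum_(e <- nbhd) \1_(E `&` step u @^-1` [set e]) w * f e w.
transitivity (expect P (E `\` step u @^-1` (~` [set` nbhd])) G); last first.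
  transitivity (expect P setT G).
    rewrite expect_mkcond; last exact: measurableD.
    apply: eq_expect => w _; rewrite indicE.
    have [h|h] := pselect ((E `\` step u @^-1` (~` [set` nbhd])) w).
      by rewrite mem_set// mul1r.
    rewrite memNset// mul0r /G big1_seq// => e /andP[_ en].
    rewrite indicE memNset ?mul0r// => -[Ew /= ew]; apply: h; split => //=.
    by rewrite ew; apply.
  rewrite expect_sum//.
    by apply: eq_bigr => e _; rewrite -expect_mkcond//; exact: measurableI.
  by move=> e; apply: nnrvM => //; apply: nnrv_indic; exact: measurableI.
rewrite /expect; set F := fun w => (f (step u w) w)%:E.
have -> : (\int[P]_(w in E) F w = \int[P]_(w in E `\` step u @^-1` (~` [set` nbhd])) F w)%E.
  rewrite -[in LHS](setDUK (_ : (E `&` step u @^-1` (~` [set` nbhd])) `<=` E)); last exact: subIsetl.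
  rewrite integral_setU; last 4 first.
  - exact: measurableI.
  - by apply: measurableD => //; exact: measurableI.
  - exact: nnrv_measurable.
  - by apply/disj_setPS => w [? []].
  rewrite null_set_integral; last 3 first.
  - exact: measurableI.
  - exact: nnrv_measurable.
  - apply/eqP; rewrite eq_le measure_ge0 andbT -(step_ae_nbhd u).
    apply: le_measure; [apply: mem_set; exact: measurableI|apply: mem_set; exact: mS|exact: subIsetr].
  rewrite add0e.
  by congr (integral _ _ _); apply/seteqP; split => w [Ew nw]; split => // h;
     apply: nw => //; case: h.
apply: eq_integral => w /set_mem[Ew /contrapT /= uw]; congr EFin; rewrite /G.
rewrite (bigD1_seq _ uw uniq_nbhd)/= indicE mem_set// mul1r big1 ?addr0// => e eu.
by rewrite indicE memNset ?mul0r// => -[_ /= h]; move: eu; rewrite h eqxx.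
Qed.

End one_step_expectations.

(** * Pairs of particles *)

(* The lineages [u] and [v] separate at a particle whose children of indices
   [i] and [j] they follow satisfy [c i j]. *)
Fixpoint diverge (c : rel nat) (u v : label) : bool :=
  match u, v with
  | i :: u', j :: v' => if i == j then diverge c u' v' else c i j
  | _, _ => false
  end.

Lemma divergexx c u : diverge c u u = false.
Proof. by elim: u => //= i u IH; rewrite eqxx. Qed.

Lemma diverge_rcons c u v i j : irreflexive c -> size u = size v ->
  diverge c (rcons u i) (rcons v j) = if u == v then c i j else diverge c u v.
Proof.
move=> irr; elim: u v => [|a u IH] [|b v]//= => [_|[uv]].
  by case: eqP => // ->; rewrite irr.
by rewrite eqseq_cons; case: eqP => //= _; exact: IH.
Qed.

Lemma diverge_neq u v : size u = size v -> diverge (fun i j => i != j) u v = (u != v).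
Proof.
elim: u v => [|a u IH] [|b v]//= [uv]; rewrite eqseq_cons.
by case: eqP => //= _; exact: IH.
Qed.

(** The number of ordered pairs of siblings related by [c] in a family of [l]. Its mean is the rate
    at which pairs separate. *)
Definition pair_count (R : pzSemiRingType) (c : rel nat) (l : nat) : R :=
  \sum_(i <- iota 0 l) \sum_(j <- iota 0 l) (c i j)%:R.

Section pair_moments.
Context {disp : measure_display} {Omega : measurableType disp} {R : realType}.
Variables (P : probability Omega R) (Q : probability nat R).
Variables (nchild : label -> Omega -> nat) (step : label -> Omega -> site 2).
Hypothesis hbrw : brw_driver P Q nchild step.
Hypothesis mean1 : expect Q setT (fun l => l%:R) = 1%E.

Notation indep_of := (indep_of P nchild step).
Notation EX := (expect P setT).
Notation G := (generation nchild).
Notation X := (position step).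
Notation history := (history nchild step).

Lemma nnrv_step u (g : site 2 -> R) : (forall e, 0 <= g e) ->
  nnrv (fun w => g (step u w)).
Proof. by move=> g0; apply: (nnrv_factor (brw_step_rv hbrw u)) => // w w' ->. Qed.

Lemma nnrv_step2 u v (g : site 2 -> site 2 -> R) : (forall e e', 0 <= g e e') ->
  nnrv (fun w => g (step u w) (step v w)).
Proof.
move=> g0; apply: (nnrv_factor (X := fun w => (step u w, step v w))) => //.
  by apply: discrete_rv_pair; exact: brw_step_rv hbrw _.
by move=> w w' [-> ->].
Qed.

Lemma nnrv_step3 t u v (g : site 2 -> site 2 -> site 2 -> R) :
  (forall e e' e'', 0 <= g e e' e'') ->
  nnrv (fun w => g (step t w) (step u w) (step v w)).
Proof.
move=> g0; apply: (nnrv_factor (X := fun w => (step t w, (step u w, step v w)))) => //.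
  apply: discrete_rv_pair; first exact: brw_step_rv hbrw _.
  by apply: discrete_rv_pair; exact: brw_step_rv hbrw _.
by move=> w w' [-> -> ->].
Qed.

Lemma sum_nbhd N S E u (h : site 2 -> R) : indep_of N S E -> S u ->
  (\sum_(e <- nbhd) P (E `&` step u @^-1` [set e]) * (h e)%:E =
   P E * (5^-1 * \sum_(e <- nbhd) h e)%:E)%E.
Proof.
move=> indE Su; have mE := indE.1.
rewrite -[in RHS](fineK (fin_num_measure P _ mE)) -EFinM mulr_sumr mulr_sumr -sumEFin.
apply: eq_big_seq => e en.
rewrite (indep_of_step hbrw [set e] Su indE).2 (brw_step_law hbrw) nbhd_neighborhood0//.
rewrite -[in LHS](fineK (fin_num_measure P _ mE)) -!EFinM; congr EFin.
by rewrite (_ : (2 * 2 + 1)%N = 5)//; ring.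
Qed.

Lemma expect_step1 N S E u a (g : site 2 -> R) : indep_of N S E -> S u ->
  (forall x, 0 <= g x) ->
  expect P E (fun w => g (a + step u w)) = (P E * (walk_op g a)%:E)%E.
Proof.
move=> indE Su g0.
rewrite (@expect_indep_step _ _ _ _ _ _ _ hbrw _ _ _ _ (fun e _ => g (a + e)) indE Su).
- rewrite -(sum_nbhd _ indE Su); apply: eq_bigr => e _.
  by rewrite (expect_cst _ _ (indep_of_step hbrw [set e] Su indE).1.1) muleC.
- by move=> e; exact: nnrv_cst.
- exact: (nnrv_step u (g := fun e => g (a + e))).
Qed.

Lemma expect_step2 N S E u v a b (g : site 2 -> site 2 -> R) :
  indep_of N S E -> S u -> S v -> u <> v -> (forall x y, 0 <= g x y) ->
  expect P E (fun w => g (a + step u w) (b + step v w)) =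
  (P E * (pair_op g a b)%:E)%E.
Proof.
move=> indE Su Sv uv g0.
rewrite (@expect_indep_step _ _ _ _ _ _ _ hbrw _ _ _ _
  (fun e w => g (a + e) (b + step v w)) indE Su).
- rewrite -(sum_nbhd _ indE Su); apply: eq_bigr => e _.
  by rewrite (expect_step1 b (indep_of_step hbrw [set e] Su indE).1)//; split => // /esym.
- by move=> e; exact: (nnrv_step v (g := fun e' => g (a + e) (b + e'))).
- exact: (nnrv_step2 u v (g := fun e e' => g (a + e) (b + e'))).
Qed.

Lemma expect_step3 N S E t u v a b c (g : site 2 -> site 2 -> site 2 -> R) :
  indep_of N S E -> S t -> S u -> S v -> t <> u -> t <> v -> u <> v ->
  (forall x y z, 0 <= g x y z) ->
  expect P E (fun w => g (a + step t w) (b + step u w) (c + step v w)) =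
  (P E * (triple_op g a b c)%:E)%E.
Proof.
move=> indE St Su Sv tu tv uv g0.
rewrite (@expect_indep_step _ _ _ _ _ _ _ hbrw _ _ _ _
  (fun e w => g (a + e) (b + step u w) (c + step v w)) indE St).
- rewrite -(sum_nbhd _ indE St); apply: eq_bigr => e _.
  by rewrite (expect_step2 b c (indep_of_step hbrw [set e] St indE).1)//; split => // /esym.
- by move=> e; exact: (nnrv_step2 u v (g := fun e' e'' => g (a + e) (b + e') (c + e''))).
- exact: (nnrv_step3 t u v (g := fun e e' e'' => g (a + e) (b + e') (c + e''))).
Qed.

Lemma parent_mem n w v : v \in G n.+1 w -> parent v \in G n w.
Proof. by move=> /mem_generationS[u [i [un _ ->]]]; rewrite parent_rcons. Qed.

Lemma position_parent n w w' v : v \in G n.+1 w' ->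
  X v w = X (parent v) w + step v w.
Proof.
by move=> /mem_generationS[u [i [un _ ->]]]; rewrite parent_rcons position_rcons.
Qed.

Lemma nnrv_history n (f : Omega -> R) : (forall w, 0 <= f w) ->
  (forall w w', history n w = history n w' -> f w = f w') -> nnrv f.
Proof. by move=> f0; apply: nnrv_factor => //; exact: discrete_history hbrw n. Qed.

Lemma nnrv_genealogy n (f : Omega -> R) : (forall w, 0 <= f w) ->
  (forall w w', history n w = history n w' -> G n.+1 w = G n.+1 w' -> f w = f w') ->
  nnrv f.
Proof.
move=> f0 ff; apply: (nnrv_factor (discrete_genealogy hbrw n)) => // w w' e.
exact: ff (congr1 fst e) (congr1 snd e).
Qed.

Lemma expect_tower_genealogy n f g : nnrv f -> nnrv g ->
  (forall w0, expect P (genealogy_cell nchild step n w0) f =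
              expect P (genealogy_cell nchild step n w0) g) ->
  EX f = EX g.
Proof.
move=> nf ng fg; apply: (expect_tower (discrete_genealogy hbrw n)) => // w0 _.
rewrite setTI (_ : [set _ | _] = genealogy_cell nchild step n w0)//.
apply/seteqP; split => w; last by move=> [hw gw]; exact: congr2 hw gw.
by move=> e; split; [exact: (congr1 fst (e : _ = _))|exact: (congr1 snd (e : _ = _))].
Qed.

Lemma expect_tower_history n f g : nnrv f -> nnrv g ->
  (forall w0, expect P (history_cell nchild step n w0) f =
              expect P (history_cell nchild step n w0) g) ->
  EX f = EX g.
Proof.
move=> nf ng fg; apply: (expect_tower (discrete_history hbrw n)) => // w0 _.
by rewrite setTI; exact: fg.
Qed.

(** Given the genealogy, distinct particles move independently. The weight vanishes on the diagonal
    because a particle paired with itself makes a single displacement. *)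
Lemma expect_move_pairs n (I : label -> label -> R) (g : site 2 -> site 2 -> R) :
  (forall u v, 0 <= I u v) -> (forall u, I u u = 0) -> (forall x y, 0 <= g x y) ->
  EX (fun w => \sum_(u <- G n.+1 w) \sum_(v <- G n.+1 w) I u v * g (X u w) (X v w)) =
  EX (fun w => \sum_(u <- G n.+1 w) \sum_(v <- G n.+1 w)
                  I u v * pair_op g (X (parent u) w) (X (parent v) w)).
Proof.
move=> I0 Iuu g0.
have pg0 x y : 0 <= pair_op g x y.
  by rewrite mulr_ge0// sumr_ge0// => e _; rewrite mulr_ge0// sumr_ge0.
apply: (@expect_tower_genealogy n).
- apply: (@nnrv_history n.+1) => [w|w w' h].
    by apply: sumr_ge0 => u _; apply: sumr_ge0 => v _; rewrite mulr_ge0.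
  rewrite (generation_eq h); apply: eq_big_seq => u un; apply: eq_big_seq => v vn.
  by rewrite !(position_eq h).
- apply: (@nnrv_genealogy n) => [w|w w' h gw].
    by apply: sumr_ge0 => u _; apply: sumr_ge0 => v _; rewrite mulr_ge0.
  rewrite gw; apply: eq_big_seq => u /parent_mem un.
  apply: eq_big_seq => v /parent_mem vn.
  by rewrite !(position_eq h).
move=> w0; set C := genealogy_cell _ _ _ _.
have [_ indC] := indep_history_cell hbrw n w0.
have mC := indC.1; set s := G n.+1 w0.
pose a u := X (parent u) w0.
have Xa u w : C w -> u \in s -> X u w = a u + step u w.
  move=> [h gw] us; rewrite (position_parent _ us); congr (_ + _).
  by apply: (position_eq h); exact: parent_mem us.
rewrite (@eq_expect _ _ _ _ _ _ (fun w => \sum_(u <- s) \sum_(v <- s)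
    I u v * g (a u + step u w) (a v + step v w))); last first.
  move=> w Cw; rewrite Cw.2 -/s; apply: eq_big_seq => u us.
  by apply: eq_big_seq => v vs; rewrite !Xa.
rewrite [RHS](@eq_expect _ _ _ _ _ _ (fun w => \sum_(u <- s) \sum_(v <- s)
    I u v * pair_op g (a u) (a v))); last first.
  move=> w Cw; rewrite Cw.2 -/s; apply: eq_big_seq => u us.
  apply: eq_big_seq => v vs.
  by rewrite !(position_eq Cw.1) ?(parent_mem us) ?(parent_mem vs).
have nst u v : nnrv (fun w => I u v * g (a u + step u w) (a v + step v w)).
  apply: nnrvZ => //.
  exact: (nnrv_step2 u v (g := fun e e' => g (a u + e) (a v + e'))).
rewrite expect_sum//; last by move=> u; apply: nnrv_sum.
rewrite expect_cst// -sumEFin muleC ge0_sume_distrr; last first.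
  by move=> u _; rewrite lee_fin sumr_ge0// => v _; rewrite mulr_ge0.
apply: eq_big_seq => u us.
rewrite expect_sum// -sumEFin ge0_sume_distrr; last first.
  by move=> v _; rewrite lee_fin mulr_ge0.
apply: eq_big_seq => v vs.
rewrite expectZ//; last exact: (nnrv_step2 u v (g := fun e e' => g (a u + e) (a v + e'))).
have [->|/eqP uv] := eqVneq u v; first by rewrite Iuu mul0e mul0r mule0.
rewrite (expect_step2 _ _ indC)//.
- by rewrite EFinM muleCA.
- by rewrite (size_generation us).
- by rewrite (size_generation vs).
Qed.

Lemma expect_nchild1 n w0 u : u \in G n w0 ->
  expect P (history_cell nchild step n w0) (fun w => (nchild u w)%:R) =
  P (history_cell nchild step n w0).
Proof.
move=> un; have [indC _] := indep_history_cell hbrw n w0.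
have := @expect_indep_nchild _ _ _ _ _ _ _ hbrw _ _ _ [:: u]
  (fun _ l => l%:R) (fun=> 1) indC isT.
rewrite big_seq1 mule1 => <- //.
- by apply: eq_expect => w _; rewrite big_seq1.
- by move=> v; rewrite inE => /eqP ->; rewrite (size_generation un).
Qed.

Lemma expect_nchild_pair n w0 u v (f g : nat -> R) (a b : R) :
  u \in G n w0 -> v \in G n w0 -> u != v ->
  (forall l, 0 <= f l) -> (forall l, 0 <= g l) ->
  expect Q setT f = a%:E -> expect Q setT g = b%:E ->
  expect P (history_cell nchild step n w0) (fun w => f (nchild u w) * g (nchild v w)) =
  (P (history_cell nchild step n w0) * (a * b)%:E)%E.
Proof.
move=> un vn uv f0 g0 fa gb; have [indC _] := indep_history_cell hbrw n w0.
have := @expect_indep_nchild _ _ _ _ _ _ _ hbrw _ _ _ [:: u; v]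
  (fun t => if t == u then f else g) (fun t => if t == u then a else b) indC.
rewrite /= inE uv !big_cons !big_nil eqxx (negbTE (_ : v != u)) 1?eq_sym// !mulr1 => <- //.
- by apply: eq_expect => w _; rewrite !big_cons !big_nil eqxx eq_sym (negbTE uv) mulr1.
- by move=> t; rewrite !inE => /orP[]/eqP ->; rewrite ?(size_generation un) ?(size_generation vn).
- by move=> t l; case: ifP.
- by move=> t _; case: ifP.
Qed.

End pair_moments.

(** * The recursion for sums over pairs of particles *)

Section pair_recursion.
Context {disp : measure_display} {Omega : measurableType disp} {R : realType}.
Variables (P : probability Omega R) (Q : probability nat R).
Variables (nchild : label -> Omega -> nat) (step : label -> Omega -> site 2).
Hypothesis hbrw : brw_driver P Q nchild step.
Hypothesis mean1 : expect Q setT (fun l => l%:R) = 1%E.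

Notation EX := (expect P setT).
Notation G := (generation nchild).
Notation X := (position step).
Notation history := (history nchild step).

Lemma pair_count_ge0 c l : 0 <= pair_count R c l.
Proof. by apply: sumr_ge0 => i _; apply: sumr_ge0 => j _; rewrite ler0n. Qed.

Lemma nnrv_pair_sum n (a : label -> label -> Omega -> R) (g : site 2 -> site 2 -> R) :
  (forall u v w, 0 <= a u v w) -> (forall x y, 0 <= g x y) ->
  (forall u v w w', history n w = history n w' -> G n.+1 w = G n.+1 w' ->
     u \in G n w' -> v \in G n w' -> a u v w = a u v w') ->
  nnrv (fun w => \sum_(u <- G n w) \sum_(v <- G n w) a u v w * g (X u w) (X v w)).
Proof.
move=> a0 g0 ha; apply: (nnrv_genealogy hbrw (n := n)) => [w|w w' h gw].
  by apply: sumr_ge0 => u _; apply: sumr_ge0 => v _; rewrite mulr_ge0.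
rewrite (generation_eq h); apply: eq_big_seq => u un; apply: eq_big_seq => v vn.
by rewrite !(position_eq h)// (ha u v w w').
Qed.

Lemma nchild_eq n w w' u : history n w = history n w' -> G n.+1 w = G n.+1 w' ->
  u \in G n w' -> nchild u w = nchild u w'.
Proof. by move=> h gw un; rewrite !(@nchild_count _ _ n) ?(generation_eq h)// gw. Qed.

(** Given the history, two distinct parents contribute the product of two independent offspring
    numbers, of mean 1, and a single parent contributes the mean of [f]. *)
Lemma expect_branch_pairs n (I : label -> label -> R) (f : nat -> R) (b : R)
    (g : site 2 -> site 2 -> R) :
  (forall u v, 0 <= I u v) -> (forall l, 0 <= f l) -> (forall x y, 0 <= g x y) ->
  expect Q setT f = b%:E ->
  EX (fun w => \sum_(u <- G n w) \sum_(v <- G n w)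
    (if u == v then f (nchild u w) else I u v * ((nchild u w)%:R * (nchild v w)%:R))
      * g (X u w) (X v w)) =
  EX (fun w => \sum_(u <- G n w) \sum_(v <- G n w)
    (if u == v then b else I u v) * g (X u w) (X v w)).
Proof.
move=> I0 f0 g0 fb.
have b0 : 0 <= b by rewrite -lee_fin -fb; apply: expect_ge0; exact: nnrv_nat.
have IF0 u v : 0 <= if u == v then b else I u v by case: ifP.
apply: (@expect_tower_history _ _ _ _ _ _ _ hbrw n).
- apply: (@nnrv_pair_sum n (fun u v w => if u == v then f (nchild u w)
    else I u v * ((nchild u w)%:R * (nchild v w)%:R))) => //.
    by move=> u v w; case: ifP; rewrite ?f0// => _; rewrite !mulr_ge0.
  by move=> u v w w' h gw un vn; rewrite (nchild_eq h gw un) (nchild_eq h gw vn).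
- exact: (@nnrv_pair_sum n (fun u v w => if u == v then b else I u v)).
move=> w0; set C := history_cell _ _ _ _.
have [indC _] := indep_history_cell hbrw n w0.
have mC := indC.1; set s := G n w0.
pose x u := X u w0.
rewrite (@eq_expect _ _ _ _ _ _ (fun w => \sum_(u <- s) \sum_(v <- s)
    g (x u) (x v) * (if u == v then f (nchild u w)
                     else I u v * ((nchild u w)%:R * (nchild v w)%:R)))); last first.
  move=> w Cw; rewrite (generation_eq Cw) -/s; apply: eq_big_seq => u us.
  by apply: eq_big_seq => v vs; rewrite !(position_eq Cw)// mulrC.
rewrite [RHS](@eq_expect _ _ _ _ _ _ (fun w => \sum_(u <- s) \sum_(v <- s)
    (if u == v then b else I u v) * g (x u) (x v))); last first.
  move=> w Cw; rewrite (generation_eq Cw) -/s; apply: eq_big_seq => u us.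
  by apply: eq_big_seq => v vs; rewrite !(position_eq Cw).
have nN u v : nnrv (fun w => (nchild u w)%:R * (nchild v w)%:R : R).
  by apply: nnrvM; exact: (nnrv_nchild hbrw _ (g := fun l => l%:R)).
have nf u v : nnrv (fun w => if u == v then f (nchild u w)
                     else I u v * ((nchild u w)%:R * (nchild v w)%:R)).
  by case: (u == v); [exact: (nnrv_nchild hbrw)|exact: nnrvZ].
have nst u v : nnrv (fun w => g (x u) (x v) * (if u == v then f (nchild u w)
                     else I u v * ((nchild u w)%:R * (nchild v w)%:R))).
  exact: nnrvZ.
rewrite expect_sum//; last by move=> u; apply: nnrv_sum.
rewrite expect_cst// -sumEFin muleC ge0_sume_distrr; last first.
  by move=> u _; rewrite lee_fin sumr_ge0// => v _; rewrite mulr_ge0.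
apply: eq_big_seq => u us.
rewrite expect_sum// -sumEFin ge0_sume_distrr; last first.
  by move=> v _; rewrite lee_fin mulr_ge0.
apply: eq_big_seq => v vs; rewrite expectZ//.
rewrite [in RHS]EFinM [RHS]muleA [RHS]muleC; congr (_ * _)%E.
have [_|uv] := eqVneq u v.
  have := @expect_indep_nchild _ _ _ _ _ _ _ hbrw _ _ _ [:: u]
    (fun _ => f) (fun=> b) indC isT.
  rewrite big_seq1 => <- //.
    by apply: eq_expect => w _; rewrite big_seq1.
  by move=> t; rewrite inE => /eqP ->; rewrite (size_generation us).
rewrite expectZ//.
rewrite (expect_nchild_pair hbrw us vs uv (f := fun l => l%:R) (g := fun l => l%:R)
  (a := 1) (b := 1))//.
by rewrite mulr1 mule1 muleC.
Qed.

Lemma sum_iota1 (k : nat) : \sum_(i <- iota 0 k) 1 = k%:R :> R.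
Proof. by rewrite big_const_seq count_predT size_iota iter_addr_0. Qed.

Lemma child_pairs c n w u v : irreflexive c -> u \in G n w -> v \in G n w ->
  \sum_(i <- iota 0 (nchild u w)) \sum_(j <- iota 0 (nchild v w))
    (diverge c (rcons u i) (rcons v j))%:R =
  if u == v then pair_count R c (nchild u w)
  else (diverge c u v)%:R * ((nchild u w)%:R * (nchild v w)%:R).
Proof.
move=> irr un vn.
have dr i j := diverge_rcons i j irr (etrans (size_generation un) (esym (size_generation vn))).
case: eqVneq dr => [<-|uv] dr.
  by apply: eq_bigr => i _; apply: eq_bigr => j _; rewrite dr.
under eq_bigr => i _ do under eq_bigr => j _ do rewrite dr.
rewrite -(sum_iota1 (nchild u w)) -(sum_iota1 (nchild v w)).
rewrite mulr_suml mulr_sumr; apply: eq_bigr => i _.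
by rewrite mul1r mulr_sumr; apply: eq_bigr => j _; rewrite mulr1.
Qed.

Definition pair_sum (c : rel nat) n (g : site 2 -> site 2 -> R) w : R :=
  \sum_(u <- G n w) \sum_(v <- G n w) (diverge c u v)%:R * g (X u w) (X v w).

Lemma nnrv_pair_sum_diverge c n g : (forall x y, 0 <= g x y) -> nnrv (pair_sum c n g).
Proof.
move=> g0; exact: (@nnrv_pair_sum n (fun u v _ => (diverge c u v)%:R)).
Qed.

Lemma pair_op_ge0 (g : site 2 -> site 2 -> R) :
  (forall x y, 0 <= g x y) -> forall x y, 0 <= pair_op g x y.
Proof.
by move=> g0 x y; rewrite mulr_ge0// sumr_ge0// => e _; rewrite mulr_ge0// sumr_ge0.
Qed.

Lemma sum_generationS2 n w (F : label -> label -> R) :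
  \sum_(u <- G n.+1 w) \sum_(v <- G n.+1 w) F u v =
  \sum_(u <- G n w) \sum_(v <- G n w)
    \sum_(i <- iota 0 (nchild u w)) \sum_(j <- iota 0 (nchild v w))
      F (rcons u i) (rcons v j).
Proof.
rewrite big_generationS; apply: eq_bigr => u _; rewrite [RHS]exchange_big.
by apply: eq_bigr => i _; rewrite big_generationS.
Qed.

Lemma sum_diag n w (F : label -> label -> R) u : u \in G n w ->
  \sum_(v <- G n w) (u == v)%:R * F u v = F u u.
Proof.
move=> un; rewrite (bigD1_seq _ un (uniq_generation _ _ _))/= eqxx mul1r.
by rewrite big1 ?addr0// => v /negbTE; rewrite eq_sym => ->; rewrite mul0r.
Qed.

(** A separated pair of generation n + 1 comes either from a pair already separated, each such pair
    having on average one pair of children by criticality, or from two siblings, of which a parent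
    has on average [b] pairs. *)
Lemma expect_pair_sumS c n g (b : R) : irreflexive c -> (forall x y, 0 <= g x y) ->
  expect Q setT (pair_count R c) = b%:E ->
  EX (pair_sum c n.+1 g) =
  (EX (pair_sum c n (pair_op g)) +
   b%:E * EX (fun w => (\sum_(u <- G n w) pair_op g (X u w) (X u w))%R))%E.
Proof.
move=> irr g0 eb; have pg0 := pair_op_ge0 g0.
have b0 : 0 <= b.
  by rewrite -lee_fin -eb; apply: expect_ge0; apply: nnrv_nat; exact: pair_count_ge0.
rewrite (@expect_move_pairs _ _ _ _ _ _ _ hbrw n (fun u v => (diverge c u v)%:R))//;
  last by move=> u; rewrite divergexx.
transitivity (EX (fun w => \sum_(u <- G n w) \sum_(v <- G n w)
    (if u == v then pair_count R c (nchild u w)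
     else (diverge c u v)%:R * ((nchild u w)%:R * (nchild v w)%:R))
      * pair_op g (X u w) (X v w))).
  apply: eq_expect => w _; rewrite sum_generationS2.
  apply: eq_big_seq => u un; apply: eq_big_seq => v vn.
  rewrite -(child_pairs irr un vn) mulr_suml; apply: eq_bigr => i _.
  by rewrite mulr_suml; apply: eq_bigr => j _; rewrite !parent_rcons.
rewrite (@expect_branch_pairs n (fun u v => (diverge c u v)%:R) _ _ _ _ _ _ eb)//;
  last exact: pair_count_ge0.
rewrite -expectZ//; last first.
  apply: (nnrv_history hbrw (n := n)) => [w|w w' h]; first by rewrite sumr_ge0.
  rewrite (generation_eq h); apply: eq_big_seq => u un.
  by rewrite (position_eq h).
rewrite -expectD//; last first.
- apply: (nnrv_history hbrw (n := n)) => [w|w w' h]; first by rewrite mulr_ge0// sumr_ge0.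
  rewrite (generation_eq h); congr (_ * _); apply: eq_big_seq => u un.
  by rewrite (position_eq h).
- exact: nnrv_pair_sum_diverge.
apply: eq_expect => w _; rewrite mulr_sumr -big_split; apply: eq_big_seq => u un /=.
rewrite -(sum_diag (fun u v => b * pair_op g (X u w) (X v w)) un) -big_split.
apply: eq_bigr => v _ /=; case: eqVneq => [<-|_].
  by rewrite divergexx mul0r add0r mul1r.
by rewrite mul0r addr0.
Qed.

Lemma expect_generation_size n : EX (fun w => (size (G n w))%:R) = 1%E.
Proof.
elim: n => [|n IH]; first by rewrite (expect_cst P 1 measurableT) probability_setT mule1.
rewrite -IH; apply: (@expect_tower_history _ _ _ _ _ _ _ hbrw n).
- by apply: (nnrv_history hbrw (n := n.+1)) => [w|w w' h]; rewrite ?(generation_eq h).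
- by apply: (nnrv_history hbrw (n := n)) => [w|w w' h]; rewrite ?(generation_eq h).
move=> w0; have [indC _] := indep_history_cell hbrw n w0; have mC := indC.1.
rewrite (@eq_expect _ _ _ _ _ _ (fun w => \sum_(u <- G n w0) (nchild u w)%:R)); last first.
  move=> w Cw; rewrite -sum1_size big_generationS natr_sum -(generation_eq Cw).
  by apply: eq_bigr => u _; rewrite sum1_size size_iota.
rewrite expect_sum//; last by move=> u; exact: (nnrv_nchild hbrw _ (g := fun l => l%:R)).
rewrite (@eq_expect _ _ _ _ _ _ (fun=> (size (G n w0))%:R)); last first.
  by move=> w Cw; rewrite (generation_eq Cw).
rewrite (eq_big_seq _ (fun u un => expect_nchild1 hbrw mean1 un)) expect_cst//.
rewrite -sum1_size natr_sum -sumEFin ge0_sume_distrl//.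
by apply: eq_bigr => u _; rewrite mul1e.
Qed.

(* The hypothesis on [rho] is a form of translation invariance. *)
Lemma expect_pair_sum c n g (b : R) (rho : nat -> R) i :
  irreflexive c -> (forall x y, 0 <= g x y) ->
  expect Q setT (pair_count R c) = b%:E ->
  (forall k x, iter k pair_op g x x = rho k) ->
  EX (pair_sum c n (iter i pair_op g)) = (b * \sum_(j < n) rho (i + j).+1)%:E.
Proof.
move=> irr g0 eb grho.
have ig0 k : forall x y, 0 <= iter k pair_op g x y.
  by elim: k => //= k IH; exact: pair_op_ge0.
(* The index [i] is generalized because each backward step applies [pair_op] once more to the
   kernel. *)
elim: n i => [|n IH] i.
  rewrite big_ord0 mulr0 (@eq_expect _ _ _ _ _ _ (fun=> 0)) ?expect_cst ?mul0e//.
  by move=> w _; rewrite /pair_sum /= !big_seq1 mul0r.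
rewrite (expect_pair_sumS _ irr (ig0 i) eb) -iterS IH.
have -> : EX (fun w => \sum_(u <- G n w) iter i.+1 pair_op g (X u w) (X u w)) = (rho i.+1)%:E.
  rewrite (@eq_expect _ _ _ _ _ _ (fun w => rho i.+1 * (size (G n w))%:R)); last first.
    move=> w _; rewrite -sum1_size natr_sum mulr_sumr; apply: eq_bigr => u _.
    by rewrite mulr1; exact: grho i.+1 _.
  rewrite expectZ// ?expect_generation_size ?mule1//.
    by rewrite -(grho i.+1 0).
  by apply: (nnrv_history hbrw (n := n)) => [w|w w' h]; rewrite ?(generation_eq h).
rewrite -EFinM -EFinD big_ord_recl mulrDr addn0 addrC; congr (_ + _ * _)%:E.
by apply: eq_bigr => j _; rewrite lift0 addnS.
Qed.

End pair_recursion.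

(** * Triples of particles *)

Section triple_recursion.
Context {disp : measure_display} {Omega : measurableType disp} {R : realType}.
Variables (P : probability Omega R) (Q : probability nat R).
Variables (nchild : label -> Omega -> nat) (step : label -> Omega -> site 2).
Hypothesis hbrw : brw_driver P Q nchild step.
Hypothesis mean1 : expect Q setT (fun l => l%:R) = 1%E.

Notation EX := (expect P setT).
Notation G := (generation nchild).
Notation X := (position step).
Notation history := (history nchild step).
Notation neq := (fun i j : nat => i != j).

Lemma triple_op_ge0 (g : site 2 -> site 2 -> site 2 -> R) :
  (forall x y z, 0 <= g x y z) -> forall x y z, 0 <= triple_op g x y z.
Proof.
move=> g0 x y z; rewrite mulr_ge0// sumr_ge0// => e _; rewrite mulr_ge0// sumr_ge0// => e' _.
by rewrite mulr_ge0// sumr_ge0.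
Qed.

Lemma nnrv_triple_sum n (a : label -> label -> label -> Omega -> R)
    (g : site 2 -> site 2 -> site 2 -> R) :
  (forall u v t w, 0 <= a u v t w) -> (forall x y z, 0 <= g x y z) ->
  (forall u v t w w', history n w = history n w' -> G n.+1 w = G n.+1 w' ->
     u \in G n w' -> v \in G n w' -> t \in G n w' -> a u v t w = a u v t w') ->
  nnrv (fun w => \sum_(u <- G n w) \sum_(v <- G n w) \sum_(t <- G n w)
    a u v t w * g (X u w) (X v w) (X t w)).
Proof.
move=> a0 g0 ha; apply: (nnrv_genealogy hbrw (n := n)) => [w|w w' h gw].
  apply: sumr_ge0 => u _; apply: sumr_ge0 => v _; apply: sumr_ge0 => t _.
  by rewrite mulr_ge0.
rewrite (generation_eq h); apply: eq_big_seq => u un; apply: eq_big_seq => v vn.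
apply: eq_big_seq => t tn.
by rewrite !(position_eq h)// (ha u v t w w').
Qed.

Lemma expect_triple_cell (C : set Omega) (s : seq label) (N : label -> label -> label -> Omega -> R)
    (m : label -> label -> label -> R) :
  measurable C -> (forall u v t, nnrv (N u v t)) -> (forall u v t, 0 <= m u v t) ->
  (forall u v t, u \in s -> v \in s -> t \in s -> expect P C (N u v t) = (P C * (m u v t)%:E)%E) ->
  expect P C (fun w => \sum_(u <- s) \sum_(v <- s) \sum_(t <- s) N u v t w) =
  expect P C (fun w => \sum_(u <- s) \sum_(v <- s) \sum_(t <- s) m u v t).
Proof.
move=> mC nN m0 Nm.
rewrite expect_sum//; last by move=> u; apply: nnrv_sum => v; exact: nnrv_sum.
rewrite expect_cst// -sumEFin muleC ge0_sume_distrr; last first.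
  by move=> u _; rewrite lee_fin sumr_ge0// => v _; rewrite sumr_ge0.
apply: eq_big_seq => u us.
rewrite expect_sum//; last by move=> v; exact: nnrv_sum.
rewrite -sumEFin ge0_sume_distrr; last first.
  by move=> v _; rewrite lee_fin sumr_ge0.
apply: eq_big_seq => v vs.
rewrite expect_sum// -sumEFin ge0_sume_distrr; last first.
  by move=> t _; rewrite lee_fin.
by apply: eq_big_seq => t ts; exact: Nm.
Qed.

Lemma expect_move_triples n (I : label -> label -> label -> R)
    (g : site 2 -> site 2 -> site 2 -> R) :
  (forall u v t, 0 <= I u v t) ->
  (forall u v t, ~~ [&& u != v, u != t & v != t] -> I u v t = 0) ->
  (forall x y z, 0 <= g x y z) ->
  EX (fun w => \sum_(u <- G n.+1 w) \sum_(v <- G n.+1 w) \sum_(t <- G n.+1 w)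
                 I u v t * g (X u w) (X v w) (X t w)) =
  EX (fun w => \sum_(u <- G n.+1 w) \sum_(v <- G n.+1 w) \sum_(t <- G n.+1 w)
                 I u v t * triple_op g (X (parent u) w) (X (parent v) w) (X (parent t) w)).
Proof.
move=> I0 Id g0; have tg0 := triple_op_ge0 g0.
apply: (@expect_tower_genealogy _ _ _ _ _ _ _ hbrw n).
- exact: (@nnrv_triple_sum n.+1 (fun u v t _ => I u v t)).
- apply: (nnrv_genealogy hbrw (n := n)) => [w|w w' h gw].
    apply: sumr_ge0 => u _; apply: sumr_ge0 => v _; apply: sumr_ge0 => t _.
    by rewrite mulr_ge0.
  rewrite gw; apply: eq_big_seq => u /parent_mem un.
  apply: eq_big_seq => v /parent_mem vn; apply: eq_big_seq => t /parent_mem tn.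
  by rewrite !(position_eq h).
move=> w0; set C := genealogy_cell _ _ _ _.
have [_ indC] := indep_history_cell hbrw n w0.
have mC := indC.1; set s := G n.+1 w0.
pose a u := X (parent u) w0.
have Xa u w : C w -> u \in s -> X u w = a u + step u w.
  move=> [h gw] us; rewrite (position_parent _ _ us); congr (_ + _).
  by apply: (position_eq h); exact: parent_mem us.
rewrite (@eq_expect _ _ _ _ _ _ (fun w => \sum_(u <- s) \sum_(v <- s) \sum_(t <- s)
    I u v t * g (a u + step u w) (a v + step v w) (a t + step t w))); last first.
  move=> w Cw; rewrite Cw.2 -/s; apply: eq_big_seq => u us.
  by apply: eq_big_seq => v vs; apply: eq_big_seq => t ts; rewrite !Xa.
rewrite [RHS](@eq_expect _ _ _ _ _ _ (fun w => \sum_(u <- s) \sum_(v <- s) \sum_(t <- s)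
    I u v t * triple_op g (a u) (a v) (a t))); last first.
  move=> w Cw; rewrite Cw.2 -/s; apply: eq_big_seq => u us.
  apply: eq_big_seq => v vs; apply: eq_big_seq => t ts.
  by rewrite !(position_eq Cw.1) ?(parent_mem us) ?(parent_mem vs) ?(parent_mem ts).
have ng u v t : nnrv (fun w => g (a u + step u w) (a v + step v w) (a t + step t w)).
  exact: (nnrv_step3 hbrw u v t (g := fun e e' e'' => g (a u + e) (a v + e') (a t + e''))).
apply: (@expect_triple_cell C s (fun u v t w => I u v t *
    g (a u + step u w) (a v + step v w) (a t + step t w))
  (fun u v t => I u v t * triple_op g (a u) (a v) (a t))) => //.
- by move=> u v t; exact: nnrvZ.
- by move=> u v t; rewrite mulr_ge0.
move=> u v t us vs ts; rewrite expectZ//.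
have [/and3P[/eqP uv /eqP ut /eqP vt]|/Id ->] := boolP [&& u != v, u != t & v != t];
  last by rewrite mul0e mul0r mule0.
rewrite (expect_step3 hbrw _ _ _ indC)//.
- by rewrite EFinM muleCA.
- by rewrite (size_generation us).
- by rewrite (size_generation vs).
- by rewrite (size_generation ts).
Qed.

Variables (c : rel nat) (b s2 : R).
Hypothesis irr : irreflexive c.
Hypothesis c_fun : forall i j k, c i j -> c i k -> j = k.
Hypothesis mean_pairs : expect Q setT (pair_count R c) = b%:E.
Hypothesis mean_neq : expect Q setT (pair_count R neq) = s2%:E.

(** These triples are the off-diagonal terms of the square of the number of partners of [u]. *)
Definition branch3 (u v t : label) : bool :=
  [&& diverge c u v, diverge c u t & v != t].

Definition triple_sum n (g : site 2 -> site 2 -> site 2 -> R) w : R :=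
  \sum_(u <- G n w) \sum_(v <- G n w) \sum_(t <- G n w)
    (branch3 u v t)%:R * g (X u w) (X v w) (X t w).

Lemma branch3_neq u v t : ~~ [&& u != v, u != t & v != t] -> branch3 u v t = false.
Proof.
rewrite /branch3 !negb_and !negbK => /or3P[]/eqP ->;
  by rewrite ?divergexx ?eqxx ?andbF.
Qed.

(** The number of triples of children of given parents, according to which parents coincide. When
    all three do, the first case applies and [diverge c u u] makes it vanish. *)
Let weight u v t w : R :=
  if u == v then
    (diverge c u t)%:R * (pair_count R c (nchild u w) * (nchild t w)%:R)
  else if u == t then
    (diverge c u v)%:R * (pair_count R c (nchild u w) * (nchild v w)%:R)
  else if v == t then
    (diverge c u v)%:R * ((nchild u w)%:R * pair_count R neq (nchild v w))
  else (branch3 u v t)%:R *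
    ((nchild u w)%:R * ((nchild v w)%:R * (nchild t w)%:R)).

Let mean_weight u v t : R :=
  if u == v then (diverge c u t)%:R * b
  else if u == t then (diverge c u v)%:R * b
  else if v == t then (diverge c u v)%:R * s2
  else (branch3 u v t)%:R.

Lemma child_triples n w u v t : u \in G n w -> v \in G n w -> t \in G n w ->
  \sum_(i <- iota 0 (nchild u w)) \sum_(j <- iota 0 (nchild v w))
    \sum_(k <- iota 0 (nchild t w))
      (branch3 (rcons u i) (rcons v j) (rcons t k))%:R = weight u v t w.
Proof.
move=> un vn tn; rewrite /weight /branch3.
have sz x y : x \in G n w -> y \in G n w -> size x = size y.
  by move=> xn yn; rewrite (size_generation xn) (size_generation yn).
under eq_bigr => i _ do under eq_bigr => j _ do under eq_bigr => k _ do
  rewrite (diverge_rcons i j irr (sz _ _ un vn)) (diverge_rcons i k irr (sz _ _ un tn))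
    eqseq_rcons.
have sum1 k (x : R) : \sum_(i <- iota 0 k) x = x * k%:R.
  by rewrite -(@sum_iota1 R k) mulr_sumr; apply: eq_bigr => i _; rewrite mulr1.
case: (eqVneq u v) => [euv|uv].
  rewrite -euv; case: (eqVneq u t) => [eut|ut].
    (* A common parent of the three would require two different partners of the child [i], which
       [c_fun] excludes. Thus no third moment of the offspring law appears. *)
    rewrite -eut divergexx mul0r big1// => i _; rewrite big1// => j _; rewrite big1// => k _.
    case: (boolP (c i j)) => //= ij; case: (boolP (c i k)) => //= ik.
    by rewrite (c_fun ij ik) !eqxx.
  rewrite /= /pair_count; under eq_bigr => i _ do under eq_bigr => j _ do
    under eq_bigr => k _ do rewrite andbT -mulnb natrM.
  under eq_bigr => i _ do under eq_bigr => j _ do rewrite sum1.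
  under eq_bigr => i _ do rewrite -!mulr_suml.
  by rewrite -!mulr_suml; ring.
case: (eqVneq u t) => [eut|ut].
  rewrite -eut (eq_sym v u) (negbTE uv) /= /pair_count.
  under eq_bigr => i _ do under eq_bigr => j _ do
    under eq_bigr => k _ do rewrite andbT -mulnb natrM.
  under eq_bigr => i _ do under eq_bigr => j _ do rewrite -mulr_sumr.
  under eq_bigr => i _ do rewrite sum1.
  rewrite -mulr_suml -mulr_sumr; ring.
(* Here the second and third particles are siblings whose parent has already left the lineage of the
   first. They may be any two distinct children, whence the count for [neq]. *)
case: (eqVneq v t) => [evt|vt].
  rewrite -evt /pair_count.
  under eq_bigr => i _ do under eq_bigr => j _ do
    under eq_bigr => k _ do rewrite andTb andbA andbb -mulnb natrM.
  under eq_bigr => i _ do under eq_bigr => j _ do rewrite -mulr_sumr.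
  under eq_bigr => i _ do rewrite -mulr_sumr.
  by rewrite sum1; ring.
rewrite /= !andbT.
under eq_bigr => i _ do under eq_bigr => j _ do rewrite sum1.
under eq_bigr => i _ do rewrite sum1.
by rewrite sum1; ring.
Qed.

Lemma sum_generationS3 n w (F : label -> label -> label -> R) :
  \sum_(u <- G n.+1 w) \sum_(v <- G n.+1 w) \sum_(t <- G n.+1 w) F u v t =
  \sum_(u <- G n w) \sum_(v <- G n w) \sum_(t <- G n w)
    \sum_(i <- iota 0 (nchild u w)) \sum_(j <- iota 0 (nchild v w))
      \sum_(k <- iota 0 (nchild t w)) F (rcons u i) (rcons v j) (rcons t k).
Proof.
rewrite sum_generationS2; apply: eq_bigr => u _; apply: eq_bigr => v _.
rewrite [RHS]exchange_big; apply: eq_bigr => i _.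
rewrite [RHS]exchange_big; apply: eq_bigr => j _.
by rewrite big_generationS.
Qed.

Lemma expect_branch_triples n (g : site 2 -> site 2 -> site 2 -> R) :
  (forall x y z, 0 <= g x y z) ->
  EX (fun w => \sum_(u <- G n w) \sum_(v <- G n w) \sum_(t <- G n w)
    weight u v t w * g (X u w) (X v w) (X t w)) =
  EX (fun w => \sum_(u <- G n w) \sum_(v <- G n w) \sum_(t <- G n w)
    mean_weight u v t * g (X u w) (X v w) (X t w)).
Proof.
move=> g0.
have pc0 c' l : 0 <= pair_count R c' l by exact: pair_count_ge0.
have b0 : 0 <= b by rewrite -lee_fin -mean_pairs; apply: expect_ge0; exact: nnrv_nat.
have s20 : 0 <= s2 by rewrite -lee_fin -mean_neq; apply: expect_ge0; exact: nnrv_nat.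
have m0 u v t : 0 <= mean_weight u v t.
  by rewrite /mean_weight; do 3?[case: ifP => _]; rewrite ?mulr_ge0.
have w0 u v t w : 0 <= weight u v t w.
  rewrite /weight.
  by do 3?[case: ifP => _]; rewrite ?(mulr_ge0, pc0).
have nwt u v t : nnrv (weight u v t).
  have nc := nnrv_nchild hbrw; have id0 l : 0 <= l%:R :> R by [].
  have nN u' := nc u' (fun l => l%:R) id0.
  have np u' c' := nc u' _ (pc0 c').
  rewrite /weight; case: (u == v).
    by apply: nnrvZ => //; apply: nnrvM.
  case: (u == t); first by apply: nnrvZ => //; apply: nnrvM.
  case: (v == t); first by apply: nnrvZ => //; apply: nnrvM.
  by apply: nnrvZ => //; apply: nnrvM => //; apply: nnrvM.
apply: (@expect_tower_history _ _ _ _ _ _ _ hbrw n).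
- apply: nnrv_triple_sum => // u v t w w' h gw un vn tn.
  rewrite /weight.
  by rewrite (nchild_eq h gw un) (nchild_eq h gw vn) (nchild_eq h gw tn).
- exact: (@nnrv_triple_sum n (fun u v t _ => mean_weight u v t)).
move=> w1; set C := history_cell _ _ _ _.
have [indC _] := indep_history_cell hbrw n w1.
have mC := indC.1; set s := G n w1.
pose x u := X u w1.
rewrite (@eq_expect _ _ _ _ _ _ (fun w => \sum_(u <- s) \sum_(v <- s) \sum_(t <- s)
    g (x u) (x v) (x t) * weight u v t w)); last first.
  move=> w Cw; rewrite (generation_eq Cw) -/s; apply: eq_big_seq => u us.
  apply: eq_big_seq => v vs; apply: eq_big_seq => t ts.
  by rewrite !(position_eq Cw)// mulrC.
rewrite [RHS](@eq_expect _ _ _ _ _ _ (fun w => \sum_(u <- s) \sum_(v <- s) \sum_(t <- s)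
    g (x u) (x v) (x t) * mean_weight u v t)); last first.
  move=> w Cw; rewrite (generation_eq Cw) -/s; apply: eq_big_seq => u us.
  apply: eq_big_seq => v vs; apply: eq_big_seq => t ts.
  by rewrite !(position_eq Cw)// mulrC.
apply: (@expect_triple_cell C s (fun u v t w => g (x u) (x v) (x t) * weight u v t w)
  (fun u v t => g (x u) (x v) (x t) * mean_weight u v t)) => //.
- by move=> u v t; exact: nnrvZ.
- by move=> u v t; rewrite mulr_ge0.
move=> u v t us vs ts; rewrite expectZ// EFinM muleCA; congr (_ * _)%E.
have nn0 : forall l, 0 <= l%:R :> R by [].
rewrite /weight /mean_weight.
have [_|uv] := eqVneq u v.
  have [<-|ut] := eqVneq u t.
    rewrite divergexx mul0r mule0; under eq_expect => w _ do rewrite mul0r.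
    by rewrite expect_cst// mul0e.
  rewrite expectZ//; last by apply: nnrvM; [exact: (nnrv_nchild hbrw)|exact: (nnrv_nchild hbrw _ (g := fun l => l%:R))].
  rewrite (expect_nchild_pair hbrw us ts ut (pc0 c) nn0 mean_pairs mean1).
  by rewrite mulr1 EFinM muleCA.
have [_|ut] := eqVneq u t.
  rewrite expectZ//; last by apply: nnrvM; [exact: (nnrv_nchild hbrw)|exact: (nnrv_nchild hbrw _ (g := fun l => l%:R))].
  rewrite (expect_nchild_pair hbrw us vs uv (pc0 c) nn0 mean_pairs mean1).
  by rewrite mulr1 EFinM muleCA.
have [_|vt] := eqVneq v t.
  rewrite expectZ//; last by apply: nnrvM; [exact: (nnrv_nchild hbrw _ (g := fun l => l%:R))|exact: (nnrv_nchild hbrw)].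
  rewrite (expect_nchild_pair hbrw us vs uv nn0 (pc0 neq) mean1 mean_neq).
  by rewrite mul1r EFinM muleCA.
have nN u' := nnrv_nchild hbrw u' nn0.
rewrite expectZ//; last by apply: nnrvM => //; apply: nnrvM.
have := @expect_indep_nchild _ _ _ _ _ _ _ hbrw _ _ _ [:: u; v; t]
  (fun _ l => l%:R) (fun=> 1) indC.
rewrite /= !inE negb_or uv ut vt => H.
rewrite (@eq_expect _ _ _ _ _ _ (fun w => \prod_(u0 <- [:: u; v; t]) (nchild u0 w)%:R)); last first.
  by move=> w _; rewrite !big_cons big_nil mulr1.
rewrite H//; first by rewrite !big_cons big_nil !mulr1 mule1 muleC.
by move=> y; rewrite !inE => /or3P[]/eqP ->;
  rewrite ?(size_generation us) ?(size_generation vs) ?(size_generation ts).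
Qed.

(** One pair sum for each way in which exactly two of the three parents coincide. An upper bound is
    enough, so each term with a coincidence is simply dominated by the corresponding pair sum. *)
Lemma expect_triple_sumS n g : (forall x y z, 0 <= g x y z) ->
  (EX (triple_sum n.+1 g) <=
   EX (triple_sum n (triple_op g)) +
   (b%:E * EX (pair_sum nchild step c n (fun x y => triple_op g x x y)) +
    (b%:E * EX (pair_sum nchild step c n (fun x y => triple_op g x y x)) +
     s2%:E * EX (pair_sum nchild step c n (fun x y => triple_op g x y y)))))%E.
Proof.
move=> g0; have tg0 := triple_op_ge0 g0.
have b0 : 0 <= b.
  by rewrite -lee_fin -mean_pairs; apply: expect_ge0; apply: nnrv_nat; exact: pair_count_ge0.
have s20 : 0 <= s2.
  by rewrite -lee_fin -mean_neq; apply: expect_ge0; apply: nnrv_nat; exact: pair_count_ge0.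
rewrite (@expect_move_triples n (fun u v t => (branch3 u v t)%:R))//;
  last by move=> u v t /branch3_neq ->.
rewrite (_ : EX _ = EX (fun w => \sum_(u <- G n w) \sum_(v <- G n w) \sum_(t <- G n w)
    weight u v t w * triple_op g (X u w) (X v w) (X t w))); last first.
  apply: eq_expect => w _; rewrite sum_generationS3.
  apply: eq_big_seq => u un; apply: eq_big_seq => v vn; apply: eq_big_seq => t tn.
  rewrite -(child_triples un vn tn) mulr_suml; apply: eq_bigr => i _.
  rewrite mulr_suml; apply: eq_bigr => j _.
  by rewrite mulr_suml; apply: eq_bigr => k _; rewrite !parent_rcons.
rewrite expect_branch_triples//.
have nt : nnrv (triple_sum n (triple_op g)).
  exact: (@nnrv_triple_sum n (fun u v t _ => (branch3 u v t)%:R)).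
have n1 : nnrv (pair_sum nchild step c n (fun x y => triple_op g x x y)) by exact: (nnrv_pair_sum_diverge hbrw).
have n2 : nnrv (pair_sum nchild step c n (fun x y => triple_op g x y x)) by exact: (nnrv_pair_sum_diverge hbrw).
have n3 : nnrv (pair_sum nchild step c n (fun x y => triple_op g x y y)) by exact: (nnrv_pair_sum_diverge hbrw).
rewrite -!expectZ// -!expectD//; try by do ?[apply: nnrvD => //]; exact: nnrvZ.
apply: le_expect => //.
- apply: (@nnrv_triple_sum n (fun u v t _ => mean_weight u v t)) => // u v t _.
  by rewrite /mean_weight; do 3?[case: ifP => _]; rewrite ?mulr_ge0.
- by apply: nnrvD => //; apply: nnrvD; [exact: nnrvZ|apply: nnrvD; exact: nnrvZ].
move=> w _; rewrite /pair_sum /triple_sum.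
(* Each pair sum is rewritten as a triple sum with an indicator of the coincidence, and the
   comparison is then made term by term. *)
rewrite [X in _ <= _ + (X + _)]mulr_sumr [X in _ <= _ + (_ + (X + _))]mulr_sumr.
rewrite [X in _ <= _ + (_ + (_ + X))]mulr_sumr -!big_split.
rewrite [leLHS]big_seq [leRHS]big_seq; apply: ler_sum => u un.
rewrite [X in _ <= _ + (X + _)]mulr_sumr [X in _ <= _ + (_ + (X + _))]mulr_sumr.
rewrite [X in _ <= _ + (_ + (_ + X))]mulr_sumr.
set F1 := fun t => b * ((diverge c u t)%:R * triple_op g (X u w) (X u w) (X t w)).
rewrite [X in _ <= _ + (X + _)](_ : _ =
    \sum_(v <- G n w) (u == v)%:R * \sum_(t <- G n w) F1 t); last first.
  have := sum_diag (fun _ _ => 1 : R) un; under eq_bigr do rewrite mulr1.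
  by rewrite -mulr_suml => ->; rewrite mul1r.
rewrite -!big_split [leLHS]big_seq [leRHS]big_seq; apply: ler_sum => v vn.
set F2 := b * _; set F3 := s2 * _.
rewrite -[F2](sum_diag (fun _ _ => F2) un) -[F3](sum_diag (fun _ _ => F3) vn) mulr_sumr.
rewrite -!big_split; apply: ler_sum => t _ /=.
have F10 : 0 <= F1 t by rewrite /F1 mulr_ge0// mulr_ge0.
have F20 : 0 <= F2 by rewrite /F2 mulr_ge0// mulr_ge0.
have F30 : 0 <= F3 by rewrite /F3 mulr_ge0// mulr_ge0.
have B0 : 0 <= (branch3 u v t)%:R * triple_op g (X u w) (X v w) (X t w).
  by rewrite mulr_ge0.
rewrite /mean_weight.
case: eqVneq => [euv|uv].
  have -> : (diverge c u t)%:R * b * triple_op g (X u w) (X v w) (X t w) = F1 t.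
    by rewrite /F1 -euv; ring.
  by rewrite mul1r; case: (u == t); case: (v == t); rewrite ?mul1r ?mul0r; lra.
case: eqVneq => [eut|ut].
  have -> : (diverge c u v)%:R * b * triple_op g (X u w) (X v w) (X t w) = F2.
    by rewrite /F2 -eut; ring.
  by rewrite mul1r mul0r; case: (v == t); rewrite ?mul1r ?mul0r; lra.
case: eqVneq => [evt|vt]; last by rewrite !mul0r !addr0.
have -> : (diverge c u v)%:R * s2 * triple_op g (X u w) (X v w) (X t w) = F3.
  by rewrite /F3 -evt; ring.
by rewrite mul1r !mul0r; lra.
Qed.

End triple_recursion.

(** * The offspring law and the survival probability *)

Definition neq_rel : rel nat := fun i j => i != j.

(* Only the first two children of a particle are paired, so that no moment of
   the offspring law beyond the second one is needed. *)
Definition pair01 : rel nat := fun i j => [&& i != j, i < 2 & j < 2]%N.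

Lemma neq_rel_irr : irreflexive neq_rel.
Proof. by move=> i; rewrite /neq_rel eqxx. Qed.

Lemma pair01_irr : irreflexive pair01.
Proof. by move=> i; rewrite /pair01 eqxx. Qed.

Lemma pair01_fun i j k : pair01 i j -> pair01 i k -> j = k.
Proof. by move=> /and3P[/eqP ? ? ?] /and3P[/eqP ? ? ?]; lia. Qed.

Lemma pair_count_neq (R : realType) l :
  pair_count R neq_rel l = l%:R * l%:R - l%:R.
Proof.
rewrite -{3}(@sum_iota1 R l) -{1}(@sum_iota1 R l) mulr_suml -sumrB.
apply: eq_big_seq => i il; rewrite mul1r -(@sum_iota1 R l) (bigD1_seq i) ?iota_uniq//=.
rewrite [in RHS](bigD1_seq i) ?iota_uniq//= /neq_rel eqxx add0r addrAC subrr add0r.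
by apply: eq_bigr => j; rewrite eq_sym => ->.
Qed.

Lemma pair_count01 (R : realType) l :
  pair_count R pair01 l = if (2 <= l)%N then 2 else 0.
Proof.
case: l => [|[|l]]; rewrite /pair_count; first by rewrite big_nil.
  by rewrite !big_seq1.
have z i : (1 < i)%N -> \sum_(j <- iota 0 l.+2) (pair01 i j)%:R = 0 :> R.
  by move=> i2; rewrite big1// => j _; rewrite /pair01 [(i < 2)%N]ltnNge i2 andbF.
have z' i : \sum_(j <- iota 2 l) (pair01 i j)%:R = 0 :> R.
  rewrite big1_seq// => j; rewrite mem_iota => /andP[_ /andP[j2 _]].
  by rewrite /pair01 [(j < 2)%N]ltnNge j2 !andbF.
rewrite [iota 0 _]/= 2!big_cons [X in _ + (_ + X)]big1_seq; last first.
  by move=> i; rewrite mem_iota => /andP[_ /andP[/z]].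
by rewrite !big_cons !z' !addr0 /= add0r.
Qed.

Section offspring.
Context {R : realType} (Q : probability nat R) (sigma2 : R).
Hypothesis hQ : critical_offspring Q sigma2.

Lemma offspring_mean : expect Q setT (fun l => l%:R) = 1%E.
Proof. by have [+ _ _] := hQ; rewrite unlock. Qed.

Lemma offspring_pairs : expect Q setT (pair_count R neq_rel) = sigma2%:E.
Proof.
have nid : nnrv (fun l : nat => l%:R : R) by apply: nnrv_nat.
have nsq : nnrv (fun l : nat => (l%:R - 1) ^+ 2 : R).
  by apply: nnrv_nat => l; exact: sqr_ge0.
have npc : nnrv (pair_count R neq_rel) by apply: nnrv_nat => l; exact: pair_count_ge0.
have var : expect Q setT (fun l => (l%:R - 1) ^+ 2) = sigma2%:E.
  have [m1 + _] := hQ; rewrite /variance unlock m1 unlock /= => <-.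
  by apply: eq_integral => l _.
(* The identity l (l - 1) + l + 1 = (l - 1)^2 + 2 l, arranged without subtraction; the finiteness of
   the factorial moment comes out of it. *)
have e : (expect Q setT (pair_count R neq_rel) + expect Q setT (fun l => l%:R) + 1%:E)%E
       = (sigma2%:E + (expect Q setT (fun l => l%:R) + expect Q setT (fun l => l%:R)))%E.
  rewrite -var -[in LHS](mul1e 1%:E) -{2}(probability_setT Q) -(expect_cst Q 1 measurableT).
  rewrite -!expectD//; try by do ?apply: nnrvD => //; exact: nnrv_cst.
  by apply: eq_expect => l _; rewrite pair_count_neq; ring.
move: e; rewrite offspring_mean; have := expect_ge0 Q setT npc.
case: (expect Q setT (pair_count R neq_rel)) => [r _ | _ | ]//=.
by rewrite -!EFinD => -[e]; congr EFin; lra.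
Qed.

(* Twice the probability of at least two children. *)
Definition multi : R := fine (expect Q setT (pair_count R pair01)).

Let npair01 : nnrv (pair_count R pair01).
Proof. by apply: nnrv_nat => l; exact: pair_count_ge0. Qed.

Lemma offspring_pairs01 : expect Q setT (pair_count R pair01) = multi%:E.
Proof.
rewrite fineK// fin_num_abs gee0_abs; last exact: expect_ge0.
apply: (@le_lt_trans _ _ (expect Q setT (fun=> 2))).
  apply: le_expect => //.
  by move=> l _; rewrite pair_count01; case: ifP.
by rewrite expect_cst// probability_setT mule1 ltry.
Qed.

Lemma multi_le2 : multi <= 2.
Proof.
rewrite -lee_fin -offspring_pairs01 -[leRHS]mule1 -(probability_setT Q).
rewrite -(expect_cst Q 2 measurableT).
apply: le_expect => //.
by move=> l _; rewrite pair_count01; case: ifP.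
Qed.

(** Otherwise almost surely at most one child is born, l (l - 1) vanishes almost surely and the
    variance would be 0. *)
Lemma multi_gt0 : 0 < multi.
Proof.
have m0 : 0 <= multi by rewrite -lee_fin -offspring_pairs01; exact: expect_ge0.
rewrite lt_neqAle m0 andbT; apply/negP => /eqP e0.
have [_ _ s0] := hQ; move: s0; apply/negP; rewrite -leNgt -lee_fin -offspring_pairs.
pose A := [set l : nat | (2 <= l)%N].
have QA : Q A = 0%E.
  have : expect Q setT (pair_count R pair01) = 0%E by rewrite offspring_pairs01 -e0.
  rewrite (_ : pair_count R pair01 = fun l => 2 * \1_A l); last first.
    apply/funext => l; rewrite pair_count01 indicE.
    by case: ifP => h; [rewrite mem_set ?mulr1|rewrite memNset ?mulr0// => h2; rewrite h2 in h].
  rewrite expectZ//.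
  rewrite -probability_expect// => /eqP; rewrite mule_eq0 => /orP[|/eqP//].
  by rewrite eqe pnatr_eq0.
rewrite (@eq_expect _ _ _ _ _ _ (fun l => \1_A l * pair_count R neq_rel l)); last first.
  move=> l _; rewrite pair_count_neq indicE.
  have [h|h] := boolP (2 <= l)%N; first by rewrite mem_set ?mul1r.
  rewrite memNset ?mul0r; last by move=> h'; rewrite h' in h.
  by case: l h => [|[|l]]// _; rewrite ?mulr0 ?mulr1 subrr.
by rewrite -expect_mkcond// /expect null_set_integral.
Qed.

Definition pgf (s : R) : R := fine (expect Q setT (fun l => s ^+ l)).

Lemma nnrv_expr (s : R) : 0 <= s -> nnrv (fun l : nat => s ^+ l).
Proof. by move=> s0; apply: nnrv_nat => l; exact: exprn_ge0. Qed.

Lemma pgfE s : 0 <= s <= 1 -> expect Q setT (fun l => s ^+ l) = (pgf s)%:E.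
Proof.
move=> /andP[s0 s1]; rewrite fineK// fin_num_abs gee0_abs; last exact/expect_ge0/nnrv_expr.
apply: (@le_lt_trans _ _ (expect Q setT (fun=> 1))).
  apply: le_expect => //; [exact: nnrv_expr|].
  by move=> l _; exact: exprn_ile1.
by rewrite expect_cst// probability_setT mule1 ltry.
Qed.

Lemma pgf_itv s : 0 <= s <= 1 -> 0 <= pgf s <= 1.
Proof.
move=> s01; have /andP[s0 s1] := s01; rewrite -!lee_fin -pgfE// expect_ge0 /=; last exact: nnrv_expr.
have <- : expect Q setT (fun=> 1) = 1%:E by rewrite expect_cst// probability_setT mule1.
apply: le_expect => //; [exact: nnrv_expr|].
by move=> l _; exact: exprn_ile1.
Qed.

(** Second-order Bernoulli inequalities. In the lower one, (1 - q)^l + l q is nondecreasing in l, so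
    that l = 2 is the worst case of at least two children. *)
Lemma expr_bernoulli (q : R) l : 0 <= q <= 1 ->
  1 + q ^+ 2 / 2 * pair_count R pair01 l <= (1 - q) ^+ l + l%:R * q <=
  1 + q ^+ 2 / 2 * pair_count R neq_rel l.
Proof.
move=> /andP[q0 q1]; rewrite pair_count01 pair_count_neq; apply/andP; split.
  case: l => [|[|l]] /=; rewrite ?expr0 ?expr1 ?mulr0 ?mul0r ?mul1r ?addr0 ?subrK//.
  rewrite divfK//; elim: l => [|l IH]; first by rewrite [in leRHS]sqrrB; lra.
  rewrite [(1 - q) ^+ l.+3]exprS -natr1; move: IH; set x := (1 - q) ^+ l.+2; set m := l.+2%:R => IH.
  have x1 : x <= 1 by rewrite exprn_ile1//; lra.
  have : 0 <= q * (1 - x) by rewrite mulr_ge0// subr_ge0.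
  by lra.
elim: l => [|l IH]; first by rewrite expr0 mul0r mul0r subrr mulr0.
rewrite exprS -natr1; have := IH; set x := (1 - q) ^+ l; set m := l%:R => h.
have m0 : 0 <= m by rewrite ler0n.
have x1 : 1 - m * q <= x.
  rewrite /x /m; elim: (l) => [|k IHk]; first by rewrite expr0 mul0r subr0.
  rewrite exprS -natr1.
  have : 0 <= (1 - q) ^+ k by rewrite exprn_ge0//; lra.
  have : (1 - q) ^+ k <= 1 by rewrite exprn_ile1//; lra.
  by have : 0 <= k%:R :> R by []; nra.
by nra.
Qed.

Lemma pgf_bounds q : 0 <= q <= 1 ->
  1 + q ^+ 2 / 2 * multi <= pgf (1 - q) + q <= 1 + q ^+ 2 / 2 * sigma2.
Proof.
move=> q01; have /andP[q0 q1] := q01.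
have q10 : 0 <= 1 - q by lra.
have q1' : 0 <= 1 - q <= 1 by lra.
have n1 := nnrv_expr q10.
have nid : nnrv (fun l : nat => l%:R : R) by apply: nnrv_nat.
have npc c : nnrv (pair_count R c) by apply: nnrv_nat => l; exact: pair_count_ge0.
have qq : 0 <= q ^+ 2 / 2 by rewrite divr_ge0// sqr_ge0.
have e0 : expect Q setT (fun l => (1 - q) ^+ l + q * l%:R) = (pgf (1 - q) + q)%:E.
  rewrite expectD//; last exact: nnrvZ.
  by rewrite expectZ// offspring_mean pgfE// mule1 EFinD.
have e1 c m : expect Q setT (pair_count R c) = m%:E ->
    expect Q setT (fun l => 1 + q ^+ 2 / 2 * pair_count R c l) = (1 + q ^+ 2 / 2 * m)%:E.
  move=> cm; rewrite expectD//; last exact: nnrvZ.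
  by rewrite expectZ// cm expect_cst// probability_setT mule1.
have nc c : nnrv (fun l => 1 + q ^+ 2 / 2 * pair_count R c l).
  by apply: nnrvD; [exact: nnrv_cst|exact: nnrvZ].
have ne : nnrv (fun l : nat => (1 - q) ^+ l + q * l%:R) by apply: nnrvD => //; exact: nnrvZ.
rewrite -!lee_fin -e0 -(e1 _ _ offspring_pairs) -(e1 _ _ offspring_pairs01).
by apply/andP; split; apply: le_expect => // l _;
  rewrite (mulrC q); have /andP[] := expr_bernoulli l q01.
Qed.

Definition qsurv n : R := 1 - iter n pgf 0.

Lemma iter_pgf_itv n s : 0 <= s <= 1 -> 0 <= iter n pgf s <= 1.
Proof. by move=> s01; elim: n => //= n; exact: pgf_itv. Qed.

Lemma qsurv_itv n : 0 <= qsurv n <= 1.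
Proof. by have := @iter_pgf_itv n 0; rewrite lexx ler01 => /(_ isT); rewrite /qsurv; lra. Qed.

Lemma qsurvS n : qsurv n - sigma2 / 2 * qsurv n ^+ 2 <= qsurv n.+1 <=
  qsurv n - multi / 2 * qsurv n ^+ 2.
Proof.
have := pgf_bounds (qsurv_itv n).
have -> : 1 - qsurv n = iter n pgf 0 by rewrite /qsurv subKr.
by rewrite [qsurv n.+1]/qsurv iterS; set p := pgf _; move=> /andP[? ?]; apply/andP; split; lra.
Qed.

(** A discrete form of the differential inequality q' <= - (m / 2) q^2, with m = [multi]; the start
    needs m <= 2. *)
Lemma qsurv_le n : qsurv n <= 2 / (multi * n.+1%:R).
Proof.
have m0 := multi_gt0.
have n0 k : 0 < k.+1%:R :> R by rewrite ltr0n.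
elim: n => [|n IH].
  by rewrite ler_pdivlMr ?mulr_gt0// /qsurv subr0 mul1r mulr1 multi_le2.
have /andP[_] := qsurvS n => /le_trans; apply; have /andP[q0 _] := qsurv_itv n.
set q := qsurv n in IH q0 *; set m := multi in IH m0 *.
have y1 : m / 2 * q * n.+1%:R <= 1.
  by move: IH; rewrite ler_pdivlMr ?mulr_gt0//; lra.
rewrite ler_pdivlMr ?mulr_gt0// -[n.+2%:R]natr1.
(* In the scaled variable, y (n + 1) <= 1 gives (y - y^2) (n + 2) <= (1 - y) (1 + y) <= 1 when y <=
   1. *)
pose y := m / 2 * q; have y0 : 0 <= y by rewrite /y; nra.
have y1' : y * n.+1%:R <= 1 by [].
have -> : (q - m / 2 * q ^+ 2) * (m * (n.+1%:R + 1)) = 2 * (y - y ^+ 2) * (n.+1%:R + 1).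
  by rewrite /y; field.
have : (y - y ^+ 2) * (n.+1%:R + 1) <= 1.
  have n1 : 0 <= n.+1%:R :> R by [].
  have [y1le|y1gt] := leP y 1; last by nra.
  have : y * (n.+1%:R + 1) <= 1 + y by lra.
  by nra.
by lra.
Qed.

(** Each of the k steps loses at most sigma2 / 2 times the square of the current value, and the
    values decrease. *)
Lemma qsurv_drop n k : qsurv n - qsurv (k + n) <= k%:R * (sigma2 / 2 * qsurv n ^+ 2).
Proof.
have [_ _ s0] := hQ.
have dec j : qsurv (j + n) <= qsurv n.
  elim: j => // j IH; apply: le_trans IH; rewrite addSn.
  have /andP[_ /le_trans] := qsurvS (j + n); apply.
  by rewrite gerBl// mulr_ge0 ?sqr_ge0// divr_ge0// ltW// multi_gt0.
elim: k => [|k IH]; first by rewrite subrr mul0r.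
have /andP[h _] := qsurvS (k + n).
have : sigma2 / 2 * qsurv (k + n) ^+ 2 <= sigma2 / 2 * qsurv n ^+ 2.
  have s20 : 0 <= sigma2 / 2 by lra.
  rewrite ler_wpM2l// ler_pXn2r ?nnegrE ?dec//.
    by have /andP[] := qsurv_itv (k + n).
  by have /andP[] := qsurv_itv n.
by rewrite addSn -[k.+1%:R]natr1 mulrDl mul1r; lra.
Qed.

End offspring.

(** * Moments *)

Section moments.
Context {disp : measure_display} {Omega : measurableType disp} {R : realType}.
Variables (P : probability Omega R) (Q : probability nat R) (sigma2 : R).
Variables (nchild : label -> Omega -> nat) (step : label -> Omega -> site 2).
Hypothesis hQ : critical_offspring Q sigma2.
Hypothesis hbrw : brw_driver P Q nchild step.

Notation EX := (expect P setT).
Notation G := (generation nchild).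
Notation X := (position step).
Notation history := (history nchild step).
Notation Z n w := (size (G n w)).

Let mean1 := offspring_mean hQ.
Let m : R := multi Q.

Lemma sigma2_gt0 : 0 < sigma2.
Proof. by have [] := hQ. Qed.

Lemma nnrv_size n (f : nat -> R) : (forall k, 0 <= f k) -> nnrv (fun w => f (Z n w)).
Proof.
by move=> f0; apply: (nnrv_history hbrw (n := n)) => // w w' h; rewrite (generation_eq h).
Qed.

Lemma expect_pgf n s : 0 <= s <= 1 ->
  EX (fun w => s ^+ Z n w) = (iter n (pgf Q) s)%:E.
Proof.
elim: n s => [|n IH] s s01.
  by rewrite (expect_cst P (s ^+ 1) measurableT) probability_setT mule1.
rewrite iterSr -IH; last exact: pgf_itv.
have /andP[s0 s1] := s01; have /andP[p0 p1] := pgf_itv Q s01.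
apply: (@expect_tower_history _ _ _ _ _ _ _ hbrw n).
- by apply: (nnrv_size n.+1 (f := fun k => s ^+ k)) => k; exact: exprn_ge0.
- by apply: (nnrv_size n (f := fun k => pgf Q s ^+ k)) => k; exact: exprn_ge0.
move=> w0; have [indC _] := indep_history_cell hbrw n w0; have mC := indC.1.
rewrite (@eq_expect _ _ _ _ _ _ (fun w => \prod_(u <- G n w0) s ^+ nchild u w)); last first.
  move=> w Cw; rewrite -sum1_size big_generationS -(generation_eq Cw) -prodrXr.
  by under [in LHS]eq_bigr => u _ do rewrite sum1_size size_iota.
rewrite (@eq_expect _ _ _ _ _ (fun w => pgf Q s ^+ Z n w) (fun=> pgf Q s ^+ Z n w0)); last first.
  by move=> w Cw; rewrite (generation_eq Cw).
have := @expect_indep_nchild _ _ _ _ _ _ _ hbrw _ _ _ (G n w0)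
  (fun _ l => s ^+ l) (fun=> pgf Q s) indC (uniq_generation _ _ _).
move=> -> //; last 3 first.
- by move=> u un; rewrite (size_generation un).
- by move=> u l; exact: exprn_ge0.
- by move=> u _; exact: pgfE.
by rewrite expect_cst// muleC big_const_seq count_predT -Monoid.iteropE.
Qed.

Lemma prob_size (A : set nat) n : measurable [set w | A (Z n w)].
Proof.
apply: (discrete_rv_factor (discrete_history hbrw n) (Y := fun w => Z n w)) A.
by move=> w w' h; rewrite (generation_eq h).
Qed.

Lemma prob_extinct n : P [set w | Z n w = 0%N] = (1 - qsurv Q n)%:E.
Proof.
have m0 := prob_size (fun k => k = 0%N) n.
rewrite probability_expect// /qsurv subKr -expect_pgf ?lexx ?ler01//.
apply: eq_expect => w _; rewrite indicE expr0n; case: eqP => h; first by rewrite mem_set.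
by rewrite memNset.
Qed.

Lemma prob_survival n : P (survival nchild n) = (qsurv Q n)%:E.
Proof.
rewrite (_ : survival _ _ = ~` [set w | Z n w = 0%N]); last first.
  by apply/seteqP; split => w /=; rewrite /survival /= -size_eq0 => /eqP.
rewrite probability_setC; last exact: (prob_size (fun k => k = 0%N)).
by rewrite prob_extinct -EFinB; congr EFin; lra.
Qed.

(** The event of extinction at time n + k contains extinction at time n and, when at most [l]
    particles remain, has conditional probability at least (1 - q_k)^l. The hypothesis makes [k]
    large enough for this to be at least 1/2. *)
Lemma prob_small n k l : 4 * l%:R <= m * k.+1%:R ->
  (P [set w | (0 < Z n w <= l)%N] <= (4 * k%:R * sigma2 / (m * n.+1%:R) ^+ 2)%:E)%E.
Proof.
move=> lk; have m0 : 0 < m := multi_gt0 hQ.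
have s0 := sigma2_gt0.
have mA := prob_size (fun j => (0 < j <= l)%N) n.
set A := [set w | _] in mA *.
have /andP[q0 q1] := qsurv_itv Q k.
set s := 1 - qsurv Q k.
have s01 : 0 <= s <= 1 by rewrite /s; lra.
have /andP[s0' s1'] := s01.
have m0n := prob_size (fun j => j = 0%N) n.
have key : ((1 - qsurv Q n)%:E + (s ^+ l)%:E * P A <= (1 - qsurv Q (k + n))%:E)%E.
  have -> : 1 - qsurv Q (k + n) = iter n (pgf Q) s.
    by rewrite /s /qsurv !subKr addnC iterD.
  rewrite -expect_pgf// -prob_extinct !probability_expect// -expectZ//; last 2 first.
  - exact: exprn_ge0.
  - exact: nnrv_indic.
  rewrite -expectD//; last 2 first.
  - exact: nnrv_indic.
  - by apply: nnrvZ; [exact: exprn_ge0|exact: nnrv_indic].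
  apply: le_expect => //.
  - apply: nnrvD; first exact: nnrv_indic.
    by apply: nnrvZ; [exact: exprn_ge0|exact: nnrv_indic].
  - by apply: (nnrv_size n (f := fun k => s ^+ k)) => j; exact: exprn_ge0.
  move=> w _; rewrite !indicE /A.
  case: (posnP (Z n w)) => z.
    rewrite mem_set//= z expr0 memNset ?mulr0 ?addr0//=.
    by rewrite z.
  rewrite memNset ?add0r/=; last by move=> e; rewrite e in z.
  have [zl|zl] := leqP (Z n w) l.
    by rewrite mem_set/= ?z ?zl// mulr1 ler_wiXn2l.
  by rewrite memNset/= ?mulr0 ?exprn_ge0// => /andP[_]; rewrite leqNgt zl.
have [p pE] : exists p, P A = p%:E.
  by exists (fine (P A)); rewrite fineK// fin_num_measure.
move: key; rewrite pE -EFinM -EFinD !lee_fin => key.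
have p0 : 0 <= p by rewrite -lee_fin -pE measure_ge0.
(* Since q_k <= 2 / (m (k + 1)), the hypothesis gives l q_k <= 1/2, and (1 - q_k)^l >= 1 - l q_k. *)
have sl : 2^-1 <= s ^+ l.
  have : qsurv Q k * l%:R <= 2^-1.
    have := qsurv_le hQ k; rewrite ler_pdivlMr ?mulr_gt0 ?ltr0n// -/m => qk.
    have kk : 0 < k.+1%:R :> R by rewrite ltr0n.
    have : qsurv Q k * (4 * l%:R) <= qsurv Q k * (m * k.+1%:R) by rewrite ler_wpM2l.
    by lra.
  have q01 : 0 <= qsurv Q k <= 1 by rewrite q0 q1.
  have /andP[+ _] := expr_bernoulli l q01.
  have : 0 <= qsurv Q k ^+ 2 / 2 * pair_count R pair01 l.
    by rewrite mulr_ge0 ?pair_count_ge0// divr_ge0// sqr_ge0.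
  by rewrite -/s; set a := s ^+ l; set b := qsurv Q k ^+ 2 / 2 * _; lra.
have drop := qsurv_drop hQ n k.
have qn := qsurv_le hQ n; rewrite -/m in qn.
have /andP[qn0 _] := qsurv_itv Q n.
have p_le : p <= 2 * (k%:R * (sigma2 / 2 * qsurv Q n ^+ 2)).
  have : 2^-1 * p <= s ^+ l * p by rewrite ler_wpM2r.
  by lra.
apply: (le_trans p_le).
have mn : 0 < m * n.+1%:R by rewrite mulr_gt0 ?ltr0n.
have q2 : qsurv Q n ^+ 2 <= 4 / (m * n.+1%:R) ^+ 2.
  have -> : 4 / (m * n.+1%:R) ^+ 2 = (2 / (m * n.+1%:R)) ^+ 2.
    by rewrite expr_div_n; congr (_ / _); rewrite -natrX.
  by rewrite ler_pXn2r ?nnegrE// divr_ge0// ltW.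
have -> : 4 * k%:R * sigma2 / (m * n.+1%:R) ^+ 2 =
    (k%:R * sigma2) * (4 / (m * n.+1%:R) ^+ 2) by ring.
have -> : 2 * (k%:R * (sigma2 / 2 * qsurv Q n ^+ 2)) = (k%:R * sigma2) * qsurv Q n ^+ 2.
  by field.
by rewrite ler_wpM2l// mulr_ge0// ltW.
Qed.

Definition meet_prob k : R := iter k pair_op diag2 (0 : site 2) 0.

Lemma iter_diag2 k x : iter k pair_op diag2 x x = meet_prob k.
Proof. exact: iter_pair_op_diag2xx. Qed.

(** The expected number of meetings at the times i + 1, ..., i + n of two walks started together;
    [hsum] is its explicit upper bound. The shift [i] follows the recursion. *)
Let rsum n i : R := \sum_(j < n) meet_prob (i + j).+1.
Let hsum n i : R := \sum_(j < n) 5 / 2 / ((i + j).+1).+1%:R.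

Lemma meet_prob_ge0 k : 0 <= meet_prob k.
Proof. exact: iter_pair_op_diag2_ge0. Qed.

Lemma diag2_ge0 (x y : site 2) : 0 <= diag2 x y :> R.
Proof. exact: ler0n. Qed.

Lemma diag3_ge0 (x y z : site 2) : 0 <= diag3 x y z :> R.
Proof. by rewrite mulr_ge0 ?diag2_ge0. Qed.

Lemma expect_pair01 n i :
  EX (pair_sum nchild step pair01 n (iter i pair_op diag2)) = (m * rsum n i)%:E.
Proof.
exact: (expect_pair_sum hbrw mean1 n i pair01_irr diag2_ge0 (offspring_pairs01 Q) iter_diag2).
Qed.

(** Each step of the recursion adds 2 m + sigma2 times a pair sum whose kernel is at most [kap]
    times the kernel of two walks. The factors [kap] add up to [hsum], and each pair sum is bounded
    by m times the whole [rsum]. *)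
Lemma expect_triple01 n i :
  (EX (triple_sum nchild step pair01 n (iter i triple_op diag3)) <=
   ((2 * m + sigma2) * m * hsum n i * rsum n i)%:E)%E.
Proof.
have m0 : 0 < m := multi_gt0 hQ; have s0 := sigma2_gt0.
elim: n i => [|n IH] i.
  rewrite (@eq_expect _ _ _ _ _ _ (fun=> 0)) ?expect_cst ?mul0e//.
    by rewrite /rsum big_ord0 mulr0.
  by move=> w _; rewrite /triple_sum /= !big_seq1 mul0r.
have t0 : forall x y z, 0 <= iter i triple_op diag3 x y z :> R.
  by move=> x y z; exact: iter_triple_op_diag3_ge0.
apply: le_trans (expect_triple_sumS hbrw mean1 pair01_irr pair01_fun
  (offspring_pairs01 Q) (offspring_pairs hQ) n t0) _.
(* The heat kernel bound at time i + 1, the kernel having received one more step. *)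
set kap := 5 / 2 / i.+2%:R : R.
have kap0 : 0 <= kap by rewrite divr_ge0.
have bnd (h : site 2 -> site 2 -> R) : (forall x y, 0 <= h x y) ->
    (forall x y, h x y <= kap * iter i.+1 pair_op diag2 x y) ->
    (EX (pair_sum nchild step pair01 n h) <= (kap * (m * rsum n i.+1))%:E)%E.
  move=> h0 hle; rewrite EFinM -expect_pair01.
  have np : nnrv (pair_sum nchild step pair01 n (iter i.+1 pair_op (@diag2 R))).
    by apply: (nnrv_pair_sum_diverge hbrw) => x y; exact: iter_pair_op_diag2_ge0.
  rewrite -expectZ//.
  apply: le_expect => //.
  - exact: (nnrv_pair_sum_diverge hbrw).
  - exact: nnrvZ.
  move=> w _; rewrite /pair_sum mulr_sumr; apply: ler_sum => u _.
  rewrite mulr_sumr; apply: ler_sum => v _.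
  by rewrite mulrCA ler_wpM2l.
have b1 : (EX (pair_sum nchild step pair01 n
     (fun x y => triple_op (iter i triple_op diag3) x x y)) <= (kap * (m * rsum n i.+1))%:E)%E.
  apply: bnd => x y; first exact: (@iter_triple_op_diag3_ge0 R i.+1).
  by rewrite -[leLHS]/(iter i.+1 triple_op diag3 x x y) iter_triple_op_diag3_swap;
    exact: iter_triple_op_diag3_le.
have b2 : (EX (pair_sum nchild step pair01 n
     (fun x y => triple_op (iter i triple_op diag3) x y x)) <= (kap * (m * rsum n i.+1))%:E)%E.
  apply: bnd => x y; first exact: (@iter_triple_op_diag3_ge0 R i.+1).
  exact: (@iter_triple_op_diag3_le R i.+1).
have b3 : (EX (pair_sum nchild step pair01 n
     (fun x y => triple_op (iter i triple_op diag3) x y y)) <= (kap * (m * rsum n i.+1))%:E)%E.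
  apply: bnd => x y; first exact: (@iter_triple_op_diag3_ge0 R i.+1).
  exact: (@iter_triple_op_diag3_le R i.+1).
have := IH i.+1; rewrite iterS => b0.
apply: (@le_trans _ _ (((2 * m + sigma2) * m * hsum n i.+1 * rsum n i.+1)%:E +
  (m%:E * (kap * (m * rsum n i.+1))%:E + (m%:E * (kap * (m * rsum n i.+1))%:E +
   sigma2%:E * (kap * (m * rsum n i.+1))%:E)))%E).
  apply: leeD => //; apply: leeD; first by apply: lee_wpmul2l => //; rewrite lee_fin ltW.
  by apply: leeD; apply: lee_wpmul2l => //; rewrite lee_fin ltW.
rewrite -!EFinM -!EFinD lee_fin.
have rle : rsum n i.+1 <= rsum n.+1 i.
  rewrite /rsum big_ord_recl /= ler_wpDl ?meet_prob_ge0//.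
  by apply: ler_sum => j _; rewrite /bump /= ?add1n addnS addSn.
have hE : hsum n.+1 i = kap + hsum n i.+1.
  rewrite /hsum big_ord_recl addn0; congr (_ + _).
  by apply: eq_bigr => j _; rewrite /bump /= ?add1n addnS addSn.
have h0 : 0 <= hsum n i.+1 by apply: sumr_ge0 => j _; rewrite divr_ge0.
rewrite hE.
apply: (@le_trans _ _ ((2 * m + sigma2) * m * (kap + hsum n i.+1) * rsum n i.+1)).
  by rewrite le_eqVlt; apply/orP; left; apply/eqP; ring.
by rewrite ler_wpM2l// !mulr_ge0 ?addr_ge0 ?mulr_ge0// ltW.
Qed.

Lemma hsumE n : hsum n 0 = 5 / 2 * \sum_(j < n) j.+2%:R^-1.
Proof. by rewrite mulr_sumr; apply: eq_bigr => j _; rewrite add0n. Qed.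

Lemma rsum_le n : rsum n 0 <= 5 / 2 * \sum_(j < n) j.+2%:R^-1.
Proof.
rewrite mulr_sumr; apply: ler_sum => j _; rewrite add0n.
exact: iter_pair_op_diag2_le.
Qed.

Lemma rsum_ge n : 72^-1 * \sum_(j < n) j.+2%:R^-1 <= rsum n 0.
Proof.
rewrite mulr_sumr; apply: ler_sum => j _; rewrite add0n.
exact: iter_pair_op_diag2_ge.
Qed.

Definition company n w u : R := \sum_(v <- G n w) diag2 (X u w) (X v w).

(* Counts only the particles at the site of [u] that descend from the sibling,
   paired by [pair01], of [u] or of one of its ancestors. *)
Definition company01 n w u : R :=
  \sum_(v <- G n w) (diverge pair01 u v)%:R * diag2 (X u w) (X v w).

Lemma company01_ge0 n w u : 0 <= company01 n w u.
Proof. by apply: sumr_ge0 => v _; rewrite mulr_ge0. Qed.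

Lemma company01_le n w u : company01 n w u <= company n w u.
Proof.
apply: ler_sum => v _; rewrite ler_piMl ?diag2_ge0//.
by case: (diverge _ _ _).
Qed.

Lemma expect_company01 n :
  EX (fun w => \sum_(u <- G n w) company01 n w u) = (m * rsum n 0)%:E.
Proof. exact: (expect_pair01 n 0). Qed.

(** Expanding the square, the diagonal terms return the sum itself, since the summands are 0 or
    1. *)
Lemma company01_sqr n w : \sum_(u <- G n w) company01 n w u ^+ 2 =
  triple_sum nchild step pair01 n diag3 w + \sum_(u <- G n w) company01 n w u.
Proof.
rewrite /triple_sum -big_split; apply: eq_bigr => u _ /=.
rewrite expr2 {1}/company01 mulr_suml -big_split; apply: eq_big_seq => v vn /=.
rewrite /company01 mulr_sumr.
rewrite -[X in _ + X](sum_diag (fun _ _ => (diverge pair01 u v)%:R * diag2 (X u w) (X v w)) vn).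
rewrite -big_split; apply: eq_bigr => t _ /=.
rewrite /branch3 /diag3 /diag2; case: (eqVneq v t) => [<-|vt].
  rewrite !andbF mul0r add0r mul1r.
  by case: (diverge _ _ _); case: (_ == _); rewrite ?(mul0r, mulr0, mul1r, mulr1).
rewrite andbT mul0r addr0.
by case: (diverge _ u v); case: (diverge _ u t); case: (_ == _); case: (_ == _);
   rewrite ?(mul0r, mulr0, mul1r, mulr1).
Qed.

Lemma nnrv_company01 n (f : R -> R) : (forall x, 0 <= x -> 0 <= f x) ->
  nnrv (fun w => \sum_(u <- G n w) f (company01 n w u)).
Proof.
move=> f0; apply: (nnrv_history hbrw (n := n)) => [w|w w' h].
  by apply: sumr_ge0 => u _; apply: f0; exact: company01_ge0.
rewrite (generation_eq h); apply: eq_big_seq => u un; congr f.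
rewrite /company01 (generation_eq h); apply: eq_big_seq => v vn.
by rewrite !(position_eq h).
Qed.

Lemma expect_company01_sqr n :
  (EX (fun w => (\sum_(u <- G n w) company01 n w u ^+ 2)%R) <=
   (m * rsum n 0 * ((2 * m + sigma2) * hsum n 0 + 1))%:E)%E.
Proof.
rewrite (@eq_expect _ _ _ _ _ _ (fun w => triple_sum nchild step pair01 n diag3 w +
  \sum_(u <- G n w) company01 n w u)); last by move=> w _; exact: company01_sqr.
rewrite expectD//; last 2 first.
- exact: (nnrv_triple_sum hbrw (a := fun u v t _ => (branch3 pair01 u v t)%:R) _ diag3_ge0).
- exact: (nnrv_company01 n (f := id)).
rewrite expect_company01; apply: le_trans (leeD (expect_triple01 n 0) (lexx _)) _.
rewrite -EFinD lee_fin le_eqVlt; apply/orP; left; apply/eqP; ring.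
Qed.

Lemma pair_sum_neq n (g : site 2 -> site 2 -> R) w :
  \sum_(u <- G n w) \sum_(v <- G n w) g (X u w) (X v w) =
  pair_sum nchild step neq_rel n g w + \sum_(u <- G n w) g (X u w) (X u w).
Proof.
rewrite /pair_sum -big_split; apply: eq_big_seq => u un /=.
rewrite -[X in _ + X](sum_diag (fun u v => g (X u w) (X v w)) un) -big_split.
apply: eq_big_seq => v vn /=.
rewrite diverge_neq ?(size_generation un) ?(size_generation vn)//.
by case: eqVneq => _; rewrite ?(mul0r, add0r, mul1r, addr0).
Qed.

(** The pair recursion for the constant kernel 1, which every step preserves. *)
Lemma expect_size_sqr n : EX (fun w => (Z n w)%:R ^+ 2) = (1 + n%:R * sigma2)%:E.
Proof.
have one0 : forall x y : site 2, 0 <= (fun _ _ => 1) x y :> R by [].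
have it1 k x : iter k pair_op (fun _ _ => 1) x x = 1 :> R.
  by rewrite iter_pair_opE (@eq_iter_walk_op _ _ _ (fun=> 1)) => [|y];
    rewrite iter_walk_op_cst.
have := expect_pair_sum hbrw mean1 n 0 neq_rel_irr one0 (offspring_pairs hQ) it1.
rewrite sumr_const card_ord -mulr_natl mulr1 mulrC /= => e1.
rewrite (@eq_expect _ _ _ _ _ _ (fun w => pair_sum nchild step neq_rel n (fun _ _ => 1) w +
  (Z n w)%:R)); last first.
  move=> w _; have := pair_sum_neq n (fun _ _ => 1) w.
  have s1 (x : R) : \sum_(u <- G n w) x = x *+ Z n w.
    by rewrite big_const_seq count_predT iter_addr_0.
  by rewrite !s1 expr2 mulr_natr => <-.
rewrite expectD//; last 2 first.
- exact: (nnrv_pair_sum_diverge hbrw).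
- exact: (nnrv_size n (f := fun k => k%:R)).
by rewrite e1 (expect_generation_size hbrw mean1) -EFinD addrC.
Qed.

Lemma expect_company n :
  EX (fun w => \sum_(u <- G n w) company n w u) = (1 + sigma2 * rsum n 0)%:E.
Proof.
have := expect_pair_sum hbrw mean1 n 0 neq_rel_irr diag2_ge0 (offspring_pairs hQ) iter_diag2.
rewrite /= -/(rsum n 0) => e1.
rewrite (@eq_expect _ _ _ _ _ _ (fun w => pair_sum nchild step neq_rel n diag2 w +
  (Z n w)%:R)); last first.
  move=> w _; rewrite /company pair_sum_neq; congr (_ + _).
  by rewrite -sum1_size natr_sum; apply: eq_bigr => u _; rewrite /diag2 eqxx.
rewrite expectD//; last 2 first.
- exact: (nnrv_pair_sum_diverge hbrw).
- exact: (nnrv_size n (f := fun k => k%:R)).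
by rewrite e1 (expect_generation_size hbrw mean1) -EFinD addrC.
Qed.

(** The inequality P(Z > 0) >= (E Z)^2 / E Z^2, linearized: x <= v / 2 + x^2 / (2 v) for x > 0. With
    v = E Z^2 and E Z = 1, integration gives 1 <= v q / 2 + 1/2. *)
Lemma qsurv_ge n : (1 + n%:R * sigma2)^-1 <= qsurv Q n.
Proof.
have s0 := sigma2_gt0; set v := 1 + n%:R * sigma2.
have v0 : 0 < v by rewrite /v ltr_pwDl// mulr_ge0// ltW.
have mS := prob_size (fun k => k <> 0%N) n.
have S_E : survival nchild n = [set w | Z n w <> 0%N].
  by apply/seteqP; split => w /=; rewrite /survival /= -size_eq0 => /eqP.
have : (1%:E <= (v / 2 * qsurv Q n + (2 * v)^-1 * v)%:E)%E.
  rewrite -(expect_generation_size hbrw mean1 n) EFinD (EFinM (v / 2)) (EFinM (2 * v)^-1) -prob_survival S_E.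
  have Ev : EX (fun w => (Z n w)%:R ^+ 2) = v%:E := expect_size_sqr n.
  rewrite probability_expect// -Ev.
  have ns : nnrv (fun w => (Z n w)%:R ^+ 2 : R).
    by apply: (nnrv_size n (f := fun k => k%:R ^+ 2)) => k; exact: sqr_ge0.
  have v20 : 0 <= v / 2 by rewrite divr_ge0// ltW.
  have v2i : 0 <= (2 * v)^-1 by rewrite invr_ge0 mulr_ge0// ltW.
  rewrite -!expectZ//; last exact: nnrv_indic.
  rewrite -expectD//; last 2 first.
  - by apply: nnrvZ => //; exact: nnrv_indic.
  - exact: nnrvZ.
  apply: le_expect => //.
  - exact: (nnrv_size n (f := fun k => k%:R)).
  - by apply: nnrvD; apply: nnrvZ => //; exact: nnrv_indic.
  move=> w _; rewrite indicE; case: (posnP (Z n w)) => z.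
    by rewrite z addr_ge0// mulr_ge0// sqr_ge0.
  rewrite mem_set/=; last by move=> e; rewrite e in z.
  rewrite mulr1; set x := (Z n w)%:R.
  have -> : v / 2 + (2 * v)^-1 * x ^+ 2 = x + (2 * v)^-1 * (x - v) ^+ 2.
    by field; rewrite gt_eqF.
  by rewrite lerDl mulr_ge0// sqr_ge0.
have -> : (2 * v)^-1 * v = 2^-1 by field; rewrite gt_eqF.
rewrite lee_fin => h.
rewrite -[leLHS]mul1r ler_pdivrMr//; lra.
Qed.

End moments.

(** * Typical particles *)

Section logarithm.
Context {R : realType}.

Lemma ln_succ_le n : ln n.+2%:R - ln n.+1%:R <= n.+1%:R^-1 :> R.
Proof.
rewrite -ln_div ?posrE ?ltr0n//.
have -> : n.+2%:R / n.+1%:R = 1 + n.+1%:R^-1 :> R.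
  by rewrite -[n.+2%:R]natr1 mulrDl mul1r mulfV ?pnatr_eq0.
by apply: le_ln1Dx; rewrite (lt_trans (ltrN10 R))// invr_gt0 ltr0n.
Qed.

Lemma ln_succ_ge n : n.+2%:R^-1 <= ln n.+2%:R - ln n.+1%:R :> R.
Proof.
rewrite -[leRHS]opprB lerNr -ln_div ?posrE ?ltr0n//.
have -> : n.+1%:R / n.+2%:R = 1 + - n.+2%:R^-1 :> R.
  by rewrite -[n.+2%:R]natr1; field; rewrite nat1r natr1 pnatr_eq0.
by apply: le_ln1Dx; rewrite ltrN2 invf_lt1 ?ltr0n// ltr1n.
Qed.

Lemma harmonic_le n : \sum_(j < n) j.+2%:R^-1 <= ln n.+1%:R :> R.
Proof.
elim: n => [|n IH]; first by rewrite big_ord0 ln1.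
rewrite big_ord_recr /=; apply: le_trans (lerD IH (ln_succ_ge n)) _.
by rewrite addrC subrK.
Qed.

Lemma harmonic_ge n : ln n.+2%:R - ln 2 <= \sum_(j < n) j.+2%:R^-1 :> R.
Proof.
elim: n => [|n IH]; first by rewrite big_ord0 subrr.
rewrite big_ord_recr /=; apply: le_trans (lerD IH (ln_succ_le n.+1)).
by rewrite [leRHS]addrC subrKA.
Qed.

(** The factors 2 absorb the additive constants; for n >= 2 they come from (n + 2)^2 >= 4 n and n +
    1 <= n^2. *)
Lemma harmonic_log n : (2 <= n)%N ->
  ln (n%:R : R) / 2 <= \sum_(j < n) (j.+2%:R^-1 : R) <= 2 * ln (n%:R : R).
Proof.
move=> n2; have n0 : (0 < n)%N by lia.
apply/andP; split.
  apply: le_trans (harmonic_ge n).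
  have : ln (2 * 2 * n%:R) <= ln (n.+2%:R * n.+2%:R) :> R.
    rewrite ler_ln ?posrE ?mulr_gt0 ?ltr0n//.
    by rewrite -!natrM ler_nat; nia.
  by rewrite !lnM ?posrE ?mulr_gt0 ?ltr0n//; lra.
apply: le_trans (harmonic_le n) _.
have : ln n.+1%:R <= ln (n%:R * n%:R) :> R.
  by rewrite ler_ln ?posrE ?mulr_gt0 ?ltr0n// -natrM ler_nat; nia.
by rewrite lnM ?posrE ?ltr0n//; lra.
Qed.

Lemma ln_ge_half n : (2 <= n)%N -> 1 <= 2 * ln n%:R :> R.
Proof.
move=> n2; have : ln 2 <= ln n%:R :> R by rewrite ler_ln ?posrE ?ltr0n ?ler_nat//; exact: ltnW.
have := @ln_succ_ge 0; rewrite ln1 subr0; lra.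
Qed.

End logarithm.

(** * The law of the count at the typical site *)

Section typical.
Context {disp : measure_display} {Omega : measurableType disp} {R : realType}.
Variables (P : probability Omega R) (Q : probability nat R).
Variables (nchild : label -> Omega -> nat) (step : label -> Omega -> site 2).
Variable V : nat -> Omega -> label.
Hypothesis hbrw : brw_driver P Q nchild step.
Hypothesis hV : typical_particle P nchild step V.

Notation EX := (expect P setT).
Notation G := (generation nchild).
Notation X := (position step).
Notation history := (history nchild step).
Notation Z n w := (size (G n w)).
Notation T := (typical_count nchild step V).

Lemma discrete_position u : discrete_rv (X u).
Proof.
elim/last_ind: u => [|u i IH].
  by move=> A; rewrite (_ : X [::] = cst 0) ?preimage_cst; [case: ifP|
    apply/funext => w; rewrite /position big_ord0].
apply: (discrete_rv_factor (X := fun w => (X u w, step (rcons u i) w))).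
  by apply: discrete_rv_pair => //; exact: brw_step_rv hbrw _.
by move=> w w' [e1 e2]; rewrite !position_rcons e1 e2.
Qed.

Lemma discrete_rv_select (I J : countType) (Y : Omega -> I) (F : I -> Omega -> J) :
  discrete_rv Y -> (forall i, discrete_rv (F i)) -> discrete_rv (fun w => F (Y w) w).
Proof.
move=> mY mF A.
rewrite (_ : _ @^-1` A = \bigcup_(i : I) (Y @^-1` [set i] `&` F i @^-1` A)).
  apply: countable_bigcupT_measurable => // i.
  by apply: measurableI; [exact: mY|exact: mF].
by apply/seteqP; split => [w Aw|w [i _ [/= -> ]]//]; exists (Y w).
Qed.

Lemma discrete_typical_count n : discrete_rv (T n).
Proof.
apply: (discrete_rv_factor (X := fun w => (history n w, X (V n w) w))).
  apply: discrete_rv_pair; first exact: (discrete_history hbrw).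
  by apply: discrete_rv_select; [exact: (hV n).1|exact: discrete_position].
move=> w w' e; have h := congr1 fst e; have x := congr1 snd e.
rewrite /typical_count -(generation_eq h) -[X (V n w') w']x.
apply: eq_in_count => v vn; rewrite (position_eq h)//.
by rewrite -(generation_eq h).
Qed.

Lemma typical_countE n w : (T n w)%:R = company nchild step n w (V n w) :> R.
Proof.
rewrite /typical_count -sum1_count natr_sum big_mkcond; apply: eq_bigr => v _.
by rewrite /diag2 eq_sym; case: eqP.
Qed.

Lemma company_eq n w w' u : history n w = history n w' -> u \in G n w' ->
  company nchild step n w u = company nchild step n w' u :> R.
Proof.
move=> h un; rewrite /company (generation_eq h); apply: eq_big_seq => v vn.
by rewrite !(position_eq h).
Qed.

Lemma measurable_survival n : measurable (survival nchild n).
Proof.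
apply: (discrete_rv_factor (discrete_history hbrw n) (Y := G n)) [set s | s != [::]].
by move=> w w' h; exact: generation_eq h.
Qed.

(** The variable Y_t; it is taken real because only its ratio to the size of the generation is
    integrated. *)
Definition crowded n (t : R) w : R :=
  \sum_(u <- G n w) (t <= company nchild step n w u)%R%:R.

Lemma crowded_ge0 n t w : 0 <= crowded n t w.
Proof. exact: sumr_ge0. Qed.

Lemma crowded_eq n t w w' : history n w = history n w' -> crowded n t w = crowded n t w'.
Proof.
move=> h; rewrite /crowded (generation_eq h); apply: eq_big_seq => u un.
by rewrite (company_eq h un).
Qed.

Lemma measurable_typical n t : measurable [set w | t <= (T n w)%:R :> R].
Proof. exact: (discrete_typical_count n [set k | t <= k%:R]). Qed.

Lemma nnrv_crowded n t : nnrv (fun w => (Z n w)%:R^-1 * crowded n t w).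
Proof.
apply: (nnrv_history hbrw (n := n)) => [w|w w' h].
  by rewrite mulr_ge0 ?invr_ge0 ?crowded_ge0.
by rewrite (generation_eq h) (crowded_eq _ h).
Qed.

(** On a history cell, the particles of the last generation have equal masses that add up to the
    whole cell. Sample points where [V n] falls outside the generation are not excluded, so the
    equality is obtained from two inequalities. *)
Lemma prob_typical n t :
  P ([set w | t <= (T n w)%:R] `&` survival nchild n) =
  EX (fun w => (Z n w)%:R^-1 * crowded n t w).
Proof.
have mB : measurable ([set w | t <= (T n w)%:R] `&` survival nchild n).
  by apply: measurableI; [exact: measurable_typical|exact: measurable_survival].
rewrite probability_expect//; set B := _ `&` _ in mB *.
have nB := nnrv_indic (R := R) mB.
apply: (@expect_tower_history _ _ _ _ _ _ _ hbrw n) => //; first exact: nnrv_crowded.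
move=> w0; set C := history_cell _ _ _ _.
have mC : measurable C := measurable_history_cell hbrw n w0.
set s := G n w0.
rewrite [RHS](@eq_expect _ _ _ _ _ _ (fun=> (size s)%:R^-1 * crowded n t w0)); last first.
  by move=> w Cw; rewrite (generation_eq Cw) (crowded_eq _ Cw).
rewrite expect_cst//.
have [pc pcE] : exists p, P C = p%:E.
  by exists (fine (P C)); rewrite fineK// fin_num_measure.
have pc0 : 0 <= pc by rewrite -lee_fin -pcE measure_ge0.
have [s0|sn0] := eqVneq s [::].
  rewrite /crowded -/s s0 big_nil mulr0 mul0e.
  rewrite (@eq_expect _ _ _ _ _ _ (fun=> 0)) ?expect_cst ?mul0e//.
  move=> w Cw; rewrite indicE memNset// => -[_]; rewrite /survival /=.
  by rewrite (generation_eq Cw) -/s s0 eqxx.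
have sz : (size s)%:R != 0 :> R by rewrite pnatr_eq0 size_eq0.
have mVu u : measurable [set w | V n w = u] by exact: ((hV n).1 [set u]).
have PV u : u \in s -> P (C `&` [set w | V n w = u]) = ((size s)%:R^-1 * pc)%:E.
  have := (hV n).2 (history n w0) u.
  rewrite last_history -generation_snapshot -/s => h us.
  have := h us; rewrite (_ : [set w | history n w = history n w0] = C)// pcE.
  by rewrite /snapshot size_map -/s.
have sumV (a : label -> bool) : expect P C (fun w => \sum_(u <- s)
      (a u)%:R * \1_([set w | V n w = u]) w) =
    ((size s)%:R^-1 * (\sum_(u <- s) (a u)%:R) * pc)%:E.
  have ni u : nnrv (\1_([set w | V n w = u]) : Omega -> R) by exact: nnrv_indic.
  rewrite expect_sum//; last by move=> u; exact: nnrvZ.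
  rewrite mulr_sumr mulr_suml -sumEFin; apply: eq_big_seq => u us.
  rewrite expectZ// /expect integral_indic// (setIC _ C).
  transitivity ((a u)%:R%:E * ((size s)%:R^-1 * pc)%:E)%E.
    by congr (_ * _)%E; exact: PV.
  by rewrite -EFinM; congr EFin; ring.
pose a u := t <= company nchild step n w0 u.
have nsum (a' : label -> bool) : nnrv (fun w => \sum_(u <- s)
      (a' u)%:R * \1_([set w | V n w = u]) w : R).
  by apply: nnrv_sum => u; apply: nnrvZ => //; exact: nnrv_indic.
have sV w (F : label -> R) : \sum_(u <- s) F u * \1_([set w | V n w = u]) w =
    if V n w \in s then F (V n w) else 0.
  case: ifPn => ws.
    rewrite (bigD1_seq _ ws (uniq_generation _ _ _))/= indicE mem_set// mulr1.
    rewrite big1 ?addr0// => u uV; rewrite indicE memNset ?mulr0//= => e.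
    by rewrite e eqxx in uV.
  rewrite big1_seq// => u /andP[_ us]; rewrite indicE memNset ?mulr0//= => e.
  by rewrite e us in ws.
have Bw w : C w -> V n w \in s -> \1_B w = (a (V n w))%:R :> R.
  move=> Cw Vs; rewrite indicE /a -(company_eq Cw Vs) -typical_countE.
  case: (boolP (t <= (T n w)%:R)) => ht.
    rewrite mem_set//; split => //; rewrite /survival /= (generation_eq Cw).
    by apply: contraTneq Vs => e; rewrite /s e.
  by rewrite memNset// => -[/= h _]; rewrite h in ht.
have [pb pbE] : exists p, expect P C \1_B = p%:E.
  by exists (fine (P (B `&` C))); rewrite /expect integral_indic// fineK// fin_num_measure//; exact: measurableI.
have lo : (expect P C (fun w => (\sum_(u <- s) (a u)%:R * \1_([set w | V n w = u]) w)%R)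
    <= expect P C \1_B)%E.
  apply: le_expect => // w Cw; rewrite sV; case: ifP => Vs; first by rewrite Bw.
  by rewrite indicE.
(* The upper bound is the lower bound for the complementary set of particles; as the masses exhaust
   [P C], the two bounds coincide. *)
have hi : (expect P C \1_B + expect P C (fun w => (\sum_(u <- s)
    (~~ a u)%:R * \1_([set w | V n w = u]) w)%R) <= P C)%E.
  rewrite -expectD// -[leRHS]mul1e -(expect_cst P 1 mC).
  apply: le_expect => //; first exact: nnrvD.
  move=> w Cw; rewrite (sV w (fun u => (~~ a u)%:R)); case: ifP => Vs.
    by rewrite Bw//; case: (a _); rewrite ?addr0 ?add0r.
  by rewrite addr0 indicE; case: (_ \in _).
move: lo hi; rewrite !sumV pbE pcE -!EFinD !lee_fin -EFinM => lo hi.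
have cmpl : \sum_(u <- s) (~~ a u)%:R = (size s)%:R - \sum_(u <- s) (a u)%:R :> R.
  apply/eqP; rewrite eq_sym subr_eq -big_split -sum1_size natr_sum /=; apply/eqP.
  by apply: eq_bigr => u _; case: (a u); rewrite ?addr0 ?add0r.
congr EFin; apply/eqP; rewrite eq_le; apply/andP; split; last exact: lo.
move: hi; rewrite cmpl mulrBr mulVf// mulrBl mul1r.
by rewrite /crowded -/s /a; lra.
Qed.

End typical.

Lemma limn_einf_ge (R : realType) (u : nat -> \bar R) (l : \bar R) N :
  (forall n, (N <= n)%N -> (l <= u n)%E) -> (l <= limn_einf u)%E.
Proof.
move=> ul; rewrite limn_einf_lim (cvg_lim _ (@cvg_einfs_sup _ u))//.
apply: le_trans (ereal_sup_ubound _); last by exists N.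
by apply: le_ereal_inf_tmp => _ [n /= Nn <-]; exact: ul.
Qed.

(** * Tightness and the lower bound on the logarithmic scale *)

Section typical_site.
Context {disp : measure_display} {Omega : measurableType disp} {R : realType}.
Variables (P : probability Omega R) (Q : probability nat R) (sigma2 : R).
Variables (nchild : label -> Omega -> nat) (step : label -> Omega -> site 2).
Variable V : nat -> Omega -> label.
Hypothesis hQ : critical_offspring Q sigma2.
Hypothesis hbrw : brw_driver P Q nchild step.
Hypothesis hV : typical_particle P nchild step V.

Notation EX := (expect P setT).
Notation G := (generation nchild).
Notation Z n w := (size (G n w)).
Notation T := (typical_count nchild step V).
Notation S := (survival nchild).

Let m : R := multi Q.
Let m_gt0 : 0 < m := multi_gt0 hQ.
Let s_gt0 : 0 < sigma2 := sigma2_gt0 hQ.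
Let meets n : R := \sum_(j < n) meet_prob (0 + j).+1.
Let L n : R := ln n%:R.

(** The heat kernel constants 1/72 and 5/2 combined with the factors 1/2 and 2 of [harmonic_log]. *)
Let meets_bounds n : (2 <= n)%N -> L n / 144 <= meets n <= 5 * L n.
Proof.
move=> n2; have /andP[h1 h2] := @harmonic_log R n n2.
by have := rsum_ge (R := R) n; have := rsum_le (R := R) n;
  rewrite -/(meets n) /L; lra.
Qed.

Let L_gt0 n : (2 <= n)%N -> 0 < L n.
Proof. by move=> n2; have := @ln_ge_half R n n2; rewrite /L; lra. Qed.

Let p n (t : R) : R := fine (P ([set w | t <= (T n w)%:R] `&` S n)).

Let pE n t : P ([set w | t <= (T n w)%:R] `&` S n) = (p n t)%:E.
Proof.
rewrite fineK// fin_num_measure//; apply: measurableI.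
  exact: (measurable_typical hbrw hV).
exact: (measurable_survival hbrw).
Qed.

(** The proportion of crowded particles is at most 1 when at most [l] particles are alive; otherwise
    its denominator is at least l + 1 and Markov's inequality bounds its numerator. *)
Lemma prob_typical_le n t l k : 0 < t -> 4 * l%:R <= m * k.+1%:R ->
  p n t <= 4 * k%:R * sigma2 / (m * n.+1%:R) ^+ 2 +
           (1 + sigma2 * meets n) / (t * l.+1%:R).
Proof.
move=> t0 lk; have l0 : 0 < l.+1%:R :> R by rewrite ltr0n.
rewrite -lee_fin -pE (prob_typical hbrw hV).
apply: le_trans (_ : _ <= P [set w | (0 < Z n w <= l)%N] +
   ((t * l.+1%:R)^-1)%:E * EX (fun w => (\sum_(u <- G n w) company nchild step n w u)%R))%E _.
  have mA := prob_size hbrw (fun k => (0 < k <= l)%N) n.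
  have c0 : 0 <= (t * l.+1%:R)^-1 by rewrite invr_ge0 mulr_ge0// ltW.
  have nc : nnrv (fun w => \sum_(u <- G n w) company nchild step n w u : R).
    apply: (nnrv_history hbrw (n := n)) => [w|w w' h].
      by apply: sumr_ge0 => u _; apply: sumr_ge0.
    by rewrite (generation_eq h); apply: eq_big_seq => u un; rewrite (company_eq h un).
  rewrite probability_expect// -expectZ// -expectD//; last 2 first.
  - exact: nnrv_indic.
  - exact: nnrvZ.
  apply: le_expect => //.
  - exact: (nnrv_crowded hbrw).
  - by apply: nnrvD; [exact: nnrv_indic|exact: nnrvZ].
  move=> w _; rewrite indicE.
  have Sc : 0 <= \sum_(u <- G n w) company nchild step n w u :> R.
    by apply: sumr_ge0 => u _; apply: sumr_ge0.
  case: (posnP (Z n w)) => z.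
    rewrite (size0nil z) /crowded (size0nil z) !big_nil !mulr0 addr0.
    by [].
  have zR : 0 < (Z n w)%:R :> R by rewrite ltr0n.
  have [zl|zl] := leqP (Z n w) l.
    rewrite mem_set/= ?z//; apply: (@le_trans _ _ 1); last first.
      by rewrite lerDl mulr_ge0.
    rewrite ler_pdivrMl// mulr1 /crowded -sum1_size natr_sum.
    by apply: ler_sum => u _; case: (t <= _).
  rewrite memNset/=; last by move=> /andP[_]; rewrite leqNgt zl.
  rewrite add0r invfM -[leRHS]mulrA [leRHS]mulrCA; apply: ler_pM.
  - by rewrite invr_ge0.
  - exact: crowded_ge0.
  - by rewrite lef_pV2 ?posrE// ler_nat.
  rewrite mulr_sumr; apply: ler_sum => u _.
  case: (boolP (t <= _)) => h.
    by rewrite ler_pdivlMl ?mulr1.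
  by apply: mulr_ge0; [rewrite invr_ge0 ltW|exact: sumr_ge0].
rewrite (expect_company hQ hbrw) -EFinM EFinD; apply: leeD; first exact: (prob_small hQ hbrw n lk).
by rewrite lee_fin mulrC.
Qed.

(** The parameters are free so that [b], then [K], can be chosen large and [eps] small, leaving a
    fixed part of the left side to the term with [p]. The factor K n there converts the proportion
    of crowded particles back into their number. *)
Lemma prob_typical_ge n eps b K : (2 <= n)%N -> 0 < eps -> 0 < b -> 0 < K ->
  m * meets n <= eps * L n + b * L n * (K * n%:R) * p n (eps * L n) +
    b * L n * (1 + sigma2) / K +
    m * meets n * ((2 * m + sigma2) * (5 * L n) + 2 * L n) / (b * L n).
Proof.
move=> n2 e0 b0 K0; have L0 := L_gt0 n2.
have n0 : 0 < n%:R :> R by rewrite ltr0n; lia.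
have bL0 : 0 < b * L n by rewrite mulr_gt0.
have Kn0 : 0 < K * n%:R by rewrite mulr_gt0.
set c1 := eps * L n.
have c10 : 0 <= c1 by rewrite mulr_ge0// ltW.
(* Chosen so that c2 / Z >= b L if Z <= K n, c3 Z >= b L if Z > K n, and c4 x^2 >= x if x >= b L. *)
pose c2 := b * L n * (K * n%:R); pose c3 := b * L n / (K * n%:R); pose c4 := (b * L n)^-1.
have c20 : 0 <= c2 by rewrite mulr_ge0// ltW.
have c30 : 0 <= c3 by rewrite divr_ge0// ltW.
have c40 : 0 <= c4 by rewrite invr_ge0 ltW.
have /andP[r1 r2] := meets_bounds n2.
have meets0 : 0 <= meets n by apply: le_trans r1; rewrite divr_ge0// ltW.
have nZ : nnrv (fun w => (Z n w)%:R : R) := nnrv_size hbrw n (fun k => ler0n R k).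
have nZ2 : nnrv (fun w => (Z n w)%:R ^+ 2 : R).
  by apply: (nnrv_size hbrw n (f := fun k => k%:R ^+ 2)) => k; exact: sqr_ge0.
have nY := nnrv_crowded (R := R) hbrw n c1.
have n01 := nnrv_company01 (R := R) hbrw n (f := id) (fun x x0 => x0).
have n012 := nnrv_company01 (R := R) hbrw n (f := fun x => x ^+ 2) (fun x _ => sqr_ge0 x).
have key : (EX (fun w => (\sum_(u <- G n w) company01 nchild step n w u)%R) <=
    c1%:E * EX (fun w => (Z n w)%:R) +
    (c2%:E * EX (fun w => ((Z n w)%:R^-1 * crowded nchild step n c1 w)%R) +
    (c3%:E * EX (fun w => ((Z n w)%:R ^+ 2)%R) +
     c4%:E * EX (fun w => (\sum_(u <- G n w) company01 nchild step n w u ^+ 2)%R))))%E.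
  have n1 := nnrvZ c10 nZ; have n2' := nnrvZ c20 nY.
  have n3 := nnrvZ c30 nZ2; have n4 := nnrvZ c40 n012.
  rewrite -!expectZ// -!expectD//; try exact: nnrvD; last by apply: nnrvD => //; exact: nnrvD.
  apply: le_expect => //; first by apply: nnrvD => //; apply: nnrvD => //; exact: nnrvD.
  move=> w _.
  have zE (x : R) : x * (Z n w)%:R = \sum_(u <- G n w) x.
    by rewrite big_const_seq count_predT iter_addr_0 mulr_natr.
  case: (posnP (Z n w)) => z.
    rewrite z (size0nil z) /crowded (size0nil z) !big_nil.
    by rewrite expr0n /= !mulr0 !addr0.
  have zR : 0 < (Z n w)%:R :> R by rewrite ltr0n.
  (* The crowded particles are counted by the second term when [Z <= K n] and
     by the third one otherwise; the particles with [company01 > b L] are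
     counted by the last one. *)
  apply: (@le_trans _ _ (\sum_(u <- G n w) (c1 +
     (c2 * (Z n w)%:R^-1 * (c1 <= company nchild step n w u)%R%:R +
     (c3 * (Z n w)%:R + c4 * company01 nchild step n w u ^+ 2))))); last first.
    rewrite big_split big_split big_split /=.
    rewrite -!zE -!mulr_sumr -/(crowded nchild step n c1 w) expr2 !mulrA.
    by [].
  apply: ler_sum => u _; set x := company01 _ _ _ _ _.
  have x0 : 0 <= x := company01_ge0 _ _ _ _ _.
  have xc : x <= company nchild step n w u := company01_le _ _ _ _ _.
  have t20 : 0 <= c2 * (Z n w)%:R^-1 by rewrite mulr_ge0// invr_ge0 ltW.
  have t2' : 0 <= c2 * (Z n w)%:R^-1 * (c1 <= company nchild step n w u)%R%:R.
    by rewrite mulr_ge0.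
  have t30 : 0 <= c3 * (Z n w)%:R by rewrite mulr_ge0.
  have t40 : 0 <= c4 * x ^+ 2 by rewrite mulr_ge0// sqr_ge0.
  have [xb|xb] := leP (b * L n) x.
    have : x <= c4 * x ^+ 2.
      by rewrite /c4 ler_pdivlMl// expr2 ler_wpM2r.
    by lra.
  have [xe|xe] := ltP x c1; first by lra.
  have cc : c1 <= company nchild step n w u by apply: le_trans xc.
  rewrite cc mulr1 in t2' *.
  have [zK|zK] := leP (Z n w)%:R (K * n%:R).
    have : b * L n <= c2 * (Z n w)%:R^-1.
      by rewrite /c2 ler_pdivlMr// ler_wpM2l// ltW.
    by lra.
  have : b * L n <= c3 * (Z n w)%:R.
    by rewrite /c3 -mulrA; apply: ler_peMr; [exact: ltW|rewrite ler_pdivlMl// mulr1 ltW].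
  by lra.
move: key; rewrite (expect_company01 hQ hbrw) (expect_generation_size hbrw (offspring_mean hQ)).
rewrite (expect_size_sqr hQ hbrw) -(prob_typical hbrw hV) pE mule1 -!EFinM => key.
have := le_trans key (leeD (lexx _) (leeD (lexx _) (leeD (lexx _)
  (lee_wpmul2l _ (expect_company01_sqr hQ hbrw n))))).
rewrite lee_fin c40 => /(_ isT).
rewrite -!EFinM -!EFinD lee_fin -/m -/(meets n) => {}key.
apply: (le_trans key); rewrite -!addrA lerD2l lerD2l.
apply: lerD.
  have -> : b * L n * (1 + sigma2) / K = c3 * (n%:R * (1 + sigma2)).
    by rewrite /c3; field; rewrite !gt_eqF.
  by apply: (ler_wpM2l c30); rewrite mulrDr mulr1 lerD2r ler1n ltnW.
rewrite mulrC; apply: (ler_wpM2r c40).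
apply: ler_wpM2l; first by rewrite mulr_ge0// ltW.
have hh : \sum_(j < n) 5 / 2 / ((0 + j).+1).+1%:R <= 5 * L n.
  rewrite hsumE; have /andP[_] := @harmonic_log R n n2; rewrite /L; lra.
apply: lerD; last by have := @ln_ge_half R n n2; rewrite /L; lra.
by rewrite ler_wpM2l// addr_ge0 ?mulr_ge0// ltW.
Qed.

Lemma typical_tight : bigOP P (fun n w => (T n w)%:R) (fun n => ln n%:R) S.
Proof.
move=> e e0; have s0 := s_gt0; have m0 := m_gt0.
(* The bound 1 + sigma2 * [meets n] <= [C1] * [L n] uses 1 <= 2 ln n. *)
pose C1 := 2 + 5 * sigma2.
have C10 : 0 < C1 by rewrite /C1; lra.
(* With the threshold d n on the population, the small-population term becomes 16 d sigma2 / (m^3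
   n), half of [e] times the lower bound 1 / (n (1 + sigma2)) of the survival probability. Then [M]
   gives the other half to the Markov term C1 / (M d n). *)
pose d := e * m ^+ 3 / (32 * sigma2 * (1 + sigma2)).
have s1 : 0 < 1 + sigma2 by lra.
have d0 : 0 < d by rewrite /d divr_gt0 ?mulr_gt0 ?exprn_gt0.
pose M := 2 * C1 * (1 + sigma2) / (d * e).
have M0 : 0 < M by apply: divr_gt0; apply: mulr_gt0 => //; exact: mulr_gt0.
exists [set` `[0, M]]; split; first exact: (@segment_compact R 0 M).
move=> n /= Ln0.
(* The logarithm is 0 at 1 and, by convention, at 0, so its positivity leaves exactly n >= 2. *)
have n2 : (2 <= n)%N.
  by case: n Ln0 => [|[|]]//; rewrite ?ln1 ?ltxx// ln0 ?ltxx.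
have nN : (0 < n)%N by lia.
have n0 : 0 < n%:R :> R by rewrite ltr0n.
have L0 := L_gt0 n2; have t0 : 0 < M * L n by rewrite mulr_gt0.
rewrite /cond_prob (prob_survival hbrw) /=.
have q0 := qsurv_ge hQ hbrw n.
have v0 : 0 < 1 + n%:R * sigma2 by rewrite ltr_pwDl// mulr_ge0// ltW.
have q_gt0 : 0 < qsurv Q n by apply: lt_le_trans q0; rewrite invr_gt0.
rewrite ler_pdivrMr//.
apply: (@le_trans _ _ (p n (M * L n))).
  have mT : measurable [set w | (~` [set` `[0, M]]) ((T n w)%:R / ln n%:R : R)].
    exact: (discrete_typical_count hbrw hV n [set k | (~` [set` `[0, M]]) (k%:R / ln n%:R : R)]).
  have mS := measurable_survival hbrw n.
  rewrite fine_le ?fin_num_measure//.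
  - exact: measurableI.
  - by apply: measurableI => //; exact: (measurable_typical hbrw hV).
  apply: le_measure; [apply: mem_set; exact: measurableI| |].
    by apply: mem_set; apply: measurableI => //; exact: (measurable_typical hbrw hV).
  apply: setSI => w /= /negP; rewrite in_itv /= negb_and -!ltNge => /orP[|h].
    by rewrite ltNge divr_ge0// ltW.
  by rewrite -ler_pdivlMr// ltW.
(* Integer parts: [l] is about d n, and [k] is the least order of delay allowed by [prob_small],
   about 4 l / m. *)
pose l := Num.trunc (d * n%:R); pose k := Num.trunc (4 * l%:R / m).
have dn0 : 0 <= d * n%:R by rewrite mulr_ge0// ltW.
have lle : l%:R <= d * n%:R by have := truncn_itv dn0 => /andP[].
have ltl : d * n%:R < l.+1%:R by have := truncn_itv dn0 => /andP[].
have lm0 : 0 <= 4 * l%:R / m by rewrite divr_ge0 ?mulr_ge0// ltW.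
have kle : k%:R <= 4 * l%:R / m by have := truncn_itv lm0 => /andP[].
have ltk : 4 * l%:R / m < k.+1%:R by have := truncn_itv lm0 => /andP[].
have lk : 4 * l%:R <= m * k.+1%:R by rewrite (mulrC m) -ler_pdivrMr// ltW.
apply: le_trans (prob_typical_le n t0 lk) _.
have q1 : (n%:R * (1 + sigma2))^-1 <= qsurv Q n.
  apply: le_trans q0; rewrite lef_pV2 ?posrE ?mulr_gt0//.
  by rewrite mulrDr mulr1 lerD2r ler1n ltnW.
apply: (@le_trans _ _ (e * (n%:R * (1 + sigma2))^-1)); last by rewrite ler_wpM2l// ltW.
have h1 : 4 * k%:R * sigma2 / (m * n.+1%:R) ^+ 2 <= e / 2 * (n%:R * (1 + sigma2))^-1.
  apply: (@le_trans _ _ (4 * (4 * (d * n%:R) / m) * sigma2 / (m * n%:R) ^+ 2)).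
    apply: ler_pM.
    - by rewrite !mulr_ge0// ltW.
    - by rewrite invr_ge0 exprn_ge0// mulr_ge0// ltW.
    - apply: (ler_wpM2r (ltW s0)); apply: ler_wpM2l => //; apply: le_trans kle _.
      by apply: ler_wpM2r; [rewrite invr_ge0 ltW|exact: ler_wpM2l].
    rewrite lef_pV2 ?posrE ?exprn_gt0 ?mulr_gt0 ?ltr0n//.
    rewrite ler_pXn2r ?nnegrE ?mulr_ge0//; try exact: ltW.
    by apply: (ler_wpM2l (ltW m0)); rewrite ler_nat.
  rewrite le_eqVlt; apply/orP; left; apply/eqP; rewrite /d; field.
  by rewrite !gt_eqF.
have h2 : (1 + sigma2 * meets n) / (M * L n * l.+1%:R) <= e / 2 * (n%:R * (1 + sigma2))^-1.
  apply: (@le_trans _ _ (C1 * L n / (M * L n * (d * n%:R)))).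
    have /andP[_ r2] := meets_bounds n2.
    have := @ln_ge_half R n n2; rewrite -/(L n) => r3.
    have r4 : sigma2 * meets n <= sigma2 * (5 * L n) by rewrite ler_wpM2l// ltW.
    have mt0 : 0 <= meets n by apply: sumr_ge0 => j _; exact: meet_prob_ge0.
    apply: ler_pM.
    - by rewrite addr_ge0// mulr_ge0// ltW.
    - by rewrite invr_ge0 mulr_ge0// ltW.
    - by rewrite /C1; lra.
    rewrite lef_pV2 ?posrE; last 2 first.
    - by rewrite mulr_gt0// ltr0n.
    - by apply: mulr_gt0 => //; exact: mulr_gt0.
    by apply: ler_wpM2l; exact: ltW.
  rewrite le_eqVlt; apply/orP; left; apply/eqP; rewrite /M; field.
  by rewrite !gt_eqF.
by apply: le_trans (lerD h1 h2) _; rewrite -mulrDl -splitr.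
Qed.

Lemma typical_large : exists eps : R, 0 < eps /\ exists delta : R, 0 < delta /\
  (delta%:E <= limn_einf (fun n =>
     (cond_prob P [set w | eps * ln n%:R <= (T n w)%:R] (S n))%:E))%E.
Proof.
have s0 := s_gt0; have m0 := m_gt0.
(* The expected truncated count is at least a L. The choices of [eps], [b] and [K] give at most a L
   / 4 to each of the three other terms, which leaves p >= a / (4 b K n); dividing by q_n <= 2 / (m
   n) yields the value of delta. *)
pose a := m / 144; have a0 : 0 < a by rewrite divr_gt0.
pose D := 5 * m * (5 * (2 * m + sigma2) + 2).
have D0 : 0 < D by rewrite /D; nra.
pose b := 4 * D / a; have b0 : 0 < b by rewrite divr_gt0// mulr_gt0.
pose K := 4 * b * (1 + sigma2) / a.
have s1 : 0 < 1 + sigma2 by lra.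
have K0 : 0 < K by apply: divr_gt0 => //; apply: mulr_gt0 => //; exact: mulr_gt0.
pose eps := a / 4; have eps0 : 0 < eps by rewrite divr_gt0.
exists eps; split => //; exists (m * a / (8 * b * K)); split.
  by apply: divr_gt0; apply: mulr_gt0 => //; exact: mulr_gt0.
apply: (@limn_einf_ge _ _ _ 2) => n n2; rewrite lee_fin /cond_prob.
rewrite (prob_survival hbrw) -[fine _]/(p n (eps * L n)) /=.
have L0 := L_gt0 n2; have n0 : 0 < n%:R :> R by rewrite ltr0n; lia.
have q0 : 0 < qsurv Q n.
  apply: lt_le_trans (qsurv_ge hQ hbrw n).
  by rewrite invr_gt0 ltr_pwDl// mulr_ge0// ltW.
have := prob_typical_ge n2 eps0 b0 K0; have /andP[r1 r2] := meets_bounds n2.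
set x := p n (eps * L n) => key.
have x0 : 0 <= x by rewrite -lee_fin -pE measure_ge0.
have m1 : a * L n <= m * meets n by rewrite /a; nra.
have t3 : b * L n * (1 + sigma2) / K = a / 4 * L n.
  by rewrite /K; field; rewrite !gt_eqF.
have t4 : m * meets n * ((2 * m + sigma2) * (5 * L n) + 2 * L n) / (b * L n) <= a / 4 * L n.
  apply: (@le_trans _ _ (m * (5 * L n) * ((2 * m + sigma2) * (5 * L n) + 2 * L n) / (b * L n))).
    apply: ler_wpM2r; first by rewrite invr_ge0 ltW// mulr_gt0.
    apply: ler_wpM2r; last exact: (ler_wpM2l (ltW m0)).
    by nra.
  rewrite le_eqVlt; apply/orP; left; apply/eqP; rewrite /b /D; field.
  by rewrite !gt_eqF// /a; nra.
have xge : a / 4 <= b * K * n%:R * x.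
  have : a / 4 * L n <= b * K * n%:R * x * L n by rewrite /eps in key; lra.
  by rewrite ler_pM2r.
have qle := qsurv_le hQ n; rewrite -/m in qle.
have n1 : 0 < n.+1%:R :> R by rewrite ltr0n.
rewrite ler_pdivlMr//; apply: (@le_trans _ _ (m * a / (8 * b * K) * (2 / (m * n%:R)))).
  apply: ler_wpM2l.
    by apply/ltW/divr_gt0; apply: mulr_gt0 => //; exact: mulr_gt0.
  apply: le_trans qle _; apply: ler_wpM2l => //.
  rewrite lef_pV2 ?posrE ?mulr_gt0//.
  by apply: (ler_wpM2l (ltW m0)); rewrite ler_nat.
have -> : m * a / (8 * b * K) * (2 / (m * n%:R)) = (a / 4) / (b * K * n%:R).
  by field; rewrite !gt_eqF.
have bKn : 0 < b * K * n%:R by apply: mulr_gt0 => //; exact: mulr_gt0.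
by rewrite ler_pdivrMr// [leRHS]mulrC.
Qed.

End typical_site.

Theorem theorem6 (R : realType) (disp : measure_display)
    (Omega : measurableType disp) (P : probability Omega R)
    (Q : probability nat R) (sigma2 : R)
    (nchild : label -> Omega -> nat) (step : label -> Omega -> site 2)
    (V : nat -> Omega -> label)
    (hQ : critical_offspring Q sigma2)
    (hbrw : brw_driver P Q nchild step)
    (hV : typical_particle P nchild step V) :
  let T := typical_count nchild step V in
  let G := survival nchild in
  bigOP P (fun n w => (T n w)%:R) (fun n => ln n%:R) G /\
  exists eps : R, 0 < eps /\ exists delta : R, 0 < delta /\
    (delta%:E <=
      limn_einf (fun n =>
        (cond_prob P [set w | eps * ln n%:R <= (T n w)%:R] (G n))%:E))%E.
Proof.
split; first exact: (typical_tight hQ hbrw hV).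
exact: (typical_large hQ hbrw hV).
Qed.
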